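(* Let $M$ be a complete Riemannian manifold (possibly infinite-dimensional), and $\Omega$ a bounded open subset of $M$ with boundary $\partial\Omega$. Then the function $x\mapsto d(x,\partial\Omega):=\inf\{d(x,y) : y\in\partial\Omega\}$ is a viscosity solution of the equation $$\|du(x)\|_{x}=1 \text{ for all } x\in\Omega,\qquad u(x)=0 \text{ for all } x\in\partial\Omega.$$ Moreover, if $M$ is uniformly locally convex and has a positive injectivity radius, then $d(\cdot,\partial\Omega)$ is the unique viscosity solution of this equation.
   Context: A Riemannian manifold is a $C^\infty$ manifold modelled on a Hilbert space (possibly infinite-dimensional) with a $C^\infty$ assignment of scalar products on the tangent spaces $TM_p$ inducing equivalent norms $\|\cdot\|_p$ (the same symbol denotes the dual norm on $T^*M_p$); $d$ is the Riemannian distance, $B(x,r)$ the open $d$-ball, $B(0_x,r)$ the open ball of $TM_x$. For a function $u$ and $x\in\Omega$, $D^{-}u(x)$ (resp. $D^{+}u(x)$) is the set of all $d\varphi(x)$ with $\varphi$ a $C^1$ function such that $u-\varphi$ attains a local minimum (resp. local maximum) at $x$. A function $u:\overline{\Omega}\to\mathbb{R}$ is a viscosity solution of the equation ''$\|du(x)\|_{x}=1$ for all $x\in\Omega$, $u(x)=0$ for all $x\in\partial\Omega$'' if $u$ is continuous; $u=0$ on $\partial\Omega$; $\|\zeta\|_{x}\ge1$ for all $\zeta\in D^{-}u(x)$, $x\in\Omega$; and $\|\zeta\|_x\le1$ for all $\zeta\in D^{+}u(x)$, $x\in\Omega$. The injectivity radius $i(M,x)$ is the supremum of the $r>0$ such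 that $\exp_x$ restricted to $B(0_x,r)$ is a $C^\infty$ diffeomorphism onto its image, and the injectivity radius of $M$ is $i(M)=\inf_x i(M,x)$. A set $U\subset M$ is convex if any $x,y\in U$ are joined by a unique geodesic in $U$ and its length is $d(x,y)$; $M$ is uniformly locally convex if there is $c>0$ such that for all $x\in M$ and $0<r<c$ the ball $B(x,r)=\exp_xB(0_x,r)$ is convex. *)

(* Defs.v *)
From HB Require Import structures.
From mathcomp Require Import all_boot all_order all_algebra.
From mathcomp Require Import all_classical all_reals all_analysis.

Set Implicit Arguments.
Unset Strict Implicit.
Unset Printing Implicit Defensive.

Import Order.TTheory GRing.Theory Num.Theory.
Import numFieldNormedType.Exports.

Local Open Scope classical_set_scope.
Local Open Scope ring_scope.

(* To be used with H complete: the norm of H comes from a scalar product. *)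
Definition hilbert_norm (R : realType) (H : normedModType R) : Prop :=
  exists dot : {bilinear H -> H -> R^o},
    (forall v w, dot v w = dot w v) /\ (forall v, dot v v = `|v| ^+ 2).

Section Smoothness.
Context (R : realType) (V W : normedModType R).

(* A k-linear map V x ... x V -> W is represented by a function on sequences
   of vectors, of which only the values on sequences of size k matter. *)
Definition bounded_multilinear (k : nat) (L : seq V -> W) : Prop :=
  (forall (us ws : seq V) (a : R) (v v' : V), (size us + size ws).+1 = k ->
     L (us ++ (a *: v + v') :: ws) = a *: L (us ++ v :: ws) + L (us ++ v' :: ws))
  /\ (exists C : R, forall vs : seq V, size vs = k ->
        `|L vs| <= C * \prod_(v <- vs) `|v|).

(* C^oo on the open set U of a map F with values in the normed space of bounded
   m-linear maps: D x is, on sequences of size m + k, the k-th Frechet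
   derivative of F at x, the vectors of differentiation being put in front.  The
   last clause is differentiability in the operator norm of the multilinear
   maps. *)
Definition smooth_multilinear_on (m : nat) (U : set V) (F : V -> seq V -> W) :
    Prop :=
  exists D : V -> seq V -> W,
    [/\ forall x vs, U x -> size vs = m -> D x vs = F x vs,
        forall k x, (m <= k)%N -> U x -> bounded_multilinear k (D x) &
        forall k x, (m <= k)%N -> U x -> forall e : R, 0 < e ->
          \forall h \near (0 : V), forall vs : seq V, size vs = k ->
            `|D (x + h) vs - D x vs - D x (h :: vs)|
              <= e * `|h| * \prod_(v <- vs) `|v| ].

Definition smooth_on (U : set V) (f : V -> W) : Prop :=
  smooth_multilinear_on 0 U (fun x _ => f x).

Definition C1_on (U : set V) (f : V -> W) : Prop :=
  forall x, U x -> differentiable f x /\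
    forall e : R, 0 < e ->
      \forall y \near x, forall v, `|'d f y v - 'd f x v| <= e * `|v|.

End Smoothness.

(* The C^oo atlas is a family of charts indexed by [chart]; [cmap i] is a
   homeomorphism of [cdom i] onto an open set of H with inverse [cinv i], both
   maps being junk elsewhere.  [chart_at p] is a preferred chart around p, used
   only to identify the tangent space TM_p with H. *)
Record hilbert_manifold (R : realType) (H : normedModType R)
    (M : topologicalType) := HilbertManifold {
  chart : Type;
  cdom : chart -> set M;
  cmap : chart -> M -> H;
  cinv : chart -> H -> M;
  chart_at : M -> chart;
  cdom_open : forall i, open (cdom i);
  cimg_open : forall i, open (cmap i @` cdom i);
  cmapK : forall i p, cdom i p -> cinv i (cmap i p) = p;
  cmap_continuous : forall i p, cdom i p -> {for p, continuous (cmap i)};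
  cinv_continuous : forall i p, cdom i p ->
    {for cmap i p, continuous (cinv i)};
  chart_atP : forall p, cdom (chart_at p) p;
  transition_smooth : forall i j,
    smooth_on (cmap i @` (cdom i `&` cdom j)) (cmap j \o cinv i);
  manifold_hausdorff : hausdorff_space M;
  manifold_connected : connected [set: M]
}.

Section ManifoldMaps.
Context (R : realType) (H : normedModType R) (M : topologicalType).
Variable X : hilbert_manifold H M.

Definition cimg (i : chart X) : set H := cmap i @` cdom i.

(* For v in H, the vector with coordinates v in the chart i at the point of
   coordinates y, seen in TM_p = H where p = cinv i y. *)
Definition to_tangent (i : chart X) (y : H) (v : H) : H :=
  'd (cmap (chart_at X (cinv i y)) \o cinv i) y v.

Definition C1_function (phi : M -> R) : Prop :=
  forall i : chart X, C1_on (cimg i) (phi \o cinv i : H -> R^o).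

(* d phi (p), a linear form on TM_p = H. *)
Definition dfun (phi : M -> R) (p : M) : H -> R :=
  'd (phi \o cinv (chart_at X p) : H -> R^o) (cmap (chart_at X p) p).

(* C^oo maps between M and its model space, on open sets. *)
Definition smooth_to (B : set H) (f : H -> M) : Prop :=
  (forall v, B v -> {for v, continuous f}) /\
  (forall i : chart X, smooth_on (B `&` f @^-1` cdom i) (cmap i \o f)).

Definition smooth_from (O : set M) (f : M -> H) : Prop :=
  forall i : chart X, smooth_on (cmap i @` (cdom i `&` O)) (f \o cinv i).

Definition diffeo_onto_image (B : set H) (f : H -> M) : Prop :=
  [/\ smooth_to B f, open (f @` B) &
      exists f' : M -> H,
        (forall v, B v -> f' (f v) = v) /\ smooth_from (f @` B) f'].

Definition C1_curve_on (A : set R) (c : R -> M) : Prop :=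
  forall t, A t -> {for t, continuous c} /\
    forall i : chart X, cdom i (c t) ->
      (\forall s \near t, derivable (cmap i \o c : R -> H) s 1) /\
      {for t, continuous ((cmap i \o c : R -> H)^`()%classic)}.

(* C^1 on [a, b] means C^1 extendable to a neighbourhood of [a, b]. *)
Definition piecewise_C1 (a b : R) (c : R -> M) : Prop :=
  exists2 s : seq R, itv_partition a b s &
    forall k, (k < size s)%N ->
      exists e (c' : R -> M),
        let t0 := nth b (a :: s) k in let t1 := nth b (a :: s) k.+1 in
        [/\ 0 < e, C1_curve_on [set` `]t0 - e, t1 + e[ ] c' &
            {in `[t0, t1], c =1 c'}].

(* The velocity c'(t), in TM_(c t) = H. *)
Definition velocity (c : R -> M) (t : R) : H :=
  (cmap (chart_at X (c t)) \o c : R -> H)^`()%classic t.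

End ManifoldMaps.

(* [metric p] is the scalar product of TM_p, where TM_p is identified with H
   through the chart [chart_at p].  Smoothness is that of the local
   representatives y |-> g_i(y), as maps to the bounded bilinear forms on H. *)
Record riemannian_manifold (R : realType) (H : normedModType R)
    (M : topologicalType) := RiemannianManifold {
  rmanifold :> hilbert_manifold H M;
  metric : M -> {bilinear H -> H -> R^o};
  metric_sym : forall p v w, metric p v w = metric p w v;
  metric_equiv : forall p, exists c C : R, 0 < c /\
    forall v, c * `|v| ^+ 2 <= metric p v v <= C * `|v| ^+ 2;
  metric_smooth : forall i : chart rmanifold,
    smooth_multilinear_on (W := R^o) 2 (cimg i)
      (fun y vs => metric (cinv i y) (to_tangent i y (nth 0 vs 0))
                                     (to_tangent i y (nth 0 vs 1)))
}.

Section RiemannianGeometry.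
Context (R : realType) (H : normedModType R) (M : topologicalType).
Variable X : riemannian_manifold H M.

Definition tnorm (p : M) (v : H) : R := Num.sqrt (metric X p v v).

Definition dual_norm (p : M) (zeta : H -> R) : R :=
  sup [set `|zeta v| | v in [set v | tnorm p v <= 1]].

Definition tball (p : M) (r : R) : set H := [set v | tnorm p v < r].

(* Length of c on [0, 1]. *)
Definition curve_length (c : R -> M) : R :=
  \int[@lebesgue_measure R]_(t in `[0, 1]) tnorm (c t) (velocity X c t).

Definition rdist (x y : M) : R :=
  inf [set curve_length c | c in [set c : R -> M |
    [/\ piecewise_C1 X 0 1 c, c 0 = x & c 1 = y]]].

Definition rball (x : M) (r : R) : set M := [set y | rdist x y < r].

Definition rcomplete : Prop :=
  forall u : nat -> M,
    (forall e : R, 0 < e -> exists N, forall m n,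
       (N <= m)%N -> (N <= n)%N -> rdist (u m) (u n) < e) ->
    exists l, forall e : R, 0 < e -> exists N, forall n,
       (N <= n)%N -> rdist (u n) l < e.

Definition rbounded (A : set M) : Prop :=
  exists C : R, forall x y, A x -> A y -> rdist x y <= C.

(* g_i(y)(v, w) and its derivative at y in the direction u. *)
Definition local_metric (i : chart X) (y v w : H) : R :=
  metric X (cinv i y) (to_tangent i y v) (to_tangent i y w).

Definition dlocal_metric (i : chart X) (y u v w : H) : R :=
  'd (fun z => local_metric i z v w : R^o) y u.

(* g_i(y)(Gamma_i(y)(u, v), w), by Koszul's formula for constant fields. *)
Definition christoffel (i : chart X) (y u v w : H) : R :=
  2^-1 * (dlocal_metric i y u v w + dlocal_metric i y v u w
          - dlocal_metric i y w u v).

(* In a chart, c'' + Gamma(c', c') = 0, tested against all vectors w. *)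
Definition geodesic_on (A : set R) (c : R -> M) : Prop :=
  forall t, A t -> {for t, continuous c} /\
    forall i : chart X, cdom i (c t) ->
      let x : R -> H := cmap i \o c in
      [/\ \forall s \near t, derivable x s 1,
          derivable (x^`()%classic) t 1 &
          forall w, local_metric i (x t) (x^`(2)%classic t) w
            + christoffel i (x t) (x^`()%classic t) (x^`()%classic t) w = 0].

(* Geodesics on [0, 1], i.e. on a neighbourhood of [0, 1]. *)
Definition geodesic_arc (c : R -> M) : Prop :=
  exists2 e : R, 0 < e & geodesic_on [set` `]- e, 1 + e[ ] c.

(* The default value x is irrelevant when X is complete, exp_x being then
   defined on the whole of TM_x. *)
Definition exp_map (x : M) (v : H) : M :=
  xget x [set y | exists c : R -> M,
    [/\ geodesic_arc c, c 0 = x, velocity X c 0 = v & c 1 = y]].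

Local Open Scope ereal_scope.

Definition injectivity_radius_at (x : M) : \bar R :=
  ereal_sup [set r%:E | r in [set r : R |
    (0 < r)%R /\ diffeo_onto_image X (tball x r) (exp_map x)]].

Definition injectivity_radius : \bar R :=
  ereal_inf (range injectivity_radius_at).

Local Close Scope ereal_scope.

Definition joins_in (U : set M) (x y : M) (c : R -> M) : Prop :=
  [/\ geodesic_arc c, c 0 = x, c 1 = y & forall t, t \in `[0, 1] -> U (c t)].

(* Uniqueness is that of the parametrization by [0, 1], which is affine. *)
Definition geodesically_convex (U : set M) : Prop :=
  forall x y, U x -> U y -> exists c,
    [/\ joins_in U x y c, curve_length c = rdist x y &
        forall c', joins_in U x y c' -> {in `[0, 1], c' =1 c}].

Definition uniformly_locally_convex : Prop :=
  exists2 delta : R, 0 < delta & forall x r, 0 < r < delta ->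
    rball x r = exp_map x @` tball x r /\ geodesically_convex (rball x r).

Definition subdifferential (u : M -> R) (x : M) : set (H -> R) :=
  [set dfun X phi x | phi in [set phi : M -> R | C1_function X phi /\
    \forall y \near x, u x - phi x <= u y - phi y]].

Definition superdifferential (u : M -> R) (x : M) : set (H -> R) :=
  [set dfun X phi x | phi in [set phi : M -> R | C1_function X phi /\
    \forall y \near x, u y - phi y <= u x - phi x]].

Definition boundary (A : set M) : set M := closure A `\` A°.

(* A function on the closure of Omega is the restriction of some u : M -> R;
   since Omega is open, the values of u elsewhere play no role. *)
Definition viscosity_solution (Omega : set M) (u : M -> R) : Prop :=
  [/\ {within closure Omega, continuous u},
      forall x, boundary Omega x -> u x = 0,
      forall x zeta, Omega x -> subdifferential u x zeta ->
        1 <= dual_norm x zeta &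
      forall x zeta, Omega x -> superdifferential u x zeta ->
        dual_norm x zeta <= 1].

(* Meaningful for A nonempty: the infimum of the empty set of reals is 0 here. *)
Definition rdist_set (x : M) (A : set M) : R := inf [set rdist x y | y in A].

End RiemannianGeometry.

(* Main.v *)
Require Import Defs.
From HB Require Import structures.
From mathcomp Require Import all_boot all_order all_algebra.
From mathcomp Require Import all_classical all_reals all_analysis.
From mathcomp Require Import measurable_realfun ring lra.

(** Let u = d(., bd Omega), bd denoting the boundary.  Two facts make the theorem
true: d is a length metric, and the dual norm of a differential measures slopes
with respect to d.

Existence.  In a chart around p the metric is, up to a factor close to 1, the
constant scalar product of TM_p ([chart_norm_near]).  Segments bound d from above
([rdist_le_gnorm]) and, because short curves cannot escape from the chart, lengths
of coordinates bound it from below ([gnorm_le_rdist]).  Therefore the dual norm of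
d phi(x) is the largest rate at which the C^1 function phi decreases from x per
unit of d ([C1_function_slope], [dual_norm_slope]).  The function u is
1-Lipschitz, and walking towards a nearly nearest boundary point decreases it at
nearly unit rate ([rdist_between]); so test functions above u have slope at most
1 and test functions below u have slope at least 1.

Uniqueness.  Let u be any solution.  The conditions on differentials are first
turned into metric ones:
- superdifferentials of norm at most 1 make u locally Lipschitz with every
  constant k > 1 ([locally_lipschitz]);
- subdifferentials of norm at least 1 let u decrease from every point of Omega at
  a rate arbitrarily close to 1 ([strict_descent]).
Both are proved by contradiction: if the conclusion failed, a cone would touch u
from above or below, up to a small error, with a forbidden slope.  Balls of H are
not compact, so the point of contact is produced by the smooth variational
principle of Borwein and Preiss ([smooth_variational_principle]), which in a
Hilbert space needs nothing but quadratic perturbations.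

These local statements are then made global by a maximality argument in the
complete metric space M ([maximal_descent]), in the manner of Ekeland and Caristi.
Walking from x towards a boundary point y0, with u varying at most at nearly unit
rate, one must end on the boundary, where u = 0: thus |u(x)| <= d(x, y0)
([viscosity_solution_le]), and u <= d(., bd Omega).  Letting u decrease from x at
nearly unit rate, one must also end on the boundary, so u(x) >= d(x, bd Omega)
([viscosity_solution_ge]).  The latter descent requires u to be bounded below,
which follows from the former inequality and the boundedness of Omega. *)

Set Implicit Arguments.
Unset Strict Implicit.
Unset Printing Implicit Defensive.

Import Order.TTheory GRing.Theory Num.Theory.
Import numFieldNormedType.Exports.

Local Open Scope classical_set_scope.
Local Open Scope ring_scope.

(** * Continuous induction, Cauchy sequences and C^1 maps *)

(** The usual least-upper-bound argument packaged as an induction principle: a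
property that propagates a little to the right and passes to limits from the
left reaches the end of the interval.  It serves for curves that could leave a
chart, where the property itself (being in the chart) is needed to speak of
coordinates. *)
Lemma real_induction (R : realType) (a b : R) (P : R -> Prop) :
  P a ->
  (forall t, a <= t < b -> P t -> \forall s \near t, t < s -> P s) ->
  (forall t, a < t <= b -> (forall s, a <= s < t -> P s) -> P t) ->
  forall t, a <= t <= b -> P t.
Proof.
move=> Pa Pnext Plim.
pose S := [set t | a <= t <= b /\ forall s, a <= s <= t -> P s].
move=> t0 /andP[at0 t0b]; have ab : a <= b := le_trans at0 t0b.
have Sa : S a.
  by split; rewrite ?lexx //= => s /andP[u v]; rewrite (_ : s = a) //; apply/le_anti/andP.
have ubS : ubound S b by move=> t [/andP[]].
have supS : has_sup S by split; [exists a | exists b].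
set m := sup S.
have am : a <= m by apply: ub_le_sup => //; exists b.
have mb : m <= b by apply: ge_sup => //; exists a.
have Plt s : a <= s < m -> P s.
  move=> /andP[as_ /sup_gt-/(_ (ex_intro _ a Sa))[t [_ Pt] st]].
  by apply: Pt; rewrite as_ ltW.
have Pm : P m.
  have [->//|ma] := eqVneq m a.
  by apply: Plim => //; rewrite mb lt_neqAle eq_sym ma am.
have Ple s : a <= s <= m -> P s.
  by move=> /andP[as_]; rewrite le_eqVlt => /predU1P[->//|sm]; apply: Plt; rewrite as_.
have [mE|mNb] := eqVneq m b; first by apply: Ple; rewrite at0 mE.
have mltb : m < b by rewrite lt_neqAle mNb.
have /Pnext/(_ Pm) : a <= m < b by rewrite am.
move=> /nbhs_ballP[e /= e0 He]; exfalso.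
(* A point beyond the supremum m up to which P still holds. *)
pose m' := Num.min b (m + e / 2).
have mm' : m < m' by rewrite lt_min mltb ltrDl divr_gt0.
suff : m' <= m by rewrite leNgt mm'.
apply: ub_le_sup; first by exists b.
split; first by rewrite (le_trans am (ltW mm'))/= ge_min lexx.
move=> s /andP[as_ sm']; have [sm|ms] := leP s m; first by apply: Ple; rewrite as_.
apply: He => //; rewrite /ball/= ltr0_norm ?subr_lt0// opprB ltrBlDr.
rewrite (le_lt_trans sm')// gt_min; apply/orP; right.
by rewrite addrC ltrD2r ltr_pdivrMr// ltr_pMr// ltrDl.
Qed.

Lemma cvg_geometric_increments (R : realType) (V : completeNormedModType R)
    (x : nat -> V) (C : R) :
  (forall n, `|x n.+1 - x n| <= C * 2^-1 ^+ n) -> exists l : V, x @ \oo --> l.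
Proof.
move=> Hx; apply/cvg_ex => /=.
have -> : x = (fun n => x 0%N + series (fun n => x n.+1 - x n) n).
  by apply/funext => n; rewrite /series/= telescope_sumr// addrC subrK.
apply: is_cvgD; first exact: is_cvg_cst.
apply: normed_cvg.
apply: (@series_le_cvg _ _ (geometric C 2^-1)) => //.
- by move=> n /=; exact: normr_ge0.
- by move=> n /=; exact: le_trans (normr_ge0 _) (Hx n).
- apply: is_cvg_geometric_series; rewrite ger0_norm ?invr_ge0// invf_lt1//; lra.
Qed.

Section diff_eps.
Variables (R : realType) (V W : normedModType R).
Implicit Types (f : V -> W) (x : V).

Lemma diff_le_eps f x : differentiable f x -> forall e, 0 < e ->
  \forall h \near (0 : V), `|f (x + h) - f x - 'd f x h| <= e * `|h|.
Proof.
move=> df e e0.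
have /eqaddoP/(_ e e0) : (fun h => f (h + x)) = (fun h => f x + 'd f x h) +o_ (0 : V) id.
  by have := diff_locally df.
by apply: filterS => h /=; rewrite !fctE/= opprD addrA (addrC h).
Qed.

(** Together with [diff_le_eps], this trades the little-o of the definition for
inequalities valid near 0; linearity and boundedness of the candidate [L] are
asked for as plain hypotheses because [L] is usually an explicit formula. *)
Lemma diff_eps f (L : V -> W) x :
  (forall k u v, L (k *: u + v) = k *: L u + L v) ->
  (exists C, forall v, `|L v| <= C * `|v|) ->
  (forall e, 0 < e ->
    \forall h \near (0 : V), `|f (x + h) - f x - L h| <= e * `|h|) ->
  differentiable f x /\ forall v, 'd f x v = L v.
Proof.
move=> Llin [C LC] Lo.
pose Lm := GRing.isLinear.Build R V W *:%R L Llin.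
pose L' : {linear V -> W} := HB.pack L Lm.
have L'c : continuous L'.
  apply/linear_bounded_continuous.
  apply/linear_boundedP; near=> r => v; rewrite (le_trans (LC v))//.
  by apply: ler_wpM2r => //; near: r; apply: nbhs_pinfty_ge; rewrite num_real.
have fE : f \o shift x = cst (f x) + L' +o_ (0 : V) id.
  apply/eqaddoP => e e0; apply: filterS (Lo e e0) => h /=.
  by rewrite !fctE/= opprD addrA (addrC h).
have dE := diff_unique L'c fE.
split; last by move=> v; rewrite dE.
by apply/diff_locallyP; rewrite dE.
Unshelve. all: by end_near. Qed.

End diff_eps.

(** Regularity at one point: test functions are built by hand and are regular only
near the point of contact, so [C1_on] on a whole open set is too rigid. *)
Definition C1at (R : realType) (V W : normedModType R) (f : V -> W) (x : V) :=
  (\forall y \near x, differentiable f y) /\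
  forall e : R, 0 < e -> \forall y \near x, forall v,
    `|'d f y v - 'd f x v| <= e * `|v|.

Section C1at_general.
Variables (R : realType) (V W : normedModType R).
Implicit Types (f g : V -> W) (x y : V).

Lemma diff_bounded f x : differentiable f x ->
  exists2 C, 0 < C & forall v, `|'d f x v| <= C * `|v|.
Proof.
move=> /diff_continuous/linear_bounded_continuous/linear_boundedP.
by move=> /pinfty_ex_gt0[C C0 HC]; exists C.
Qed.

Lemma diff_near_eq f g x : (\forall y \near x, f y = g y) ->
  differentiable f x -> differentiable g x /\ forall v, 'd g x v = 'd f x v.
Proof.
move=> fg df; apply: diff_eps => [k u v||e e0].
- by rewrite linearP.
- by have [C _ HC] := diff_bounded df; exists C.
- have fgx : f x = g x := nbhs_singleton fg.
  have fg0 : \forall h \near (0 : V), f (x + h) = g (x + h).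
    by move: fg; rewrite (near_shift 0) subr0; apply: filterS => h; rewrite /= addrC.
  by apply: filterS2 (diff_le_eps df e0) fg0 => h; rewrite -fgx => + <-.
Qed.

Lemma C1at_differentiable f x : C1at f x -> differentiable f x.
Proof. by case=> /nbhs_singleton. Qed.

Lemma C1_on_at (U : set V) f x : open U -> C1_on U f -> U x -> C1at f x.
Proof.
move=> oU fU Ux; split; last by have [] := fU _ Ux.
by near do apply: (fU _ _).1; exact: open_nbhs_nbhs.
Unshelve. all: by end_near. Qed.

Lemma C1at_on (U : set V) f : (forall x, U x -> C1at f x) -> C1_on U f.
Proof. by move=> fU x /fU fx; split; [exact: C1at_differentiable|case: fx]. Qed.

Lemma C1at_near_eq f g x : (\forall y \near x, f y = g y) ->
  C1at f x -> C1at g x.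
Proof.
move=> /near_join fg [df fc]; split.
  by apply: filterS2 fg df => y fg /(diff_near_eq fg)[].
have dfx := nbhs_singleton df; have fgx := nbhs_singleton fg.
move=> e e0; apply: filterS3 fg df (fc e e0) => y fg dfy fe v.
by rewrite (diff_near_eq fg dfy).2 (diff_near_eq fgx dfx).2.
Qed.

Lemma C1at_cst (c : W) x : C1at (cst c) x.
Proof.
split; first by near do exact: differentiable_cst.
by move=> e e0; near=> y => v; rewrite !diff_cst subrr normr0 mulr_ge0// ltW.
Unshelve. all: by end_near. Qed.

Lemma C1at_add f g x : C1at f x -> C1at g x -> C1at (fun y => f y + g y) x.
Proof.
move=> [df fc] [dg gc]; split.
  by apply: filterS2 df dg => y ? ?; apply: differentiableD.
have dfx := nbhs_singleton df; have dgx := nbhs_singleton dg.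
move=> e e0; have e20 : 0 < e / 2 by rewrite divr_gt0.
apply: filterS3 (filterI df dg) (fc _ e20) (gc _ e20) => y [dfy dgy] fe ge v.
rewrite (diffD dfy dgy) (diffD dfx dgx) /= opprD addrACA.
apply: le_trans (ler_normD _ _) _; rewrite [e in leRHS]splitr mulrDl.
exact: lerD (fe v) (ge v).
Qed.

End C1at_general.

Lemma diff_comp_apply (R : realType) (U V W : normedModType R) (f : U -> V)
    (g : V -> W) x v : differentiable f x -> differentiable g (f x) ->
  'd (g \o f) x v = 'd g (f x) ('d f x v).
Proof. by move=> df dg; rewrite (diff_comp df dg). Qed.

Lemma C1at_comp (R : realType) (U V W : normedModType R) (f : U -> V)
  (g : V -> W) x : C1at f x -> C1at g (f x) -> C1at (g \o f) x.
Proof.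
move=> [df fc] [dg gc].
have dfx := nbhs_singleton df; have dgx := nbhs_singleton dg.
have fcont : {for x, continuous f} by exact: differentiable_continuous.
have dgf : \forall y \near x, differentiable g (f y) := fcont _ dg.
split.
  by apply: filterS2 df dgf => y ? ?; apply: differentiable_comp.
have [Cf Cf0 HCf] := diff_bounded dfx; have [Cg Cg0 HCg] := diff_bounded dgx.
move=> e e0.
pose e1 := e / 2 / (Cf + 1); have e10 : 0 < e1 by rewrite !divr_gt0// addr_gt0.
(* The bound 1 keeps |'d f y v| below (Cf + 1) |v|; the other one absorbs Cg. *)
pose e2 := Num.min 1 (e / 2 / Cg); have e20 : 0 < e2.
  by rewrite lt_min ltr01 !divr_gt0.
have gcf := fcont _ (gc _ e10).
apply: filterS3 (filterI df dgf) (fc _ e20) gcf => y [dfy dgy] fe ge v.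
rewrite (diff_comp dfy dgy) (diff_comp dfx dgx) /=.
rewrite -(subrK ('d g (f x) ('d f y v)) ('d g (f y) _)) -addrA -linearB.
rewrite (le_trans (ler_normD _ _))// [e in leRHS]splitr mulrDl lerD//.
  rewrite (le_trans (ge _))//.
  have : `|'d f y v| <= (Cf + 1) * `|v|.
    rewrite -(subrK ('d f x v) ('d f y v)) addrC (le_trans (ler_normD _ _))//.
    rewrite mulrDl lerD// (le_trans (fe _))// ler_wpM2r//.
    by rewrite /e2 ge_min lexx.
  by rewrite -(ler_pM2l e10) mulrA /e1 divfK// gt_eqF// addr_gt0.
rewrite (le_trans (HCg _))// -ler_pdivlMl// (le_trans (fe _))// mulrA ler_wpM2r//.
by rewrite /e2 mulrC ge_min lexx orbT.
Qed.

(** The continuity of the differential of a product, with all six quantities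
replaced by real numbers so that it becomes pure arithmetic. *)
Lemma product_rule_estimate (R : realType)
    (fx fy gx gy dfx dfy dgx dgy Cf Cg e n : R) :
  0 <= n -> `|dfx| <= Cf * n -> `|dgx| <= Cg * n ->
  `|dfy - dfx| <= e * n -> `|dgy - dgx| <= e * n ->
  `|fy - fx| <= e -> `|gy - gx| <= e -> e <= 1 ->
  `|fy * dgy + gy * dfy - (fx * dgx + gx * dfx)| <=
    e * (`|fx| + `|gx| + Cf + Cg + 2) * n.
Proof.
move=> n0 HCf HCg fe ge fye gye e1; have e0 : 0 <= e := le_trans (normr_ge0 _) fye.
have en0 : 0 <= e * n := le_trans (normr_ge0 _) fe.
have -> : fy * dgy + gy * dfy - (fx * dgx + gx * dfx) =
   ((fy - fx) * dgy + fx * (dgy - dgx)) + ((gy - gx) * dfy + gx * (dfy - dfx)).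
  by ring.
have enn : e * n <= n by rewrite ler_piMl.
have bf : `|dfy| <= (Cf + 1) * n.
  by rewrite -(subrK dfx dfy) addrC (le_trans (ler_normD _ _))// mulrDl mul1r lerD// (le_trans fe).
have bg : `|dgy| <= (Cg + 1) * n.
  by rewrite -(subrK dgx dgy) addrC (le_trans (ler_normD _ _))// mulrDl mul1r lerD// (le_trans ge).
have -> : e * (`|fx| + `|gx| + Cf + Cg + 2) * n = (e * ((Cg + 1) * n) + `|fx| * (e * n)) +
   (e * ((Cf + 1) * n) + `|gx| * (e * n)) by ring.
rewrite (le_trans (ler_normD _ _))// lerD// (le_trans (ler_normD _ _))// lerD//;
  rewrite normrM.
- by rewrite ler_pM.
- by rewrite ler_wpM2l.
- by rewrite ler_pM.
- by rewrite ler_wpM2l.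
Qed.

Section C1at_real.
Variables (R : realType) (V : normedModType R).

Lemma C1at_mul (f g : V -> R^o) x : C1at f x -> C1at g x ->
  C1at (fun y => f y * g y : R^o) x.
Proof.
move=> [df fc] [dg gc].
have dfx := nbhs_singleton df; have dgx := nbhs_singleton dg.
have dM z v : differentiable f z -> differentiable g z ->
    'd (fun y => f y * g y : R^o) z v = f z * 'd g z v + g z * 'd f z v.
  by move=> dfz dgz; rewrite (diffM dfz dgz).
split; first by apply: filterS2 df dg => y ? ?; apply: differentiableM.
have fcont : {for x, continuous f} by exact: differentiable_continuous.
have gcont : {for x, continuous g} by exact: differentiable_continuous.
have [Cf Cf0 HCf] := diff_bounded dfx; have [Cg Cg0 HCg] := diff_bounded dgx.
move=> e e0.
pose a := `|f x| + `|g x| + Cf + Cg + 2 : R.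
have a0 : 0 < a by rewrite /a; have := normr_ge0 (f x); have := normr_ge0 (g x); lra.
pose e1 := Num.min 1 (e / a); have e10 : 0 < e1 by rewrite lt_min ltr01 !divr_gt0.
have e11 : e1 <= 1 by rewrite /e1 ge_min lexx.
have ea : e1 * a <= e by rewrite -ler_pdivlMr// /e1 ge_min lexx orbT.
move/cvgrPdist_le : fcont => /(_ _ e10) fcont.
move/cvgrPdist_le : gcont => /(_ _ e10) gcont.
apply: filterS3 (filterI df dg) (filterI fcont gcont)
  (filterI (fc _ e10) (gc _ e10)) => y [dfy dgy] [fye gye] [fe ge] v.
rewrite distrC in fye; rewrite distrC in gye. have h := product_rule_estimate (normr_ge0 v) (HCf v) (HCg v) (fe v) (ge v) fye gye e11.
have h2 : e1 * a * `|v| <= e * `|v| by rewrite ler_wpM2r.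
have eqd : 'd (fun z => f z * g z : R^o) y v - 'd (fun z => f z * g z : R^o) x v
    = f y * 'd g y v + g y * 'd f y v - (f x * 'd g x v + g x * 'd f x v) :=
  f_equal2 (fun a b : R => a - b) (dM y v dfy dgy) (dM x v dfx dgx).
by rewrite eqd; exact: le_trans h h2.
Qed.

End C1at_real.

Lemma C1at_real (R : realType) (g dg : R -> R) (x : R) :
  (\forall y \near x, is_derive (y : R) 1 g (dg y)) -> {for x, continuous dg} ->
  C1at g x.
Proof.
move=> gdg dgc.
have dE y : is_derive (y : R) 1 g (dg y) ->
  differentiable g y /\ forall v, 'd g y v = v * dg y.
  move=> [h1 h2]; split; first exact/derivable1_diffP.
  by move=> v; rewrite (deriv1E h1) derive1E h2.
split; first by apply: filterS gdg => y /dE[].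
have gx := (dE _ (nbhs_singleton gdg)).2.
move=> e e0; move/cvgrPdist_le : dgc => /(_ _ e0) dgc.
apply: filterS2 gdg dgc => y /dE[_ gy] dgxy v.
have dyx : 'd g y v - 'd g x v = v * (dg y - dg x).
  by rewrite mulrBr; congr (_ - _); [exact: gy|exact: gx].
have h : `|v * (dg y - dg x)| <= e * `|v|.
  by rewrite normrM mulrC ler_wpM2r// distrC.
by move: h; rewrite -dyx.
Qed.

Lemma C1at_real_comp (R : realType) (V : normedModType R) (f : V -> R^o)
    (g dg : R -> R) (x : V) : C1at f x ->
  (\forall y \near f x, is_derive (y : R) 1 g (dg y)) ->
  {for f x, continuous dg} -> C1at (g \o f : V -> R^o) x.
Proof. by move=> fx gdg dgc; exact: C1at_comp fx (C1at_real gdg dgc). Qed.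

(** * Norms of equivalent scalar products *)

Section InnerProduct.
Variables (R : realType) (H : normedModType R) (G : {bilinear H -> H -> R^o}).

Definition gnorm (v : H) : R := Num.sqrt (G v v).

Definition inner_product :=
  (forall v w, G v w = G w v) /\
  exists c C : R, 0 < c /\ forall v, c * `|v| ^+ 2 <= G v v <= C * `|v| ^+ 2.

Lemma biDl u v w : G (u + v) w = G u w + G v w. Proof. exact: linearDl. Qed.
Lemma biDr u v w : G w (u + v) = G w u + G w v. Proof. exact: linearDr. Qed.
Lemma biBl u v w : G (u - v) w = G u w - G v w. Proof. exact: linearBl. Qed.
Lemma biBr u v w : G w (u - v) = G w u - G w v. Proof. exact: linearBr. Qed.
Lemma biZl k v w : G (k *: v) w = k * G v w. Proof. exact: linearZl_LR. Qed.
Lemma biZr k v w : G w (k *: v) = k * G w v. Proof. exact: linearZr_LR. Qed.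
Lemma biNl v w : G (- v) w = - G v w. Proof. exact: linearNl. Qed.
Lemma biNr v w : G w (- v) = - G w v. Proof. exact: linearNr. Qed.
Lemma bi0l w : G 0 w = 0. Proof. exact: linear0l. Qed.
Lemma bi0r w : G w 0 = 0. Proof. exact: linear0r. Qed.
Definition biE := (biDl, biDr, biBl, biBr, biZl, biZr, biNl, biNr).

Hypothesis HG : inner_product.
Let Gsym := HG.1.

Lemma bi_ge0 v : 0 <= G v v.
Proof.
have [c [C [c0 HC]]] := HG.2.
by have /andP[h _] := HC v; rewrite (le_trans _ h)// mulr_ge0 ?exprn_ge0// ltW.
Qed.

Lemma sqr_gnorm v : gnorm v ^+ 2 = G v v.
Proof. by rewrite /gnorm sqr_sqrtr// bi_ge0. Qed.

Lemma gnorm_ge0 v : 0 <= gnorm v. Proof. exact: sqrtr_ge0. Qed.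

(** The form returned by this lemma, in norms rather than squares and with both
constants positive, is what lets completeness and the topology of [H] be used
with the norm of [G]. *)
Lemma gnorm_equiv : exists c C, [/\ 0 < c, 0 < C &
  forall v, c * `|v| <= gnorm v <= C * `|v|].
Proof.
have [c [C [c0 HC]]] := HG.2.
exists (Num.sqrt c), (Num.sqrt (Num.max C 1)).
split; rewrite ?sqrtr_gt0// ?lt_max ?ltr01 ?orbT// => v.
have /andP[h1 h2] := HC v.
have E k : 0 <= k -> Num.sqrt k * `|v| = Num.sqrt (k * `|v| ^+ 2).
  by move=> k0; rewrite sqrtrM// sqrtr_sqr normr_id.
have M0 : 0 <= Num.max C 1 by rewrite le_max ler01 orbT.
rewrite !E ?(ltW c0)//; apply/andP; split; rewrite ler_wsqrtr//.
by rewrite (le_trans h2)// ler_wpM2r ?exprn_ge0// le_max lexx.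
Qed.

Lemma gnorm_eq0 v : gnorm v = 0 -> v = 0.
Proof.
have [c [C [c0 _ HC]]] := gnorm_equiv => v0.
have /andP[h _] := HC v; apply/eqP; rewrite -normr_eq0; apply/eqP/le_anti.
by rewrite normr_ge0 andbT -(ler_pM2l c0) mulr0 -v0.
Qed.

Lemma gnorm0 : gnorm 0 = 0. Proof. by rewrite /gnorm bi0l sqrtr0. Qed.

Lemma gnormZ k v : gnorm (k *: v) = `|k| * gnorm v.
Proof. by rewrite /gnorm biZl biZr mulrA -expr2 sqrtrM ?sqr_ge0// sqrtr_sqr. Qed.

Lemma gnormN v : gnorm (- v) = gnorm v.
Proof. by rewrite -scaleN1r gnormZ normrN normr1 mul1r. Qed.

Lemma gdistC v w : gnorm (v - w) = gnorm (w - v).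
Proof. by rewrite -gnormN opprB. Qed.

(** Expand G u u >= 0 for u := (G w w) v - (G v w) w. *)
Lemma cauchy_schwarz v w : `|G v w| <= gnorm v * gnorm w.
Proof.
have [->|w0] := eqVneq w 0; first by rewrite bi0r normr0 mulr_ge0// gnorm_ge0.
have Gw : 0 < G w w.
  rewrite lt_neqAle bi_ge0 andbT eq_sym; apply: contraNneq w0 => h.
  by apply/eqP/gnorm_eq0; rewrite /gnorm h sqrtr0.
rewrite /gnorm -sqrtrM ?bi_ge0// -sqrtr_sqr ler_sqrt ?mulr_ge0 ?bi_ge0//.
have := bi_ge0 (G w w *: v - G v w *: w).
rewrite !biE (Gsym w v) => h.
rewrite -(ler_pM2l Gw) -subr_ge0 (le_trans h)// le_eqVlt; apply/orP; left.
by apply/eqP; ring.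
Qed.

Lemma ler_gnormD v w : gnorm (v + w) <= gnorm v + gnorm w.
Proof.
rewrite -(@ler_pXn2r _ 2)// ?nnegrE ?addr_ge0 ?gnorm_ge0//.
rewrite sqr_gnorm sqrrD !sqr_gnorm !biE (Gsym w v).
have := le_trans (ler_norm _) (cauchy_schwarz v w); lra.
Qed.

Lemma ler_gdistD u v w : gnorm (v - w) <= gnorm (v - u) + gnorm (u - w).
Proof. by rewrite (le_trans _ (ler_gnormD _ _))// addrA subrK. Qed.

Lemma bi_bounded : exists2 C, 0 < C & forall v w, `|G v w| <= C * `|v| * `|w|.
Proof.
have [c [C [c0 C0 HC]]] := gnorm_equiv; exists (C * C); first exact: mulr_gt0.
move=> v w; rewrite (le_trans (cauchy_schwarz v w))//.
have /andP[_ hv] := HC v; have /andP[_ hw] := HC w.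
by rewrite (le_trans (ler_pM (gnorm_ge0 v) (gnorm_ge0 w) hv hw))// mulrACA mulrA.
Qed.

Lemma gnorm_near_lt x e : 0 < e -> \forall y \near x, gnorm (y - x) < e.
Proof.
have [c [C [c0 C0 HC]]] := gnorm_equiv => e0.
apply/nbhs_normP; exists (e / C) => /=; first exact: divr_gt0.
move=> y; rewrite /ball_ /= distrC => xy.
by have /andP[_ h] := HC (y - x); rewrite (le_lt_trans h)// mulrC -ltr_pdivlMr.
Qed.

Lemma gnorm_nbhs x (P : set H) : nbhs x P ->
  exists2 r, 0 < r & forall y, gnorm (y - x) < r -> P y.
Proof.
have [c [C [c0 C0 HC]]] := gnorm_equiv.
move=> /nbhs_normP[e /= e0 He]; exists (c * e); first exact: mulr_gt0.
move=> y xy; apply: He; rewrite /ball_ /= distrC.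
by have /andP[h _] := HC (y - x); rewrite -(ltr_pM2l c0) (le_lt_trans h).
Qed.

Lemma gnorm_open_ball x r : open [set y | gnorm (y - x) < r].
Proof.
rewrite openE => y /= xy; have /(gnorm_near_lt y) : 0 < r - gnorm (y - x) by rewrite subr_gt0.
by apply: filterS => z yz; rewrite /= (le_lt_trans (ler_gdistD y _ _))// -ltrBrDr.
Qed.

Lemma bi_continuous T (F : set_system T) (FF : Filter F) (f g : T -> H) a b :
  f @ F --> a -> g @ F --> b -> G (f t) (g t) @[t --> F] --> (G a b : R).
Proof.
have [C C0 HC] := bi_bounded.
move=> fa gb; apply/cvgrPdist_le => e e0.
pose k := `|a| + `|b| + 1; have k0 : 0 < k by rewrite ltr_wpDl ?addr_ge0.
pose e1 := Num.min 1 (e / C / (2 * k)).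
have e10 : 0 < e1 by rewrite lt_min ltr01 !divr_gt0// mulr_gt0.
move/cvgrPdist_le : fa => /(_ _ e10) fa; move/cvgrPdist_le : gb => /(_ _ e10) gb.
apply: filterS2 fa gb => t ft gt.
have -> : G a b - G (f t) (g t) = G (a - f t) b + (G a (b - g t) - G (a - f t) (b - g t)).
  by rewrite !biE; ring.
have e11 : e1 <= 1 by rewrite /e1 ge_min lexx.
have h : C * (e1 * (2 * k)) <= e.
  rewrite mulrC -ler_pdivlMr// -ler_pdivlMr ?mulr_gt0//.
  by rewrite /e1 ge_min lexx orbT.
apply: le_trans h.
have h1 : `|G (a - f t) b| <= C * (e1 * `|b|).
  by rewrite (le_trans (HC _ _))// -mulrA ler_pM2l// ler_wpM2r.
have h2 : `|G a (b - g t)| <= C * (e1 * `|a|).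
  by rewrite (le_trans (HC _ _))// -mulrA ler_pM2l// mulrC ler_wpM2r.
have h3 : `|G (a - f t) (b - g t)| <= C * (e1 * 1).
  by rewrite (le_trans (HC _ _))// -mulrA ler_pM2l// ler_pM// (le_trans gt).
rewrite (le_trans (ler_normD _ _))// (le_trans (lerD h1 (ler_normB _ _)))//.
rewrite (le_trans (lerD (lexx _) (lerD h2 h3)))// -!mulrDr ler_pM2l// ler_pM2l//.
by rewrite /k; have := normr_ge0 a; have := normr_ge0 b; lra.
Qed.

Lemma gnorm_cvg T (F : set_system T) (FF : Filter F) (f : T -> H) a :
  f @ F --> a -> gnorm (f t) @[t --> F] --> gnorm a.
Proof.
move=> fa; have h := bi_continuous FF fa fa.
exact: (cvg_comp _ _ h (@sqrt_continuous R (G a a))).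
Qed.

End InnerProduct.

(* Explicit form: otherwise unification may take the product of R for G. *)
Arguments biDl {R H} G.
Arguments biDr {R H} G.
Arguments biBl {R H} G.
Arguments biBr {R H} G.
Arguments biZl {R H} G.
Arguments biZr {R H} G.
Arguments biNl {R H} G.
Arguments biNr {R H} G.
Arguments bi0l {R H} G.
Arguments bi0r {R H} G.
Arguments biE {R H} G.

(** * The smooth variational principle *)

Section VariationalPrinciple.
Variables (R : realType) (H : completeNormedModType R).
Variables (G : {bilinear H -> H -> R^o}) (HG : inner_product G).

Lemma approx_min (S : set H) (F : H -> R) m z e : S z -> 0 < e ->
  (forall y, S y -> m <= F y) ->
  exists z', [/\ S z', F z' <= F z & forall y, S y -> F z' <= F y + e].
Proof.
move=> Sz e0 Fm.
have hi : has_inf (F @` S).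
  by split; [exists (F z), z|exists m => _ [y Sy <-]; exact: Fm].
have [_ [y Sy <-] Fy] := inf_adherent e0 hi.
have infle w : S w -> inf (F @` S) <= F w.
  by move=> Sw; apply: ge_inf; [case: hi|exists w].
have [zy|yz] := leP (F z) (F y).
  exists z; split=> // w Sw; rewrite (le_trans zy)// ltW// (lt_le_trans Fy)//.
  by rewrite lerD2r infle.
exists y; split=> //; first exact: ltW.
by move=> w Sw; rewrite ltW// (lt_le_trans Fy)// lerD2r infle.
Qed.

(** The successive points of the Borwein-Preiss construction.  At stage n, z n
nearly minimizes f plus the penalties centred at the previous points, and a new
penalty centred at z n is added.  The tolerance c 8^-n is chosen against the
weight c 2^-n: since z n+1 is at least as good as z n for the new functional,
(c 2^-n) |z n+1 - z n|^2 <= c 8^-n, which makes (z n) a Cauchy sequence. *)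
Lemma penalized_near_minima (S : set H) (f : H -> R) (m c : R) z00 :
  S z00 -> (forall y, S y -> m <= f y) -> 0 < c ->
  exists (z : nat -> H) (p : nat -> H -> R),
    [/\ p 0%N = cst 0,
        forall n y, p n.+1 y = p n y + c * 2^-1 ^+ n * G (y - z n) (y - z n),
        forall n, S (z n) /\ forall y, S y -> f (z n) + p n (z n) <= f y + p n y + c * 8^-1 ^+ n &
        forall n, gnorm G (z n.+1 - z n) <= 2^-1 ^+ n].
Proof.
move=> Sz00 fm c0.
pose mu n : R := c * 2^-1 ^+ n; pose ep n : R := c * 8^-1 ^+ n.
have mu0 n : 0 < mu n by rewrite mulr_gt0// exprn_gt0// invr_gt0.
have ep0 n : 0 < ep n by rewrite mulr_gt0// exprn_gt0// invr_gt0.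
have /choice[pick Hpick] : forall q : (H -> R) * H * nat, exists z', S q.1.2 ->
    (forall y, S y -> 0 <= q.1.1 y) ->
    [/\ S z', f z' + q.1.1 z' <= f q.1.2 + q.1.1 q.1.2 &
      forall y, S y -> f z' + q.1.1 z' <= f y + q.1.1 y + ep q.2].
  move=> [[p z] n] /=.
  have [[Sz p0]|h] := pselect (S z /\ forall y, S y -> 0 <= p y); last first.
    by exists z => Sz p0; exfalso; apply: h.
  have [|z' [? ? ?]] := @approx_min S (fun y => f y + p y) m z (ep n) Sz (ep0 n).
    by move=> y Sy; rewrite -[m]addr0 lerD ?fm ?p0.
  by exists z'.
(* The state is the last point and the sum of the penalties before it. *)
pose step n (s : H * (H -> R)) : H * (H -> R) :=
  let p' y := s.2 y + mu n * G (y - s.1) (y - s.1) in (pick (p', s.1, n.+1), p').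
pose s := fix s n : H * (H -> R) :=
  if n is k.+1 then step k (s k) else (pick (cst 0, z00, 0%N), cst 0).
pose z n := (s n).1; pose p n := (s n).2.
have pS n y : p n.+1 y = p n y + mu n * G (y - z n) (y - z n) by [].
have p0 n y : 0 <= p n y.
  elim: n => [//|n IH]; rewrite pS; apply: addr_ge0 => //; apply: mulr_ge0; [exact: ltW|exact: bi_ge0].
have zP n : S (z n) /\ forall y, S y -> f (z n) + p n (z n) <= f y + p n y + ep n.
  elim: n => [|n [Szn _]].
    by have [||h1 _ h2] := Hpick (cst 0, z00, 0%N).
  have [//|y _|h1 _ h2] := Hpick (p n.+1, z n, n.+1); first exact: (p0 n.+1).
  by split.
have zdec n : f (z n.+1) + p n.+1 (z n.+1) <= f (z n) + p n (z n).
  have [|y _|_ h _] := Hpick (p n.+1, z n, n.+1); [by case: (zP n)|exact: (p0 n.+1)|].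
  by rewrite /= [p n.+1 (z n)]pS subrr (bi0l G) mulr0 addr0 in h.
have zinc n : gnorm G (z n.+1 - z n) <= 2^-1 ^+ n.
  have := zdec n; rewrite pS; have := (zP n).2 _ (zP n.+1).1 => h1 h2.
  have : mu n * G (z n.+1 - z n) (z n.+1 - z n) <= ep n by lra.
  rewrite /mu /ep -mulrA ler_pM2l// (_ : 8^-1 = 2^-1 * 2^-1 ^+ 2 :> R); last by field.
  rewrite exprMn ler_pM2l ?exprn_gt0// ?invr_gt0// -sqr_gnorm// -exprM mulnC exprM.
  by rewrite ler_pXn2r// nnegrE ?gnorm_ge0// exprn_ge0// invr_ge0.
by exists z, p.
Qed.

(** In a space that is not locally compact a continuous function bounded below
need not attain its infimum on a ball; after adding a small smooth perturbation
it does (Borwein and Preiss).  The perturbation is a series of penalties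
c 2^-n |y - z n|^2.  As the norm comes from a scalar product, each partial sum
is a quadratic function A |y|^2 - 2 <y, b> + C, and it is enough that the three
coefficients converge.  The limit of the centres z n is then the minimum point,
and the perturbation and its gradient are small with c. *)
Lemma smooth_variational_principle (S : set H) (f : H -> R) (m d c : R) z00 :
  closed S -> S z00 -> (forall y y', S y -> S y' -> gnorm G (y - y') <= d) ->
  (forall y, S y -> {for y, continuous f}) ->
  (forall y, S y -> m <= f y) -> 0 < c ->
  exists (z : H) (A : R) (b : H) (C : R), let p y := A * G y y - 2 * G y b + C in
    [/\ S z, forall y, S y -> f z + p z <= f y + p y,
        forall y, S y -> 0 <= p y <= 2 * c * d ^+ 2 &
        forall y v, S y -> `|A * G y v - G b v| <= 2 * c * d * gnorm G v].
Proof.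
move=> cS Sz00 Sd fc fm c0.
have d0 : 0 <= d by rewrite (le_trans (gnorm_ge0 G 0))// -(subrr z00) Sd.
pose mu n : R := c * 2^-1 ^+ n.
have mu0 n : 0 < mu n by rewrite mulr_gt0// exprn_gt0// invr_gt0.
have [z [p [pO pS zP zinc]]] := penalized_near_minima Sz00 fm c0.
have p0 n y : 0 <= p n y.
  elim: n => [|n IH]; first by rewrite pO.
  by rewrite pS; apply: addr_ge0 => //; apply: mulr_ge0; [exact: ltW (mu0 n)|exact: bi_ge0].
have [k [K [k0 K0 HK]]] := gnorm_equiv HG.
have [zl zcvg] : exists l : H, z @ \oo --> l.
  apply: (@cvg_geometric_increments _ _ _ k^-1) => n.
  rewrite -ler_pdivrMl ?invr_gt0// invrK (le_trans _ (zinc n))//.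
  by have /andP[] := HK (z n.+1 - z n).
have Szl : S zl by apply: (@closed_cvg _ H \oo _ z (fun y => S y) cS _ zl zcvg); near=> n; case: (zP n).
(* Coefficients of the partial sum p n, seen as A |y|^2 - 2 <y, b> + C. *)
pose A := fix A n : R := if n is k.+1 then A k + mu k else 0.
pose b := fix b n : H := if n is k.+1 then b k + mu k *: z k else 0.
pose C := fix C n : R := if n is k.+1 then C k + mu k * G (z k) (z k) else 0.
have [AO bO CO] : [/\ A 0%N = 0, b 0%N = 0 & C 0%N = 0] by [].
have AS n : A n.+1 = A n + mu n by [].
have bS n : b n.+1 = b n + mu n *: z n by [].
have CS n : C n.+1 = C n + mu n * G (z n) (z n) by [].
have {}pS n y : p n.+1 y = p n y + mu n * G (y - z n) (y - z n) := pS n y.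
(* The weights telescope: the first n of them add up to 2 c (1 - 2^-n). *)
have muS n : mu n = 2 * c * 2^-1 ^+ n - 2 * c * 2^-1 ^+ n.+1.
  by rewrite /mu exprS; field.
clearbody A b C.
have pE n y : p n y = A n * G y y - 2 * G y (b n) + C n.
  elim: n => [|n IH]; first by rewrite pO AO bO CO (bi0r G) mul0r mulr0 subrr addr0.
  rewrite (pS n) IH (AS n) (bS n) (CS n).
  rewrite !(biE G) (HG.1 (z n) y).
  move: (G y y) (G y (z n)) (G (z n) (z n)) (G y (b n)) (A n) (C n) (mu n) => r1 r2 r3 r4 r5 r6 r7.
  by ring.
have gE n y v : A n.+1 * G y v - G (b n.+1) v = (A n * G y v - G (b n) v) + mu n * G (y - z n) v.
  rewrite (AS n) (bS n) !(biE G).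
  by move: (G y v) (G (z n) v) (G (b n) v) (A n) (mu n) => r1 r2 r3 r4 r5; ring.
have [Al Acvg] : exists l : R, A @ \oo --> l.
  apply: (@cvg_geometric_increments _ R _ c) => n.
  by rewrite AS addrC addKr ger0_norm// ltW.
have Kz n : `|z n| <= k^-1 * (d + gnorm G z00).
  rewrite ler_pdivlMl//; have /andP[h _] := HK (z n); rewrite (le_trans h)//.
  by rewrite -{1}(subrK z00 (z n)) (le_trans (ler_gnormD HG _ _))// lerD2r; apply: Sd => //; exact: (zP n).1.
set k1 := k^-1 * _ in Kz.
have k10 : 0 <= k1 := le_trans (normr_ge0 _) (Kz 0%N).
clearbody k1.
have [bl bcvg] : exists l : H, b @ \oo --> l.
  apply: (@cvg_geometric_increments _ _ _ (c * k1)) => n.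
  rewrite bS addrC addKr normrZ ger0_norm ?(ltW (mu0 _))//.
  by rewrite [leRHS]mulrAC -/(mu n) ler_wpM2l// ltW.
have [Cl Ccvg] : exists l : R, C @ \oo --> l.
  apply: (@cvg_geometric_increments _ R _ (c * (K * k1) ^+ 2)) => n.
  rewrite CS addrC addKr normrM ger0_norm ?(ltW (mu0 _))// [leRHS]mulrAC -/(mu n) ler_wpM2l ?(ltW (mu0 _))//.
  rewrite -sqr_gnorm// ger0_norm ?exprn_ge0 ?gnorm_ge0// ler_pXn2r ?nnegrE ?gnorm_ge0 ?mulr_ge0 ?(ltW K0)//.
  by have /andP[_ h] := HK (z n); rewrite (le_trans h)// ler_pM2l.
have Fcvg (x : nat -> H) xl : x @ \oo --> xl -> S xl ->
    f (x n) + p n (x n) @[n --> \oo] --> f xl + (Al * G xl xl - 2 * G xl bl + Cl).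
  move=> xcvg Sxl; under eq_fun do rewrite pE.
  apply: cvgD; first exact: (cvg_comp _ _ xcvg (fc _ Sxl)).
  apply: cvgD => //; apply: cvgB.
    by apply: cvgM => //; apply: bi_continuous.
  by apply: cvgMr; apply: bi_continuous.
have epcvg : c * 8^-1 ^+ n @[n --> \oo] --> (0 : R).
  rewrite -[X in _ --> X](mulr0 c); apply: cvgMr; apply: cvg_expr.
  by rewrite ger0_norm ?invr_ge0// invf_lt1//; lra.
have pbnd n y : S y -> p n y <= (2 * c - 2 * c * 2^-1 ^+ n) * d ^+ 2.
  move=> Sy; elim: n => [|n IH]; first by rewrite pO/= expr0 mulr1 subrr mul0r.
  rewrite pS.
  have h : mu n * G (y - z n) (y - z n) <= mu n * d ^+ 2.
    rewrite ler_pM2l// -sqr_gnorm// ler_pXn2r ?nnegrE ?gnorm_ge0//.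
    by apply: Sd => //; case: (zP n).
  apply: le_trans (lerD IH h) _; rewrite muS -mulrDl le_eqVlt; apply/orP; left.
  by rewrite addrA subrK.
have gbnd n y v : S y ->
    `|A n * G y v - G (b n) v| <= (2 * c - 2 * c * 2^-1 ^+ n) * (d * gnorm G v).
  move=> Sy; elim: n => [|n IH].
    by rewrite AO bO (bi0l G) mul0r subrr normr0 expr0 mulr1 subrr mul0r.
  rewrite gE.
  have h : `|mu n * G (y - z n) v| <= mu n * (d * gnorm G v).
    rewrite normrM ger0_norm ?(ltW (mu0 _))// ler_pM2l//.
    rewrite (le_trans (cauchy_schwarz HG _ _))// ler_wpM2r ?gnorm_ge0//.
    by apply: Sd => //; case: (zP n).
  apply: le_trans (ler_normD _ _) (le_trans (lerD IH h) _).
  rewrite muS -mulrDl le_eqVlt; apply/orP; left.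
  by rewrite addrA subrK.
have le2c n : 2 * c - 2 * c * 2^-1 ^+ n <= 2 * c.
  by rewrite gerBl mulr_ge0 ?exprn_ge0 ?invr_ge0// mulr_ge0// ltW.
exists zl, Al, bl, Cl; split => //.
- move=> y Sy.
  have h1 := Fcvg _ _ zcvg Szl.
  have h2 : f y + p n y + c * 8^-1 ^+ n @[n --> \oo] --> f y + (Al * G y y - 2 * G y bl + Cl) + 0.
    by apply: cvgD => //; apply: (Fcvg (cst y)) => //; exact: cvg_cst.
  rewrite addr0 in h2; apply: ler_cvg_to h1 h2 _.
  by near=> n; exact: (zP n).2.
- move=> y Sy.
  have h2 : f y + p n y @[n --> \oo] --> f y + (Al * G y y - 2 * G y bl + Cl).
    by apply: (Fcvg (cst y)) => //; exact: cvg_cst.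
  apply/andP; split; rewrite -(lerD2l (f y)).
    apply: ler_cvg_to (cvg_cst _) h2 _.
    by near=> n; rewrite lerD2l.
  apply: ler_cvg_to h2 (cvg_cst _) _.
  near=> n; rewrite lerD2l (le_trans (pbnd n y Sy))// ler_wpM2r ?exprn_ge0//.
- move=> y v Sy.
  have h : `|A n * G y v - G (b n) v| @[n --> \oo] --> `|Al * G y v - G bl v|.
    apply: cvg_norm; apply: cvgB; first exact: cvgMl.
    by apply: bi_continuous => //; exact: cvg_cst.
  apply: ler_cvg_to h (cvg_cst _) _.
  near=> n; rewrite (le_trans (gbnd n y v Sy))// -[leRHS]mulrA ler_wpM2r// mulr_ge0// gnorm_ge0.
Unshelve. all: by end_near. Qed.

End VariationalPrinciple.

(** * Square roots of quadratic forms as test functions *)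

(** [C1at] with the differential displayed, so that regularity and derivative of a
test function are computed in one go. *)
Definition C1diff (R : realType) (V W : normedModType R) (f : V -> W) (x : V)
  (L : V -> W) := C1at f x /\ forall v, 'd f x v = L v.

Lemma C1diff_add (R : realType) (V W : normedModType R) (f g : V -> W) x L K :
  C1diff f x L -> C1diff g x K -> C1diff (fun y => f y + g y) x (fun v => L v + K v).
Proof.
move=> [fx fL] [gx gK]; split; first exact: C1at_add.
move=> v; rewrite (diffD (C1at_differentiable fx) (C1at_differentiable gx)).
by rewrite -fL -gK.
Qed.

Lemma C1diff_eq (R : realType) (V W : normedModType R) (f : V -> W) x L K :
  C1diff f x L -> L =1 K -> C1diff f x K.
Proof. by move=> [fx fL] LK; split=> // v; rewrite fL LK. Qed.

Lemma C1diff_cst (R : realType) (V W : normedModType R) (c : W) (x : V) :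
  C1diff (cst c) x (cst 0).
Proof. by split; [exact: C1at_cst|move=> v; rewrite diff_cst]. Qed.

Lemma C1diff_real_comp (R : realType) (V : normedModType R) (f : V -> R^o) L
    (g dg : R -> R) (x : V) : C1diff f x L ->
  (\forall y \near f x, is_derive (y : R) 1 g (dg y)) ->
  {for f x, continuous dg} ->
  C1diff (g \o f : V -> R^o) x (fun v => dg (f x) * L v).
Proof.
move=> [fx fL] gdg dgc; split; first exact: C1at_real_comp fx gdg dgc.
have gC := C1at_real gdg dgc.
have [h1 h2] := nbhs_singleton gdg.
have dgE w : 'd g (f x) w = dg (f x) * w.
  by rewrite (deriv1E h1) derive1E h2 mulrC.
move=> v; rewrite -fL; apply: etrans (dgE _).
exact: diff_comp_apply (C1at_differentiable fx) (C1at_differentiable gC).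
Qed.

Lemma C1diff_scale (R : realType) (V : normedModType R) (f : V -> R^o) L k x :
  C1diff f x L -> C1diff (fun y => k * f y : R^o) x (fun v => k * L v).
Proof.
move=> fL; apply: (@C1diff_real_comp R V f L ( *%R k) (cst k) x fL).
  by near=> y; apply: is_derive_eq; rewrite /GRing.scale /= mulr1.
exact: cst_continuous.
Unshelve. all: by end_near. Qed.

Section Quadratic.
Variables (R : realType) (H : normedModType R).
Variables (G : {bilinear H -> H -> R^o}) (HG : inner_product G).

Lemma C1diff_quadratic x z : C1diff (fun y => G (y - x) (y - x) : R^o) z
  (fun v => 2 * G (z - x) v).
Proof.
have [C C0 HC] := bi_bounded HG.
have dQ y : differentiable (fun y => G (y - x) (y - x) : R^o) y /\
    forall v, 'd (fun y => G (y - x) (y - x) : R^o) y v = 2 * G (y - x) v.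
  apply: diff_eps => [k u v||e e0].
  - by rewrite !(biE G) /GRing.scale/=; ring.
  - exists (2 * (C * `|y - x|)) => v; rewrite normrM ger0_norm// -mulrA ler_pM2l//.
  - near=> h.
    have -> : G (y + h - x) (y + h - x) - G (y - x) (y - x) - 2 * G (y - x) h = G h h.
      rewrite (addrAC y h); move: (y - x) => u.
      rewrite !(biDl G) !(biDr G) (HG.1 h u).
      move: (G u u) (G u h) (G h h) => a b c; ring.
    rewrite (le_trans (HC _ _))// ler_wpM2r// -ler_pdivlMl//.
    near: h; apply: nbhs0_le; rewrite mulr_gt0 ?invr_gt0//.
split; last exact: (dQ z).2.
split; first by near do apply: (dQ _).1.
move=> e e0; near=> y => v.
have -> : 'd (fun y => G (y - x) (y - x) : R^o) y v
   - 'd (fun y => G (y - x) (y - x) : R^o) z v = 2 * G (y - z) v.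
  apply: etrans (f_equal2 (fun a b : R => a - b) ((dQ y).2 v) ((dQ z).2 v)) _.
  by rewrite -mulrBr -(biBl G) opprB addrA subrK.
rewrite normrM ger0_norm// (le_trans (ler_wpM2l _ (HC _ _)))// mulrA ler_wpM2r//.
rewrite mulrA -ler_pdivlMl ?mulr_gt0// distrC.
by near: y; apply: cvgr_dist_le => //; rewrite mulr_gt0// invr_gt0 mulr_gt0.
Unshelve. all: by end_near. Qed.

Lemma C1diff_linear b z : C1diff (fun y => G b y : R^o) z (fun v => G b v).
Proof.
have [C C0 HC] := bi_bounded HG.
have dL y : differentiable (fun y => G b y : R^o) y /\
    forall v, 'd (fun y => G b y : R^o) y v = G b v.
  apply: diff_eps => [k u v||e e0].
  - by rewrite !(biE G) /GRing.scale/=.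
  - by exists (C * `|b|) => v.
  - by near=> h; rewrite (biDr G) (addrC (G b y)) addrK subrr normr0 mulr_ge0// ltW.
split; last exact: (dL z).2.
split; first by near do apply: (dL _).1.
move=> e e0; near=> y => v.
have -> : 'd (fun y => G b y : R^o) y v - 'd (fun y => G b y : R^o) z v = 0 :> R.
  apply: etrans (f_equal2 (fun a b : R => a - b) ((dL y).2 v) ((dL z).2 v)) _.
  by rewrite subrr.
by rewrite normr0 mulr_ge0// ltW.
Unshelve. all: by end_near. Qed.

(** The one family of test functions needed: a multiple of a norm, regularized by
[s] near its centre, a multiple of its square, and the quadratic perturbation
of [smooth_variational_principle]. *)
Lemma C1diff_gauge (a s B A C : R) (x b z : H) : 0 < s + G (z - x) (z - x) ->
  C1diff (fun y => a * Num.sqrt (s + G (y - x) (y - x)) + B * G (y - x) (y - x)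
     + (A * G y y - 2 * G y b + C) : R^o) z
   (fun v => a * (G (z - x) v / Num.sqrt (s + G (z - x) (z - x)))
      + 2 * B * G (z - x) v + 2 * (A * G z v - G b v)).
Proof.
move=> pos.
have h1 : C1diff (fun y => a * Num.sqrt (s + G (y - x) (y - x)) : R^o) z
   (fun v => a * (G (z - x) v / Num.sqrt (s + G (z - x) (z - x)))).
  apply: C1diff_scale.
  have hq := C1diff_add (C1diff_cst (s : R^o) z) (C1diff_quadratic x z).
  apply: C1diff_eq; first apply: (C1diff_real_comp (g := Num.sqrt) (dg := fun t => (2 * Num.sqrt t)^-1) hq).
  - near=> t; apply: is_derive1_sqrt; near: t.
    exact: (cvgr_gt _ cvg_id).
  - apply: cvgV; first by rewrite mulf_neq0// gt_eqF// sqrtr_gt0.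
    by apply: cvgMr; exact: sqrt_continuous.
  - by move=> v /=; rewrite add0r; field; rewrite gt_eqF// sqrtr_gt0.
have h2 := C1diff_scale B (C1diff_quadratic x z).
have h3 := C1diff_scale A (C1diff_quadratic 0 z).
have h4 := C1diff_scale (-2) (C1diff_linear b z).
have h := C1diff_add (C1diff_add h1 h2) (C1diff_add (C1diff_add h3 h4) (C1diff_cst (C : R^o) z)).
have -> : (fun y => a * Num.sqrt (s + G (y - x) (y - x)) + B * G (y - x) (y - x)
     + (A * G y y - 2 * G y b + C) : R^o) = (fun y => a * Num.sqrt (s + G (y - x) (y - x)) + B * G (y - x) (y - x)
     + (A * G (y - 0) (y - 0) + -2 * G b y + cst C y) : R^o).
  by apply/funext => y; rewrite subr0 mulNr (HG.1 b y).
apply: C1diff_eq h _ => v /=; rewrite subr0.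
move: (G (z - x) v) (G z v) (G b v) => r1 r2 r3; ring.
Unshelve. all: by end_near. Qed.

Lemma C1_near_gauge (a s B A C : R) (x b z : H) : 0 < s + G (z - x) (z - x) ->
  \forall y \near z, C1at (fun y => a * Num.sqrt (s + G (y - x) (y - x)) + B * G (y - x) (y - x)
     + (A * G y y - 2 * G y b + C) : R^o) y.
Proof.
move=> pos; have hz : G (y - x) (y - x) @[y --> z] --> (G (z - x) (z - x) : R).
  exact: differentiable_continuous (C1at_differentiable (C1diff_quadratic x z).1).
have : \forall y \near z, - s < G (y - x) (y - x).
  by apply: (cvgr_gt _ hz); rewrite -subr_gt0 opprK addrC.
apply: filterS => y ys; have h0 : 0 < s + G (y - x) (y - x) by rewrite -ltrBlDl sub0r.
by have [] := @C1diff_gauge a s B A C x b y h0.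
Qed.

End Quadratic.

(** * From slopes to subgradients and supergradients *)

Section FlatSlopes.
Variables (R : realType) (H : completeNormedModType R).
Variables (G : {bilinear H -> H -> R^o}) (HG : inner_product G).
Local Notation N := (gnorm G).

Let cball (x : H) (r : R) : set H := [set y | N (y - x) <= r].

Lemma gdist_continuous x : continuous (fun y => N (y - x)).
Proof.
move=> y; apply: gnorm_cvg => //.
by apply: cvgB; [exact: cvg_id|exact: cvg_cst].
Qed.

Lemma gdist2_continuous x : continuous (fun y => G (y - x) (y - x) : R).
Proof.
by move=> y; apply: (bi_continuous HG); apply: cvgB; [exact: cvg_id|exact: cvg_cst|exact: cvg_id|exact: cvg_cst].
Qed.

Lemma closed_gball x r : closed (cball x r).
Proof.
apply: (@closed_comp _ _ (fun y => N (y - x)) [set t : R | t <= r]); last exact: closed_le.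
by move=> y _; exact: gdist_continuous.
Qed.

Lemma gball_diam x r y y' : cball x r y -> cball x r y' -> N (y - y') <= 2 * r.
Proof.
move=> /= h h'; rewrite (le_trans (ler_gdistD HG x _ _))// (gdistC _ x y').
by rewrite mulr2n mulrDl mul1r lerD.
Qed.

(** If v decreases from x at a rate at most 1 - e on a ball, add to v the
regularized cone k sqrt(s + |y - x|^2) with a slope k strictly between 1 - e and
1.  The sum is larger on the sphere than at x by a definite amount, so a small
perturbation of it has a minimum point inside the ball, and there the opposite
of the cone (with the perturbation) touches v from below.  Its gradient is
barely larger than k. *)
Lemma subgradient_of_slow_descent (v : H -> R) x r e : 0 < r -> 0 < e < 1 ->
  (forall y, N (y - x) <= r -> {for y, continuous v}) ->
  (forall y, N (y - x) <= r -> v x - (1 - e) * N (y - x) <= v y) ->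
  exists (z : H) (f : H -> R^o) (L : H -> R^o),
    [/\ N (z - x) < r, (\forall y \near z, C1at f y) /\ (forall w, 'd f z w = L w),
      forall y, N (y - x) <= r -> v z - f z <= v y - f y &
      forall w, `|L w| <= (1 - e / 2) * N w].
Proof.
move=> r0 /andP[e0 e1] vc vx.
have xS : N (x - x) <= r by rewrite subrr gnorm0 ltW.
(* With k the slope of the cone, the sum on the sphere exceeds the value at x
   by (k - (1 - e)) r = e r / 4, against errors of at most e r / 16 from the
   rounding s and e r / 16 from the perturbation, whose gradient adds at most
   e / 16 to k. *)
pose k := 1 - 3 / 4 * e; pose s := (e * r / 16) ^+ 2; pose c := e / (128 * r).
have k0 : 0 < k by rewrite /k; lra.
have c0 : 0 < c by rewrite divr_gt0// mulr_gt0.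
have s0 : 0 < s by rewrite exprn_gt0// divr_gt0// mulr_gt0.
have cr : c * r = e / 128 by rewrite /c; field; rewrite gt_eqF.
have Qc y : {for y, continuous (fun y => k * Num.sqrt (s + G (y - x) (y - x)))}.
  have hq : s + G (y - x) (y - x) @[y --> y] --> s + G (y - x) (y - x).
    by apply: cvgD; [exact: cvg_cst|exact: gdist2_continuous].
  by apply: cvgMr; exact: (cvg_comp _ _ hq (@sqrt_continuous R _)).
pose F y := v y + k * Num.sqrt (s + G (y - x) (y - x)).
have Fm y : cball x r y -> v x - r <= F y.
  move=> yr; rewrite -[v x - r]addr0 lerD ?mulr_ge0 ?sqrtr_ge0 ?(ltW k0)//.
  rewrite (le_trans _ (vx y yr))// lerD2l lerN2 (le_trans _ yr)//.
  by rewrite ler_piMl ?gnorm_ge0//; lra.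
have Fc y : cball x r y -> {for y, continuous F}.
  by move=> yr; apply: cvgD; [exact: vc|exact: Qc].
have [z [A [b [C [zr Fmin p0 pg]]]]] :=
  smooth_variational_principle HG (@closed_gball x r) xS (@gball_diam x r) Fc Fm c0.
pose p y := A * G y y - 2 * G y b + C.
have pbnd y : N (y - x) <= r -> 0 <= p y <= e * r / 16.
  move=> /p0/andP[h1 h2]; apply/andP; split=> //; apply: le_trans h2 _.
  by rewrite le_eqVlt; apply/orP; left; apply/eqP; rewrite /c; field; rewrite gt_eqF.
have gbnd w : `|A * G z w - G b w| <= e / 32 * N w.
  apply: le_trans (pg z w zr) _; rewrite ler_wpM2r ?gnorm_ge0//.
  by rewrite le_eqVlt; apply/orP; left; apply/eqP; rewrite /c; field; rewrite gt_eqF.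
have q0 : 0 <= G (z - x) (z - x) by exact: bi_ge0.
have sq0 : 0 < s + G (z - x) (z - x) by rewrite ltr_wpDr.
pose f y := - k * Num.sqrt (s + G (y - x) (y - x)) + 0 * G (y - x) (y - x)
  + ((- A) * G y y - 2 * G y (- b) + (- C)).
have fE y : f y = - (k * Num.sqrt (s + G (y - x) (y - x))) - p y.
  rewrite /f /p (biNr G); move: (G y y) (G y b) (G _ _) => r1 r2 r3; ring.
set q := Num.sqrt (s + G (z - x) (z - x)).
have q1 : 0 < q by rewrite sqrtr_gt0.
have Nz : N (z - x) <= q by rewrite ler_wsqrtr// lerDr ltW.
exists z, f, (fun w => - (k * (G (z - x) w / q)) - 2 * (A * G z w - G b w)); split.
- rewrite lt_neqAle zr andbT; apply/eqP => Nzr.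
  have := Fmin x xS; rewrite -!/(p _) /F subrr (bi0l G) addr0.
  rewrite sqrtr_sqr ger0_norm ?divr_ge0 ?mulr_ge0 ?(ltW r0) ?(ltW e0)//.
  have /andP[_ hx] := pbnd x xS; have /andP[hz _] := pbnd z zr.
  have vz := vx z zr; rewrite Nzr in vz Nz.
  have kq : k * r <= k * q by rewrite ler_pM2l.
  have ks : k * (e * r / 16) <= e * r / 16.
    by rewrite ler_piMl ?divr_ge0 ?mulr_ge0 ?(ltW r0) ?(ltW e0)// /k; lra.
  have er : 0 < e * r by rewrite mulr_gt0.
  rewrite -/q => hF.
  have : k * r - (1 - e) * r <= e * r / 8 by lra.
  by rewrite /k; lra.
- split=> [|w]; first exact: C1_near_gauge.
  rewrite (C1diff_gauge HG _ _ _ _ _ sq0).2 -/q (biNl G).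
  move: (G (z - x) w) (G z w) (G b w) => r1 r2 r3; ring.
- move=> y yr; rewrite !fE; have := Fmin y yr; rewrite -!/(p _) /F; lra.
- move=> w.
  have h1 : `|k * (G (z - x) w / q)| <= k * N w.
    rewrite normrM (ger0_norm (ltW k0)) ler_pM2l// normrM normfV (gtr0_norm q1).
    rewrite ler_pdivrMr// (le_trans (cauchy_schwarz HG _ _))// mulrC.
    by rewrite ler_wpM2l ?gnorm_ge0.
  have h2 : `|2 * (A * G z w - G b w)| <= 2 * (e / 32 * N w).
    by rewrite normrM ger0_norm// ler_pM2l.
  rewrite (le_trans (ler_normB _ _))// normrN.
  have Nw := gnorm_ge0 G w.
  have eN : 0 <= e * N w by rewrite mulr_ge0 ?(ltW e0).
  move: h1 h2; rewrite /k.
  move: `|_ * _| `|_ * _| => r1 r2; lra.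
Qed.

(** If v increases from x to y1 more than K |y - x| + B |y - x|^2 does, then v - v x
minus this function is positive at y1, vanishes at x, and is negative on the
sphere because the square was chosen to dominate the oscillation of v.  After a
small perturbation its maximum is attained at an inner point z other than x,
where the cone is smooth and steeper than k in the direction z - x. *)
Lemma steep_supergradient (v : H -> R) x y1 r m k K B : 0 < r ->
  0 <= k < K -> m < B * r ^+ 2 ->
  (forall y, N (y - x) <= r -> {for y, continuous v}) ->
  (forall y, N (y - x) <= r -> v y <= v x + m) ->
  N (y1 - x) <= r -> K * N (y1 - x) + B * N (y1 - x) ^+ 2 < v y1 - v x ->
  exists (z : H) (f : H -> R^o) (L : H -> R^o),
    [/\ N (z - x) < r, (\forall y \near z, C1at f y) /\ (forall w, 'd f z w = L w),
      forall y, N (y - x) <= r -> v y - f y <= v z - f z &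
      exists w, k * N w < L w].
Proof.
move=> r0 /andP[k0 kK] mB vc vm y1r y1gt.
have xS : N (x - x) <= r by rewrite subrr gnorm0 ltW.
have m0 : 0 <= m by have := vm x xS; rewrite lerDl.
have B0 : 0 < B by rewrite -(pmulr_lgt0 _ (exprn_gt0 2 r0)) (le_lt_trans m0).
have K0 : 0 < K := le_lt_trans k0 kK.
pose F y := K * Num.sqrt (0 + G (y - x) (y - x)) + B * G (y - x) (y - x) - v y.
have FE y : F y = K * N (y - x) + B * N (y - x) ^+ 2 - v y.
  by rewrite /F sqr_gnorm// add0r.
(* The margin t bounds the perturbation: its values stay below 8 c r^2 < t. *)
pose t := v y1 - v x - (K * N (y1 - x) + B * N (y1 - x) ^+ 2).
have t0 : 0 < t by rewrite subr_gt0.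
pose c := Num.min (t / (16 * r ^+ 2)) ((K - k) / (8 * r)).
have c0 : 0 < c by rewrite lt_min !divr_gt0 ?mulr_gt0 ?exprn_gt0 ?subr_gt0.
have c1 : 8 * c * r ^+ 2 < t.
  have : c <= t / (16 * r ^+ 2) by rewrite /c ge_min lexx.
  by rewrite ler_pdivlMr ?mulr_gt0 ?exprn_gt0//; lra.
have c2 : 8 * c * r <= K - k.
  have : c <= (K - k) / (8 * r) by rewrite /c ge_min lexx orbT.
  by rewrite ler_pdivlMr ?mulr_gt0//; lra.
have Fm y : cball x r y -> - (v x + m) <= F y.
  move=> yr; rewrite FE; have := vm y yr.
  have : 0 <= K * N (y - x) by rewrite mulr_ge0 ?gnorm_ge0// ltW.
  have : 0 <= B * N (y - x) ^+ 2 by rewrite mulr_ge0 ?exprn_ge0 ?gnorm_ge0// ltW.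
  lra.
have Fc y : cball x r y -> {for y, continuous F}.
  move=> yr; apply: cvgB; last exact: vc.
  apply: cvgD; last by apply: cvgMr; exact: gdist2_continuous.
  have hq : 0 + G (y - x) (y - x) @[y --> y] --> 0 + G (y - x) (y - x).
    by apply: cvgD; [exact: cvg_cst|exact: gdist2_continuous].
  by apply: cvgMr; exact: (cvg_comp _ _ hq (@sqrt_continuous R _)).
have [z [A [b [C [zr Fmin p0 pg]]]]] :=
  smooth_variational_principle HG (@closed_gball x r) xS (@gball_diam x r) Fc Fm c0.
pose p y := A * G y y - 2 * G y b + C.
have pbnd y : N (y - x) <= r -> 0 <= p y <= 8 * c * r ^+ 2.
  move=> /p0/andP[h1 h2]; apply/andP; split=> //; apply: le_trans h2 _.
  by rewrite le_eqVlt; apply/orP; left; apply/eqP; ring.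
(* So z differs from x and is not on the sphere, F being at least -v x there. *)
have Fz : F z < - v x.
  have := Fmin y1 y1r; rewrite -!/(p _).
  have /andP[h1 _] := pbnd z zr; have /andP[_ h2] := pbnd y1 y1r.
  rewrite (FE y1); rewrite /t in c1; lra.
have zx : 0 < N (z - x).
  rewrite lt_neqAle gnorm_ge0 andbT; apply/eqP => /esym Nz.
  move: Fz; rewrite FE Nz (expr2 0) !mulr0 addr0 add0r ltrN2.
  by rewrite (subr0_eq (gnorm_eq0 HG Nz)) ltxx.
have sq0 : 0 < 0 + G (z - x) (z - x) by rewrite add0r -sqr_gnorm// exprn_gt0.
pose f y := K * Num.sqrt (0 + G (y - x) (y - x)) + B * G (y - x) (y - x)
  + (A * G y y - 2 * G y b + C).
pose L w := K * (G (z - x) w / Num.sqrt (0 + G (z - x) (z - x)))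
  + 2 * B * G (z - x) w + 2 * (A * G z w - G b w).
exists z, f, L; split; last first.
- exists (z - x); rewrite /L.
  have h1 := pg z (z - x) zr.
  have := ler_norm (- (A * G z (z - x) - G b (z - x))); rewrite normrN => h2.
  have h3 : 2 * c * (2 * r) * N (z - x) <= (K - k) / 2 * N (z - x).
    by rewrite ler_pM2r//; lra.
  rewrite add0r -/(N (z - x)) -sqr_gnorm// expr2 mulfK ?gt_eqF//.
  have : 0 < 2 * B * (N (z - x) * N (z - x)) by rewrite !mulr_gt0.
  lra.
- move=> y yr; have := Fmin y yr; rewrite /f /F; lra.
- split=> [|w]; first exact: C1_near_gauge.
  exact: (C1diff_gauge HG _ _ _ _ _ sq0).2.
- rewrite lt_neqAle zr andbT; apply/eqP => Nzr.
  move: Fz; rewrite FE Nzr; have := vm z zr.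
  have : 0 <= K * r by rewrite mulr_ge0// ltW.
  lra.
Qed.

End FlatSlopes.

(** * Charts, transition maps and tangent vectors *)

Lemma near_translate (R : realType) (V : normedModType R) (x : V) (P : set V) :
  nbhs x P <-> \forall h \near (0 : V), P (x + h).
Proof.
rewrite -[nbhs x P]/(\forall y \near x, P y) (near_shift 0) subr0.
by split; apply: filterS => h; rewrite /= addrC.
Qed.

(** The differential is the map v |-> D y [:: v]; its continuity comes from the
next term of the sequence, D (x + h) [:: v] - D x [:: v] being close to the
bounded bilinear D x [:: h; v]. *)
Lemma smooth_on_C1at (R : realType) (V W : normedModType R) (U : set V)
  (f : V -> W) x : open U -> smooth_on U f -> U x -> C1at f x.
Proof.
move=> oU [D [D0 Dlin Dd]] Ux.
have nearU y : U y -> \forall h \near (0 : V), U (y + h).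
  by move=> Uy; apply: (near_translate y U).1; apply: open_nbhs_nbhs; split.
have df y : U y -> differentiable f y /\ forall v, 'd f y v = D y [:: v].
  move=> Uy; have [L1 [C LC]] := Dlin 1%N y isT Uy.
  apply: diff_eps => [k u v||e e0].
  - by have := L1 [::] [::] k u v erefl.
  - by exists C => v; have := LC [:: v] erefl; rewrite big_seq1.
  - apply: filterS2 (nearU y Uy) (Dd 0%N y isT Uy e e0) => h Uyh /(_ [::] erefl).
    by rewrite (D0 _ [::] Uyh erefl) (D0 _ [::] Uy erefl) big_nil mulr1.
split; first by apply: filterS (open_nbhs_nbhs (conj oU Ux)) => y /df[].
move=> e e0.
have [_ [C2 LC2]] := Dlin 2%N x isT Ux.
pose C := `|C2| + 1; have C0 : 0 < C by rewrite ltr_wpDl.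
have h1 := Dd 1%N x isT Ux 1 ltr01.
have h2 : \forall h \near (0 : V), `|h| <= e / (1 + C).
  by apply: nbhs0_le; apply: divr_gt0 => //; apply: addr_gt0.
apply/near_translate; apply: filterS3 (nearU x Ux) h1 h2 => h Uxh Hh hC v.
rewrite (df _ Uxh).2 (df _ Ux).2.
have := Hh [:: v] erefl; rewrite big_seq1 mul1r => {}Hh.
have := LC2 [:: h; v] erefl; rewrite !big_cons big_nil mulr1 => Hhv.
rewrite -[X in `|X|](subrK (D x [:: h; v])) (le_trans (ler_normD _ _))//.
apply: (@le_trans _ _ ((1 + C) * `|h| * `|v|)).
  rewrite 2!mulrDl mul1r lerD// (le_trans Hhv)// -mulrA ler_wpM2r ?mulr_ge0//.
  by rewrite (le_trans (ler_norm _))// /C lerDl.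
by rewrite ler_wpM2r// mulrC -ler_pdivlMr// addr_gt0.
Qed.

Section Charts.
Variables (R : realType) (H : normedModType R) (M : topologicalType).
Variable X : hilbert_manifold H M.
Implicit Types (i j : chart X) (p : M) (y v w : H).

Lemma cimgP i y : cimg i y -> cdom i (cinv i y) /\ cmap i (cinv i y) = y.
Proof. by move=> [p ip <-]; rewrite cmapK. Qed.

Lemma cmap_cimg i p : cdom i p -> cimg i (cmap i p).
Proof. by exists p. Qed.

Lemma cinv_continuous_at i y : cimg i y -> {for y, continuous (cinv i)}.
Proof. by move=> [p ip <-]; exact: cinv_continuous. Qed.

Lemma cmap_open i (O : set M) : open O -> open (cmap i @` (cdom i `&` O)).
Proof.
move=> oO; rewrite openE => _ [p [ip Op] <-].
have h1 : nbhs (cmap i p) (cimg i).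
  by apply: open_nbhs_nbhs; split; [exact: cimg_open|exact: cmap_cimg].
have h2 : \forall y \near cmap i p, O (cinv i y).
  apply: (cinv_continuous ip); rewrite cmapK//; exact: open_nbhs_nbhs.
apply: filterS2 h1 h2 => y /cimgP[iy yE] Oy.
by exists (cinv i y).
Qed.

Lemma transition_C1at i j p : cdom i p -> cdom j p ->
  C1at (cmap j \o cinv i) (cmap i p).
Proof.
move=> ip jp; apply: smooth_on_C1at (transition_smooth (h := X) i j) _; last by exists p.
by apply: cmap_open; exact: cdom_open.
Qed.

Lemma near_cdom i p : cdom i p -> \forall q \near p, cdom i q.
Proof. by move=> ip; apply: open_nbhs_nbhs; split => //; exact: cdom_open. Qed.

Lemma near_cimg i p : cdom i p -> \forall y \near cmap i p, cimg i y.
Proof.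
by move=> ip; apply: open_nbhs_nbhs; split; [exact: cimg_open|exact: cmap_cimg].
Qed.

Lemma near_cinv i p (P : set M) : cdom i p -> nbhs p P ->
  \forall y \near cmap i p, P (cinv i y).
Proof. by move=> ip pP; apply: (cinv_continuous ip); rewrite cmapK. Qed.

Lemma near_chart i p (P : set H) : cdom i p -> nbhs (cmap i p) P ->
  \forall q \near p, cdom i q /\ P (cmap i q).
Proof.
move=> ip pP; apply: filterI; first exact: near_cdom.
exact: (cmap_continuous ip pP).
Qed.

Lemma to_tangentE i p v : cdom i p ->
  to_tangent i (cmap i p) v = 'd (cmap (chart_at X p) \o cinv i) (cmap i p) v.
Proof. by move=> ip; rewrite /to_tangent cmapK. Qed.

(** TM_p is identified with H by the preferred chart, so there coordinates and
tangent vectors agree. *)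
Lemma to_tangent_chart_at p v :
  to_tangent (chart_at X p) (cmap (chart_at X p) p) v = v.
Proof.
have ip := chart_atP X p; rewrite to_tangentE//.
set i := chart_at X p in ip *.
have h : \forall y \near cmap i p, idfun y = (cmap i \o cinv i) y.
  by apply: filterS (near_cimg ip) => y /cimgP[_ /= ->].
have did : is_diff (cmap i p) (@idfun H) idfun by exact: is_diff_id.
have d1 : differentiable (@idfun H) (cmap i p) by [].
by rewrite (diff_near_eq h d1).2 diff_val.
Qed.

Lemma to_tangent_linear i y k u v :
  to_tangent i y (k *: u + v) = k *: to_tangent i y u + to_tangent i y v.
Proof. exact: linearP. Qed.

Lemma to_tangent_bounded i y : cimg i y ->
  exists2 C, 0 < C & forall v, `|to_tangent i y v| <= C * `|v|.
Proof.
move=> [p ip <-]; have := C1at_differentiable (transition_C1at ip (chart_atP X p)).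
move=> /diff_bounded[C C0 HC]; exists C; first exact: C0.
by move=> v; rewrite (to_tangentE _ ip); exact: HC.
Qed.

Lemma C1_function_at (phi : M -> R) i p : C1_function X phi -> cdom i p ->
  C1at (phi \o cinv i : H -> R^o) (cmap i p).
Proof.
move=> phiC ip; apply: C1_on_at (phiC i) _; [exact: cimg_open|exact: cmap_cimg].
Qed.

(** The chain rule through the transition from chart [i] to the preferred chart:
it lets differentials be computed in whichever chart is at hand. *)
Lemma dfun_to_tangent (phi : M -> R) i p v :
  C1_function X phi -> cdom i p ->
  dfun X phi p (to_tangent i (cmap i p) v) = 'd (phi \o cinv i : H -> R^o) (cmap i p) v.
Proof.
move=> phiC ip; have jp := chart_atP X p; rewrite to_tangentE// /dfun.
set j := chart_at X p in jp *.
have dT := C1at_differentiable (transition_C1at ip jp).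
have dj := C1at_differentiable (C1_function_at phiC jp).
have Tp : (cmap j \o cinv i) (cmap i p) = cmap j p by rewrite /= cmapK.
have dj' : differentiable (phi \o cinv j : H -> R^o) ((cmap j \o cinv i) (cmap i p)).
  by rewrite Tp.
have h : \forall y \near cmap i p,
    ((phi \o cinv j) \o (cmap j \o cinv i)) y = (phi \o cinv i) y.
  by apply: filterS (near_cinv ip (near_cdom jp)) => y jy /=; rewrite cmapK.
have dc := differentiable_comp dT dj'.
by rewrite (diff_near_eq h dc).2 (diff_comp dT dj')/= cmapK.
Qed.

(** The transition map has the opposite transition as inverse, so its
differential is onto: every tangent vector has coordinates in chart [i]. *)
Lemma to_tangent_surj i p w : cdom i p -> exists v, to_tangent i (cmap i p) v = w.
Proof.
move=> ip; have jp := chart_atP X p; set j := chart_at X p in jp.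
exists ('d (cmap i \o cinv j) (cmap j p) w); rewrite to_tangentE// -/j.
have dS := C1at_differentiable (transition_C1at jp ip).
have dT := C1at_differentiable (transition_C1at ip jp).
have Sp : (cmap i \o cinv j) (cmap j p) = cmap i p by rewrite /= cmapK.
have dT' : differentiable (cmap j \o cinv i) ((cmap i \o cinv j) (cmap j p)).
  by rewrite Sp.
have h : \forall y \near cmap j p, ((cmap j \o cinv i) \o (cmap i \o cinv j)) y
    = (cmap j \o cinv j) y.
  by apply: filterS (near_cinv jp (near_cdom ip)) => y jy /=; rewrite cmapK.
have dc := differentiable_comp dS dT'.
have := diff_comp_apply w dS dT'; rewrite Sp => <-.
rewrite -(diff_near_eq h dc).2 -(to_tangentE _ jp).
exact: to_tangent_chart_at.
Qed.

End Charts.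

(** * The metric read in a chart *)

Section MetricInCharts.
Variables (R : realType) (H : completeNormedModType R) (M : topologicalType).
Variable X : riemannian_manifold H M.
Implicit Types (i j : chart X) (p : M) (y v w : H).

Lemma metric_inner_product p : inner_product (metric X p).
Proof. by split; [move=> v w; exact: (Defs.metric_sym X p v w)|exact: (metric_equiv X p)]. Qed.

Lemma tnorm_gnorm p v : tnorm X p v = gnorm (metric X p) v. Proof. by []. Qed.

(** The Riemannian norm of the vector with coordinates [v] at the point with
coordinates [y]. *)
Definition chart_norm i y v : R := tnorm X (cinv i y) (to_tangent i y v).

Lemma chart_norm_ge0 i y v : 0 <= chart_norm i y v.
Proof. exact: sqrtr_ge0. Qed.

Lemma sqr_chart_norm i y v : chart_norm i y v ^+ 2 = local_metric i y v v.
Proof. exact: sqr_gnorm (metric_inner_product _) _. Qed.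

Lemma chart_norm_center p v :
  chart_norm (chart_at X p) (cmap (chart_at X p) p) v = tnorm X p v.
Proof. by rewrite /chart_norm to_tangent_chart_at cmapK//; exact: chart_atP. Qed.

(** The metric is smooth as a map to bounded bilinear forms, whence an estimate
uniform in [v]; this uniformity is what makes charts almost isometric. *)
Lemma local_metric_near i p e : cdom i p -> 0 < e ->
  \forall y \near cmap i p, forall v,
    `|local_metric i y v v - local_metric i (cmap i p) v v| <= e * `|v| ^+ 2.
Proof.
move=> ip e0; have [D [D0 Dlin Dd]] := metric_smooth (i : chart X).
have Uy := cmap_cimg ip; set y := cmap i p in Uy *.
have [_ [C0 LC0]] := Dlin 3%N y isT Uy.
pose C := `|C0| + 1; have Cpos : 0 < C by rewrite ltr_wpDl.
have h1 := Dd 2%N y isT Uy 1 ltr01.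
have h2 : \forall h \near (0 : H), `|h| <= e / (1 + C).
  by apply: nbhs0_le; apply: divr_gt0 => //; apply: addr_gt0.
have nearU : \forall h \near (0 : H), cimg i (y + h).
  by apply: (near_translate y (cimg i)).1; exact: near_cimg.
apply/near_translate; apply: filterS3 nearU h1 h2 => h Uyh Hh hC v.
have := Hh [:: v; v] erefl.
rewrite (D0 _ [:: v; v] Uyh erefl) (D0 _ [:: v; v] Uy erefl).
rewrite -/(local_metric i (y + h) v v) -/(local_metric i y v v).
rewrite !big_cons big_nil mulr1 mul1r => {}Hh.
have := LC0 [:: h; v; v] erefl; rewrite !big_cons big_nil mulr1 => Hhv.
rewrite -[X in `|X|](subrK (D y [:: h; v; v])) (le_trans (ler_normD _ _))//.
apply: (@le_trans _ _ ((1 + C) * `|h| * (`|v| * `|v|))).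
  rewrite 2!mulrDl mul1r lerD// (le_trans Hhv)// -mulrA ler_wpM2r ?mulr_ge0//.
  by rewrite (le_trans (ler_norm _))// /C lerDl.
by rewrite -expr2 ler_wpM2r ?exprn_ge0// mulrC -ler_pdivlMr// addr_gt0.
Qed.

(** The key comparison: near p, the Riemannian norm is, up to a factor close to 1,
the fixed Hilbert norm of TM_p.  All the geometry below is done in this fixed
norm. *)
Lemma chart_norm_near p e : 0 < e < 1 ->
  \forall y \near cmap (chart_at X p) p, forall v,
    (1 - e) * tnorm X p v <= chart_norm (chart_at X p) y v <= (1 + e) * tnorm X p v.
Proof.
move=> /andP[e0 e1]; set i := chart_at X p.
have ip : cdom i p := chart_atP X p.
have HG := metric_inner_product p.
have [c [C [c0 C0 HC]]] := gnorm_equiv HG.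
have ec0 : 0 < e * c ^+ 2 by rewrite mulr_gt0// exprn_gt0.
apply: filterS (local_metric_near ip ec0) => y Hy v.
have := Hy v; rewrite -!sqr_chart_norm chart_norm_center.
set n := chart_norm i y v; set N := tnorm X p v => Hn.
have n0 : 0 <= n by exact: chart_norm_ge0.
have N0 : 0 <= N by exact: gnorm_ge0.
have cN : c ^+ 2 * `|v| ^+ 2 <= N ^+ 2.
  have /andP[h _] := HC v; rewrite -exprMn ler_pXn2r ?nnegrE//.
  by rewrite mulr_ge0// ltW.
have : `|n ^+ 2 - N ^+ 2| <= e * N ^+ 2.
  by rewrite (le_trans Hn)// -mulrA ler_pM2l.
rewrite ler_norml => /andP[h1 h2].
have N2 : 0 <= N ^+ 2 by rewrite exprn_ge0.
have e2 : 0 <= e * N ^+ 2 by rewrite mulr_ge0// ltW.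
have ee : 0 <= e ^+ 2 * N ^+ 2 by rewrite mulr_ge0// exprn_ge0// ltW.
have ee1 : e ^+ 2 * N ^+ 2 <= e * N ^+ 2.
  by rewrite ler_wpM2r// expr2 ler_piMl// ltW.
have a1 : 0 <= (1 - e) * N by rewrite mulr_ge0// subr_ge0 ltW.
have a2 : 0 <= (1 + e) * N by rewrite mulr_ge0// addr_ge0// ltW.
apply/andP; split; rewrite -(@ler_pXn2r _ 2)// ?nnegrE//.
  have -> : ((1 - e) * N) ^+ 2 = N ^+ 2 - 2 * (e * N ^+ 2) + e ^+ 2 * N ^+ 2 by ring.
  lra.
have -> : ((1 + e) * N) ^+ 2 = N ^+ 2 + 2 * (e * N ^+ 2) + e ^+ 2 * N ^+ 2 by ring.
lra.
Qed.

(** Move the vector first at the fixed base point, where the form is continuous,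
then the base point, uniformly in the vector by [local_metric_near]. *)
Lemma local_metric_cvg T (F : set_system T) (FF : Filter F) i p
    (y : T -> H) (v : T -> H) v0 :
  cdom i p -> y @ F --> cmap i p -> v @ F --> v0 ->
  local_metric i (y t) (v t) (v t) @[t --> F] --> local_metric i (cmap i p) v0 v0.
Proof.
move=> ip ycvg vcvg; set y0 := cmap i p.
have cvg1 : local_metric i y0 (v t) (v t) @[t --> F] --> local_metric i y0 v0 v0.
  have [C C0 HC] := to_tangent_bounded (cmap_cimg ip).
  have Tcvg : to_tangent i y0 (v t) @[t --> F] --> to_tangent i y0 v0.
    apply/cvgrPdist_le => e e0.
    have eC : 0 < e / C by rewrite divr_gt0.
    move/cvgrPdist_le : vcvg => /(_ _ eC); apply: filterS => t Ht.
    rewrite -[X in `|X|](_ : to_tangent i y0 (v0 - v t) = _); last first.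
      by rewrite -scaleN1r addrC to_tangent_linear scaleN1r addrC.
    by rewrite (le_trans (HC _))// mulrC -ler_pdivlMr.
  exact: (bi_continuous (metric_inner_product _) FF Tcvg Tcvg).
rewrite -[X in _ --> X]add0r.
rewrite (_ : (fun t => _) = (fun t => (local_metric i (y t) (v t) (v t)
   - local_metric i y0 (v t) (v t)) + local_metric i y0 (v t) (v t))); last first.
  by apply/funext => t; rewrite subrK.
apply: cvgD cvg1.
apply/cvgrPdist_le => e e0.
pose k := (`|v0| + 1) ^+ 2; have k0 : 0 < k by rewrite exprn_gt0// ltr_wpDl.
have ek : 0 < e / k by rewrite divr_gt0.
have h1 : \forall t \near F, forall w, `|local_metric i (y t) w w - local_metric i y0 w w| <= e / k * `|w| ^+ 2.
  exact: (ycvg _ (local_metric_near ip ek)).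
have h2 : \forall t \near F, `|v0 - v t| <= 1.
  by move/cvgrPdist_le : vcvg; apply.
apply: filterS2 h1 h2 => t /= h1 h2.
rewrite sub0r normrN (le_trans (h1 _))// -mulrA ler_piMr ?(ltW e0)// mulrC ler_pdivrMr// mul1r.
rewrite ler_pXn2r ?nnegrE ?addr_ge0//.
rewrite -[X in `|X|](subrK v0) addrC (le_trans (ler_normD _ _))// lerD2l.
by rewrite distrC.
Qed.

Lemma chart_norm_cvg T (F : set_system T) (FF : Filter F) i p
    (y : T -> H) (v : T -> H) v0 :
  cdom i p -> y @ F --> cmap i p -> v @ F --> v0 ->
  chart_norm i (y t) (v t) @[t --> F] --> chart_norm i (cmap i p) v0.
Proof.
move=> ip ycvg vcvg.
have h := local_metric_cvg FF ip ycvg vcvg.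
exact: (cvg_comp _ _ h (@sqrt_continuous R _)).
Qed.

End MetricInCharts.

(** * Derivatives of curves and their speed *)

Lemma is_derive_chain (R : realType) (V W : normedModType R) (x : R -> V)
    (T : V -> W) (t : R) v :
  differentiable T (x t) -> is_derive t 1 x v ->
  is_derive t 1 (T \o x) ('d T (x t) v).
Proof.
move=> dT [dx xv].
have dx' : differentiable x t by exact/derivable1_diffP.
have dc : differentiable (T \o x) t by exact: differentiable_comp.
apply: DeriveDef; first exact/derivable1_diffP.
rewrite deriveE// (diff_comp dx' dT) /=.
by rewrite -xv deriveE.
Qed.

Lemma is_derive_affine (R : realType) (V : normedModType R) (x : R -> V)
    (k m t : R) v :
  is_derive (k * t + m) 1 x v -> is_derive t 1 (fun s => x (k * s + m)) (k *: v).
Proof.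
move=> [dx xv].
have dx' : differentiable x (k * t + m) by exact/derivable1_diffP.
have dA : is_derive t 1 (fun s : R => k * s + m) k.
  by apply: is_derive_eq; rewrite /GRing.scale /= mulr1 addr0.
have h := @is_derive_chain R R V (fun s : R => k * s + m) x t k dx' dA.
have -> : k *: v = 'd x (k * t + m) k.
  by rewrite (deriv1E dx) derive1E xv.
exact: h.
Qed.

Lemma is_derive_ge0_le (R : realType) (f df : R -> R) (a b : R) : a <= b ->
  (forall t, a <= t <= b -> is_derive t 1 f (df t)) ->
  (forall t, a <= t <= b -> 0 <= df t) -> f a <= f b.
Proof.
move=> ab fd d0.
have dr t : t \in `]a, b[ -> derivable f t 1.
  by rewrite in_itv/= => /andP[/ltW h1 /ltW h2]; have [] := fd t; rewrite ?h1.
apply: (@ger0_derive1_le_cc R f a b dr) => //.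
- move=> t; rewrite in_itv/= => /andP[/ltW h1 /ltW h2].
  have tab : a <= t <= b by rewrite h1.
  by have [_ h] := fd t tab; rewrite derive1E h d0.
- apply: continuous_in_subspaceT => t; rewrite inE/= in_itv/= => tab.
  have [h _] := fd t tab.
  by apply: differentiable_continuous; exact/derivable1_diffP.
- by rewrite in_itv/= lexx.
- by rewrite in_itv/= lexx ab.
Qed.

Lemma is_derive_scale (R : realType) (f : R -> R) (k d t : R) :
  is_derive t 1 f d -> is_derive t 1 (fun s => k * f s) (k * d).
Proof. by move=> fd; exact: (is_deriveZ k fd). Qed.

(** The mean value inequality, from the scalar case applied to the product with the
fixed vector w = x b - x a. *)
Lemma gnorm_mean_value (R : realType) (H : normedModType R)
    (G : {bilinear H -> H -> R^o}) (x dx : R -> H) (l dl : R -> R) (a b K : R) :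
  inner_product G -> a <= b ->
  (forall t, a <= t <= b -> is_derive t 1 x (dx t)) ->
  (forall t, a <= t <= b -> is_derive t 1 l (dl t)) ->
  (forall t, a <= t <= b -> gnorm G (dx t) <= K * dl t) ->
  gnorm G (x b - x a) <= K * (l b - l a).
Proof.
move=> HG ab xd ld dxl; set w := x b - x a.
have [w0|w0] := eqVneq (gnorm G w) 0.
  rewrite w0 -subr_ge0 subr0 mulrBr subr_ge0.
  apply: (@is_derive_ge0_le _ (fun t => K * l t) (fun t => K * dl t)) => //.
    by move=> t tab; exact: is_derive_scale (ld t tab).
  by move=> t tab; rewrite (le_trans _ (dxl t tab))// gnorm_ge0.
have wpos : 0 < gnorm G w by rewrite lt_neqAle eq_sym w0 gnorm_ge0.
rewrite -(ler_pM2l wpos) -expr2 sqr_gnorm// {2}/w (biBr G) -subr_ge0.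
have key : gnorm G w * (K * l a) - G w (x a) <= gnorm G w * (K * l b) - G w (x b).
  apply: (@is_derive_ge0_le _ (fun t => gnorm G w * (K * l t) - G w (x t))
    (fun t => gnorm G w * (K * dl t) - G w (dx t))) => //.
    move=> t tab; have h1 := ld t tab; have h2 := xd t tab.
    have [cL dL] := C1diff_linear HG w (x t).
    have h3 := is_derive_chain (C1at_differentiable cL) h2.
    rewrite dL in h3.
    by apply: is_deriveB.
  move=> t tab; rewrite subr_ge0 (le_trans (ler_norm _))//.
  by rewrite (le_trans (cauchy_schwarz HG _ _))// ler_pM2l// dxl.
move: key; move: (G w (x a)) (G w (x b)) => r1 r2; lra.
Qed.

Section Curves.
Variables (R : realType) (H : completeNormedModType R) (M : topologicalType).
Variable X : riemannian_manifold H M.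
Implicit Types (i j : chart X) (p : M) (c : R -> M) (t : R).

Definition speed c t : R := tnorm X (c t) (velocity X c t).

Lemma speed_ge0 c t : 0 <= speed c t. Proof. exact: sqrtr_ge0. Qed.

Lemma C1_curve_derivable (A : set R) c t i : C1_curve_on X A c -> A t -> cdom i (c t) ->
  derivable (cmap i \o c : R -> H) t 1.
Proof. by move=> cC /cC[_ /(_ i) h] /h[/nbhs_singleton]. Qed.

(** The definition of the velocity uses a chart depending on the point of the
curve; this reads it in a fixed chart, which gives continuity of the speed. *)
Lemma velocity_in_chart (A : set R) c t i : C1_curve_on X A c -> A t -> cdom i (c t) ->
  velocity X c t = to_tangent i (cmap i (c t)) ((cmap i \o c : R -> H)^`()%classic t).
Proof.
move=> cC At ict; have jct := chart_atP X (c t); rewrite to_tangentE// /velocity.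
set j := chart_at X (c t) in jct *.
have di := C1_curve_derivable cC At ict.
have h1 : is_derive t 1 (cmap i \o c) ((cmap i \o c : R -> H)^`()%classic t).
  by rewrite derive1E; exact/derivableP.
have dT := C1at_differentiable (transition_C1at ict jct).
have h2 := @is_derive_chain R H H (cmap i \o c) _ t _ dT h1.
have ceq : \forall s \near t, ((cmap j \o cinv i) \o (cmap i \o c)) s = (cmap j \o c) s.
  have h : \forall s \near t, cdom i (c s) := (cC t At).1 _ (near_cdom ict).
  by apply: filterS h => s /= ics; rewrite cmapK.
rewrite derive1E -(near_eq_derive _ ceq).
by have [_ ->] := h2.
Qed.

Lemma speed_in_chart (A : set R) c t i : C1_curve_on X A c -> A t -> cdom i (c t) ->
  speed c t = chart_norm i (cmap i (c t)) ((cmap i \o c : R -> H)^`()%classic t).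
Proof.
by move=> cC At ict; rewrite /speed (velocity_in_chart cC At ict) /chart_norm cmapK.
Qed.

Lemma speed_continuous (A : set R) c t : open A -> C1_curve_on X A c -> A t ->
  {for t, continuous (speed c)}.
Proof.
move=> oA cC At; set i := chart_at X (c t); have ict : cdom i (c t) := chart_atP X (c t).
have [ct /(_ i ict)[_ dct]] := cC t At.
have near_i : \forall s \near t, A s /\ cdom i (c s).
  by apply: filterI; [exact: open_nbhs_nbhs|exact: ct (near_cdom ict)].
rewrite /prop_for/continuous_at (speed_in_chart cC At ict).
have xc : (cmap i \o c) s @[s --> t] --> cmap i (c t).
  exact: (cvg_comp _ _ ct (cmap_continuous ict)).
have h := chart_norm_cvg (nbhs_filter t) ict xc dct.
apply: cvg_trans h; apply: near_eq_cvg.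
by apply: filterS near_i => s [As ics]; rewrite /= (speed_in_chart cC As ics).
Qed.

End Curves.

(** * Pieces of C^1 curves and their lengths *)

Lemma derive1_affine (R : realType) (V : normedModType R) (x : R -> V) (k m t : R) :
  derivable x (k * t + m) 1 -> is_derive t 1 (fun s => x (k * s + m))
      (k *: x^`()%classic (k * t + m)) /\
  (fun s => x (k * s + m))^`()%classic t = k *: x^`()%classic (k * t + m).
Proof.
move=> dx.
have h : is_derive t 1 (fun s => x (k * s + m)) (k *: x^`()%classic (k * t + m)).
  by apply: is_derive_affine; rewrite derive1E; exact/derivableP.
by split=> //; rewrite derive1E; case: h.
Qed.

Section Pieces.
Variables (R : realType) (H : completeNormedModType R) (M : topologicalType).
Variable X : riemannian_manifold H M.
Implicit Types (i j : chart X) (p : M) (c : R -> M) (t : R).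

(** The length is carried by a primitive [l] of the speed instead of an integral,
so that sub-pieces, reversals and reparametrizations need no measure theory. *)
Definition piece c (l : R -> R) (a b : R) :=
  [/\ a <= b,
      exists2 e, 0 < e & C1_curve_on X [set` `]a - e, b + e[ ] c &
      forall t, a <= t <= b -> is_derive t 1 l (speed X c t)].

(** Points joined by finitely many pieces of total length [l].  The pieces keep
their own parameter intervals; concatenation then costs nothing. *)
Inductive reach : M -> M -> R -> Prop :=
| reach_piece c l a b : piece c l a b -> reach (c a) (c b) (l b - l a)
| reach_trans x y z l m : reach x y l -> reach y z m -> reach x z (l + m).

Lemma piece_sub c l a b a' b' : piece c l a b -> a <= a' -> a' <= b' -> b' <= b ->
  piece c l a' b'.
Proof.
move=> [ab [e e0 cC] ld] aa' ab' bb'; split=> //.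
  exists e => // t; rewrite /= in_itv/= => /andP[h1 h2]; apply: cC.
  rewrite /= in_itv/= (le_lt_trans _ h1) ?lerD2r//=.
  by rewrite (lt_le_trans h2)// lerD2r.
move=> t /andP[h1 h2]; apply: ld.
by rewrite (le_trans aa' h1) (le_trans h2 bb').
Qed.

Lemma piece_primitive_continuous c l a b t : piece c l a b -> a <= t <= b ->
  {for t, continuous l}.
Proof.
move=> [_ _ ld] tab; have [h _] := ld t tab.
by apply: differentiable_continuous; exact/derivable1_diffP.
Qed.

Lemma piece_le c l a b : piece c l a b -> l a <= l b.
Proof.
move=> [ab _ ld]; apply: (is_derive_ge0_le ab ld) => t _; exact: speed_ge0.
Qed.

Lemma reach_ge0 x y l : reach x y l -> 0 <= l.
Proof.
elim=> [c l' a b /piece_le|*]; first by rewrite subr_ge0.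
exact: addr_ge0.
Qed.

(** A curve of length l has, by the intermediate value theorem applied to the
primitive of its speed, a point at length s.  This is why d is a length
metric. *)
Lemma reach_split x y l s : reach x y l -> 0 <= s <= l ->
  exists z, reach x z s /\ reach z y (l - s).
Proof.
move=> xyl; elim: xyl s => [c l' a b cl|{}x y' {}y l1 l2 r1 IH1 r2 IH2] s /andP[s0 sl].
  have [ab _ _] := cl.
  have [||t] := @IVT R l' a b (l' a + s) ab.
  - apply: continuous_in_subspaceT => t; rewrite inE/= in_itv/= => tab.
    exact: piece_primitive_continuous cl tab.
  - have lab := piece_le cl.
    by rewrite (min_idPl lab) (max_idPr lab) lerDl s0/= -lerBrDl.
  rewrite in_itv/= => /andP[ta tb] lt.
  exists (c t); split.
    have -> : s = l' t - l' a by rewrite lt addrC addKr.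
    exact: reach_piece (piece_sub cl (lexx a) ta tb).
  have -> : l' b - l' a - s = l' b - l' t by rewrite lt opprD addrA.
  exact: reach_piece (piece_sub cl ta tb (lexx b)).
have [sl1|l1s] := leP s l1.
  have [|z [xz zy']] := IH1 s; first by rewrite s0.
  by exists z; split=> //; rewrite addrAC; exact: reach_trans zy' r2.
have [|z [xz zy']] := IH2 (s - l1).
  by rewrite subr_ge0 (ltW l1s)/= lerBlDl.
exists z; split; first by rewrite -(subrK l1 s) addrC; exact: reach_trans r1 xz.
by have -> : l1 + l2 - s = l2 - (s - l1) by ring.
Qed.

(** The affine maps k t + m cover translations, rescalings and, for k = -1, reversal
of time. *)
Lemma C1_curve_affine (A : set R) c (k m : R) : C1_curve_on X A c ->
  C1_curve_on X [set t | A (k * t + m)] (fun t => c (k * t + m)).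
Proof.
move=> cC t /= At; have [ct cd] := cC _ At.
have Ac : {for t, continuous (fun s : R => k * s + m)}.
  by apply: cvgD; [apply: cvgMr; exact: cvg_id|exact: cvg_cst].
split; first exact: (cvg_comp _ _ Ac ct).
move=> i ict; have [d1 d2] := cd i ict.
have near_d : \forall s \near t, derivable (cmap i \o c : R -> H) (k * s + m) 1.
  exact: (Ac _ d1).
split; first by apply: filterS near_d => s /derive1_affine[[]].
rewrite /prop_for/continuous_at.
have -> : (cmap i \o (fun t0 => c (k * t0 + m)) : R -> H)^`()%classic t =
    k *: (cmap i \o c : R -> H)^`()%classic (k * t + m).
  exact: (derive1_affine (nbhs_singleton near_d)).2.
have h : k *: (cmap i \o c : R -> H)^`()%classic (k * s + m) @[s --> t] -->
   k *: (cmap i \o c : R -> H)^`()%classic (k * t + m).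
  apply: cvgZr; exact: (cvg_comp _ _ Ac d2).
apply: cvg_trans h; apply: near_eq_cvg.
by apply: filterS near_d => s hs; symmetry; exact: (derive1_affine hs).2.
Qed.

Lemma speed_affine (A : set R) c (k m t : R) : C1_curve_on X A c -> A (k * t + m) ->
  speed X (fun t => c (k * t + m)) t = `|k| * speed X c (k * t + m).
Proof.
move=> cC At; rewrite /speed !tnorm_gnorm -gnormZ ?metric_inner_product//.
congr gnorm; rewrite /velocity; set j := chart_at X _.
have [_ /(_ j)[|/nbhs_singleton h _]] := cC _ At; first exact: chart_atP.
exact: (derive1_affine h).2.
Qed.

Lemma piece_affine c l a b (k m a' b' : R) :
  piece c l a b -> 0 <= k -> a' <= b' -> k * a' + m = a -> k * b' + m = b ->
  piece (fun t => c (k * t + m)) (fun t => l (k * t + m)) a' b'.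
Proof.
move=> [ab [e e0 cC] ld] k0 ab' Ea Eb.
have sub t : a' <= t <= b' -> a <= k * t + m <= b.
  by move=> /andP[h1 h2]; rewrite -Ea -Eb !lerD2r !ler_wpM2l.
have cC' := @C1_curve_affine _ c k m cC.
have k1 : 0 < k + 1 by rewrite ltr_wpDl.
pose q := e / (k + 1); have q0 : 0 < q by rewrite divr_gt0.
have qe : k * q < e.
  have : q * (k + 1) = e by rewrite divfK// gt_eqF.
  by move=> h; rewrite -{}h mulrDr mulr1 mulrC ltrDl.
split=> //.
  exists q => // t; rewrite /= in_itv/= => /andP[h1 h2]; apply: cC'.
  have h3 : k * (a' - q) <= k * t by rewrite ler_wpM2l// ltW.
  have h4 : k * t <= k * (b' + q) by rewrite ler_wpM2l// ltW.
  rewrite /= in_itv/= -Ea -Eb; move: h3 h4; rewrite mulrBr mulrDr => h3 h4.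
  by apply/andP; split; lra.
move=> t tab; have tab' := sub t tab.
have tA : [set` `]a - e, b + e[ ] (k * t + m).
  move: tab' => /andP[h1 h2]; rewrite /= in_itv/= (lt_le_trans _ h1) ?gtrBl//=.
  by rewrite (le_lt_trans h2)// ltrDl.
rewrite (speed_affine cC tA) ger0_norm//.
exact: is_derive_affine (ld _ tab').
Qed.

Lemma piece_opp c l a b : piece c l a b ->
  piece (fun t => c (-1 * t + 0)) (fun t => - l (-1 * t + 0)) (- b) (- a).
Proof.
move=> [ab [e e0 cC] ld].
have cC' := @C1_curve_affine _ c (-1) 0 cC.
split; first by rewrite lerN2.
  exists e => // t; rewrite /= in_itv/= => /andP[h1 h2]; apply: cC'.
  by rewrite /= in_itv/= mulN1r addr0; apply/andP; split; lra.
move=> t /andP[h1 h2].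
have tab' : a <= -1 * t + 0 <= b by rewrite mulN1r addr0 lerNr lerNl h1 h2.
have tA : [set` `]a - e, b + e[ ] (-1 * t + 0).
  move: tab' => /andP[h3 h4]; rewrite /= in_itv/= (lt_le_trans _ h3) ?gtrBl//=.
  by rewrite (le_lt_trans h4)// ltrDl.
rewrite (speed_affine cC tA) normrN normr1.
have h := is_derive_affine (ld _ tab').
have -> : 1 * speed X c (-1 * t + 0) = - (-1 *: (speed X c (-1 * t + 0) : R^o)).
  by rewrite scaleN1r opprK mul1r.
exact: (is_deriveN h).
Qed.

Lemma reach_sym x y l : reach x y l -> reach y x l.
Proof.
elim=> [c l' a b cl|x0 y0 z0 l1 l2 _ IH1 _ IH2]; last by rewrite addrC; exact: reach_trans IH2 IH1.
have := reach_piece (piece_opp cl).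
by rewrite !mulN1r !opprK !addr0 addrC.
Qed.

(** The primitive starts slightly before a, so that it is differentiable at a as
well. *)
Lemma piece_exists (a b e : R) c : a <= b -> 0 < e ->
  C1_curve_on X [set` `]a - e, b + e[ ] c -> exists l, piece c l a b.
Proof.
move=> ab e0 cC.
have oA : open [set` `]a - e, b + e[ ] by exact: interval_open.
have cs t : a - e < t < b + e -> {for t, continuous (speed X c)}.
  by move=> h; apply: speed_continuous oA cC _; rewrite /= in_itv.
pose u := b + e / 2; pose v := a - e / 2.
have vu t : v <= t <= u -> a - e < t < b + e.
  by rewrite /u /v => /andP[h1 h2]; apply/andP; split; lra.
have integ : (@lebesgue_measure R).-integrable `[v, u] (EFin \o speed X c).
  apply: continuous_compact_integrable; first exact: segment_compact.
  by apply: continuous_in_subspaceT => t; rewrite inE/= in_itv/= => /vu/cs.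
exists (fun x => \int[@lebesgue_measure R]_(t in `[v, x]) speed X c t); split=> //.
  by exists e.
move=> t /andP[h1 h2].
have [|||d1 d2] := @continuous_FTC1_closed R (speed X c) v t u _ integ.
- by rewrite /u; lra.
- by rewrite /v; lra.
- by apply: cs; apply/andP; split; lra.
by apply: DeriveDef; [exact: d1|rewrite -derive1E; exact: d2].
Qed.

Lemma reach_refl p : reach p p 0.
Proof.
have cC : C1_curve_on X [set` `](0 : R) - 1, 0 + 1[ ] (fun=> p).
  move=> t _; split; first exact: cst_continuous.
  move=> i ip; rewrite (_ : _ \o _ = cst (cmap i p))//; split.
    by near do exact: derivable_cst.
  rewrite (_ : _^`()%classic = cst 0); first exact: cst_continuous.
  by apply/funext => s; rewrite derive1_cst.
have [l pl] := piece_exists (lexx 0) ltr01 cC.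
by have := reach_piece pl; rewrite subrr.
Unshelve. all: by end_near. Qed.

End Pieces.

(** * Piecewise C^1 curves and the distance *)

Section Arcs.
Variables (R : realType) (H : completeNormedModType R) (M : topologicalType).
Variable X : riemannian_manifold H M.
Implicit Types (c : R -> M) (a b m t : R).
Local Notation mu := (@lebesgue_measure R).

(** Like [reach], but for one curve on one interval: [arc a b c l] says that [c] is
made on [a, b] of pieces of total length [l].  It mediates between [reach] and
the curves on [0, 1] in the definition of the distance. *)
Inductive arc : R -> R -> (R -> M) -> R -> Prop :=
| arc_piece c c' l a b : a < b -> piece X c' l a b ->
    (forall t, a <= t <= b -> c t = c' t) -> arc a b c (l b - l a)
| arc_cat c a m b l1 l2 : arc a m c l1 -> arc m b c l2 -> arc a b c (l1 + l2).

Lemma arc_lt a b c l : arc a b c l -> a < b.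
Proof. by elim=> [//|*]; apply: lt_trans; eassumption. Qed.

Lemma arc_eq a b c c2 l : arc a b c l -> (forall t, a <= t <= b -> c t = c2 t) ->
  arc a b c2 l.
Proof.
move=> h; elim: h c2 => [{}c c' l' {}a {}b ab cl cc'|{}c {}a m {}b l1 l2 h1 IH1 h2 IH2] c2 cc2.
  by apply: arc_piece cl _ => // t tab; rewrite -cc2// cc'.
apply: arc_cat (IH1 _ _) (IH2 _ _) => t /andP[h3 h4]; apply: cc2; rewrite ?h3 ?h4 ?andbT/=.
  by rewrite (le_trans h4)// ltW// (arc_lt h2).
by rewrite (le_trans _ h3)// ltW// (arc_lt h1).
Qed.

Lemma arc_reach a b c l : arc a b c l -> reach X (c a) (c b) l.
Proof.
elim=> [{}c c' l' {}a {}b ab cl cc'|{}c {}a m {}b l1 l2 h1 IH1 h2 IH2].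
  by rewrite !cc' ?lexx ?(ltW ab)//; exact: reach_piece.
exact: reach_trans IH1 IH2.
Qed.

Lemma reach_arc x y l : reach X x y l -> forall a b, a < b ->
  exists c, [/\ arc a b c l, c a = x & c b = y].
Proof.
elim=> [c l' a0 b0 cl|{}x y' {}y l1 l2 h1 IH1 h2 IH2] a b ab.
  pose k := (b0 - a0) / (b - a); pose m := a0 - k * a.
  have ba0 : b - a != 0 by rewrite subr_eq0 gt_eqF.
  have [ab0 _ _] := cl.
  have Ea : k * a + m = a0 by rewrite /m addrC subrK.
  have Eb : k * b + m = b0 by rewrite /m /k; field.
  have k0 : 0 <= k by rewrite divr_ge0 ?subr_ge0 ?(ltW ab).
  have cl' := piece_affine cl k0 (ltW ab) Ea Eb.
  exists (fun t => c (k * t + m)); rewrite Ea Eb; split=> //.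
  have -> : l' b0 - l' a0 = (fun t => l' (k * t + m)) b - (fun t => l' (k * t + m)) a.
    by rewrite /= Ea Eb.
  exact: arc_piece ab cl' _.
pose m := (a + b) / 2.
have am : a < m by rewrite /m; lra.
have mb : m < b by rewrite /m; lra.
have [c1 [ac1 c1a c1m]] := IH1 a m am; have [c2 [ac2 c2m c2b]] := IH2 m b mb.
pose c t := if t <= m then c1 t else c2 t.
exists c; split.
- apply: arc_cat (arc_eq ac1 _) (arc_eq ac2 _) => t /andP[h3 h4]; rewrite /c ?h4//.
  case: ifPn => // tm; have -> : t = m by apply/le_anti; rewrite tm h3.
  by rewrite c2m c1m.
- by rewrite /c (ltW am).
- by rewrite /c leNgt mb.
Qed.

(** The partition of the concatenation is the concatenation of the partitions; the
indices left of the junction and right of it are shifted separately. *)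
Lemma arc_piecewise_C1 a b c l : arc a b c l -> piecewise_C1 X a b c.
Proof.
elim=> [{}c c' l' {}a {}b ab [_ [e e0 cC] _] cc'|{}c {}a m {}b l1 l2 h1 [s1 p1 IH1] h2 [s2 p2 IH2]].
  exists [:: b]; first exact: itv_partition1.
  move=> [|//] _; exists e, c' => /=; split=> // t; rewrite in_itv/=; exact: cc'.
exists (s1 ++ s2); first exact: itv_partition_cat p1 p2.
have ms1 : last a s1 = m by case: p1 => _ /eqP.
move=> k; rewrite size_cat => ks.
have nth1 j : (j <= size s1)%N -> nth b (a :: s1 ++ s2) j = nth m (a :: s1) j.
  move=> js; rewrite -cat_cons nth_cat /= ltnS js; apply: set_nth_default.
  by rewrite /= ltnS.
have nth2 j : (size s1 <= j)%N -> nth b (a :: s1 ++ s2) j = nth b (m :: s2) (j - size s1).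
  rewrite leq_eqVlt => /predU1P[<-|js].
    by rewrite nth1// subnn (itv_partition_nth_size m p1).
  rewrite -cat_cons nth_cat /= ltnS leqNgt js /=.
  by rewrite -[(j - size s1)%N]prednK ?subn_gt0// subnS.
have [ks1|s1k] := ltnP k (size s1).
  have [e [c' h]] := IH1 k ks1; exists e, c'.
  by rewrite nth1 ?(ltnW ks1)// nth1.
have [|e [c' h]] := IH2 (k - size s1)%N; first by rewrite ltn_subLR.
by exists e, c'; rewrite nth2// nth2 ?subSn// leqW.
Qed.

Lemma piecewise_C1_arc a b c : a < b -> piecewise_C1 X a b c -> exists l, arc a b c l.
Proof.
move=> + [s]; elim: s a => [|x s IH] a ab.
  by move=> /itv_partition_nil h; rewrite h ltxx in ab.
move=> ps Hs.
have ax : a < x by case: ps => /= /andP[].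
have ps' := itv_partition_cons ps.
have [e [c' /= [e0 cC cc']]] := Hs 0%N isT.
have [l cl] := piece_exists (ltW ax) e0 cC.
have h1 : arc a x c (l x - l a).
  by apply: (arc_piece ax cl) => t tab; apply: cc'; rewrite in_itv.
have [sE|s0] := eqVneq s [::].
  have xb : x = b by apply: itv_partition_nil; rewrite sE in ps'.
  by exists (l x - l a); rewrite -xb.
have xb : x < b by apply: itv_partition_size_neq0 ps'; case: (s) s0.
have [|l2 h2] := IH x xb ps'.
  by move=> k ks; have := Hs k.+1; rewrite /= ltnS => /(_ ks).
by exists (l x - l a + l2); exact: arc_cat h1 h2.
Qed.

(** On the inside of each piece the speed of [c] is that of the C^1 extension, and
the fundamental theorem of calculus applies; at the junctions the velocity of
[c] may be junk, which the integral does not see. *)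
Lemma arc_length a b c l : arc a b c l ->
  measurable_fun `[a, b] (speed X c) /\
  (\int[mu]_(t in `[a, b]) (speed X c t)%:E = l%:E)%E.
Proof.
elim=> [{}c c' l' {}a {}b ab cl cc'|{}c {}a m {}b l1 l2 h1 [m1 i1] h2 [m2 i2]].
  have [_ [e e0 cC] ld] := cl.
  have tA t : a <= t <= b -> [set` `]a - e, b + e[ ] t.
    move=> /andP[h1 h2]; rewrite /= in_itv/= (lt_le_trans _ h1) ?gtrBl//=.
    by rewrite (le_lt_trans h2)// ltrDl.
  have c'c t : a <= t <= b -> {for t, continuous (speed X c')}.
    by move=> /tA; exact: speed_continuous (interval_open _ _) cC.
  have ss : {in `]a, b[, speed X c =1 speed X c'}.
    move=> t; rewrite in_itv/= => /andP[h1 h2].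
    have ct : c t = c' t by apply: cc'; rewrite (ltW h1) (ltW h2).
    rewrite /speed /velocity ct; congr tnorm.
    rewrite !derive1E; apply: near_eq_derive.
    have : \forall s \near t, a < s < b.
      have := near_in_itvoo; move=> /(_ R a b t); rewrite in_itv/= h1 h2 => /(_ isT).
      by apply: filterS => s; rewrite in_itv.
    by apply: filterS => s /andP[/ltW h3 /ltW h4] /=; rewrite cc'// h3.
  have mo' : measurable_fun `]a, b[ (speed X c').
    apply: open_continuous_measurable_fun; first exact: interval_open.
    by move=> t; rewrite inE/= in_itv/= => /andP[/ltW h3 /ltW h4]; apply: c'c; rewrite h3.
  have mo : measurable_fun `]a, b[ (speed X c).
    by apply: eq_measurable_fun mo' => t; rewrite inE => /ss ->.
  split; first exact: measurable_fun_itv_cc mo.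
  rewrite (@eq_integral_itv_bounded R a b (speed X c') (speed X c) _ _ mo mo' ss).
  rewrite (@continuous_FTC2 R (speed X c') l' a b ab) ?EFinB//.
  - by apply: continuous_in_subspaceT => t; rewrite inE/= in_itv/= => /c'c.
  - have lc t : a <= t <= b -> {for t, continuous l'}.
      by move=> tab; exact: piece_primitive_continuous cl tab.
    split.
    + move=> t; rewrite in_itv/= => /andP[/ltW h3 /ltW h4].
      by have [] := ld t; rewrite ?h3.
    + by apply: cvg_at_right_filter; apply: lc; rewrite lexx ltW.
    + by apply: cvg_at_left_filter; apply: lc; rewrite lexx ltW.
  - move=> t; rewrite in_itv/= => /andP[/ltW h3 /ltW h4].
    have tab : a <= t <= b by rewrite h3.
    by have [_ h] := ld t tab; rewrite derive1E h.
have am := arc_lt h1; have mb := arc_lt h2.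
have E : `[a, b]%classic = `[a, m]%classic `|` `]m, b]%classic.
  by rewrite -itv_bndbnd_setU// bnd_simp ltW.
have m2' : measurable_fun `]m, b] (speed X c) by exact/measurable_fun_itv_obnd_cbndP.
have mE : measurable_fun `[a, b] (speed X c).
  by rewrite E; apply/measurable_funU.
split=> //; rewrite E ge0_integral_setU//.
- by rewrite i1 integral_itv_obnd_cbnd ?i2//; exact/measurable_EFinP.
- by apply/measurable_EFinP; rewrite -E.
- by move=> t _; rewrite lee_fin; exact: speed_ge0.
- apply/disj_setPS => t [] /=; rewrite !in_itv/= => /andP[_ tm] /andP[mt _].
  by move: (lt_le_trans mt tm); rewrite ltxx.
Qed.

(** Here the lengths defined by integrals and by primitives are identified. *)
Lemma reach_curve x y l : reach X x y l <->
  exists c, [/\ piecewise_C1 X 0 1 c, c 0 = x, c 1 = y & curve_length X c = l].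
Proof.
have len c l' : arc 0 1 c l' -> curve_length X c = l'.
  by move=> /arc_length[_ h]; rewrite /curve_length /Rintegral -/(speed X c) h.
split=> [/reach_arc/(_ _ _ ltr01)[c [ac c0 c1]]|[c [pc c0 c1 cl]]].
  by exists c; split=> //; [exact: arc_piecewise_C1 ac|exact: len].
have [l' ac] := piecewise_C1_arc ltr01 pc.
by rewrite -cl (len _ _ ac) -c0 -c1; exact: arc_reach.
Qed.

Lemma rdist_reach x y : rdist X x y = inf [set l | reach X x y l].
Proof.
rewrite /rdist; congr inf; apply/seteqP; split.
  by move=> _ [c [pc c0 c1] <-]; apply/reach_curve; exists c.
by move=> l /reach_curve[c [pc c0 c1 cl]]; exists c.
Qed.

End Arcs.

(** * Short curves stay in a chart *)

Lemma is_derive_line (R : realType) (V : normedModType R) (y w : V) (t : R) :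
  is_derive t 1 (fun s : R => y + s *: w) w.
Proof.
have d : is_diff t (fun s : R => s *: w) (fun s => s *: w).
  have -> : (fun s : R => s *: w) = (fun s : R => (idfun s) *: w) by [].
  exact: is_diff_scalel.
have d1 : differentiable (fun s : R => s *: w) t by [].
have h : is_derive t 1 (fun s : R => s *: w) w.
  apply: DeriveDef; first exact/derivable1_diffP.
  by rewrite deriveE// diff_val scale1r.
rewrite -[X in is_derive _ _ _ X]add0r.
exact: (is_deriveD (is_derive_cst y t 1) h).
Qed.

Section LocalComparison.
Variables (R : realType) (H : completeNormedModType R) (M : topologicalType).
Variable X : riemannian_manifold H M.
Implicit Types (i j : chart X) (p : M) (c : R -> M) (t : R).

Lemma line_C1_curve i (y w : H) (A : set R) :
  (forall t, A t -> cimg i (y + t *: w)) ->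
  C1_curve_on X A (fun t => cinv i (y + t *: w)).
Proof.
move=> Ai t At; pose L (s : R) := y + s *: w.
have Lt : cimg i (L t) := Ai t At.
have Ld (s : R) : is_derive s 1 L w by exact: is_derive_line.
have Lc : {for t, continuous L}.
  apply: differentiable_continuous; apply/derivable1_diffP.
  by have [] := Ld t.
split; first exact: (cvg_comp _ _ Lc (cinv_continuous_at Lt)).
move=> j jt; have [it Et] := cimgP Lt.
(* In another chart j the line becomes its image by the transition map. *)
have [Td Tc] : C1at (cmap j \o cinv i) (L t) by rewrite -Et; exact: transition_C1at.
have nd : \forall s \near t, differentiable (cmap j \o cinv i) (L s) := Lc _ Td.
have nD : \forall s \near t, is_derive (s : R) 1 (cmap j \o (fun t => cinv i (y + t *: w)))
    ('d (cmap j \o cinv i) (L s) w).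
  by apply: filterS nd => s dT; exact: (is_derive_chain dT (Ld s)).
split; first by apply: filterS nD => s [].
have -> : {for t, continuous (cmap j \o (fun t => cinv i (y + t *: w)) : R -> H)^`()%classic} =
   ((cmap j \o (fun t => cinv i (y + t *: w)) : R -> H)^`()%classic s @[s --> t]
     --> 'd (cmap j \o cinv i) (L t) w).
  rewrite /prop_for/continuous_at derive1E.
  by have [_ ->] := nbhs_singleton nD.
have h : 'd (cmap j \o cinv i) (L s) w @[s --> t] --> 'd (cmap j \o cinv i) (L t) w.
  apply/cvgrPdist_le => e e0.
  pose e1 := e / (`|w| + 1); have w1 : 0 < `|w| + 1 by rewrite ltr_wpDl.
  have e10 : 0 < e1 by rewrite divr_gt0.
  have h1 : \forall s \near t, forall v, `|'d (cmap j \o cinv i) (L s) v - 'd (cmap j \o cinv i) (L t) v| <= e1 * `|v| := Lc _ (Tc _ e10).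
  apply: filterS h1 => s /(_ w); rewrite distrC => h1; rewrite (le_trans h1)//.
  by rewrite /e1 mulrAC ler_pdivrMr// ler_wpM2l ?(ltW e0)// lerDl.
apply: cvg_trans h; apply: near_eq_cvg.
by apply: filterS nD => s [_ hs]; rewrite derive1E hs.
Qed.

Section Ball.
Variables (i : chart X) (G : {bilinear H -> H -> R^o}) (HG : inner_product G).
Variables (y0 : H) (r K : R).
Local Notation N := (gnorm G).
Let B := [set y | N (y - y0) < r].
Hypothesis Bi : forall y, B y -> cimg i y.

(** A ball is convex and open, so a segment in it can be prolonged a little; the
prolongation is required of curves of class C^1 on a closed interval. *)
Lemma near_line_in_ball y y' : B y -> B y' ->
  exists2 e, 0 < e & forall t, - e < t < 1 + e -> B (y + t *: (y' - y)).
Proof.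
rewrite /B/= => yr y'r; pose m := Num.max (N (y - y0)) (N (y' - y0)).
have mr : m < r by rewrite gt_max yr.
have m0 : 0 <= m by rewrite le_max gnorm_ge0.
(* Outside [0, 1] the coefficients 1 - t and t have total mass at most 1 + 2 e. *)
pose e := (r - m) / (4 * (m + 1)).
have m1 : 0 < 4 * (m + 1) by rewrite mulr_gt0// ltr_wpDl.
have e0 : 0 < e by rewrite divr_gt0// subr_gt0.
have eE : e * (4 * (m + 1)) = r - m by rewrite /e divfK// gt_eqF.
exists e => // t /andP[t1 t2].
have -> : y + t *: (y' - y) - y0 = (1 - t) *: (y - y0) + t *: (y' - y0).
  have -> : y' - y = (y' - y0) - (y - y0) by rewrite opprB addrA subrK.
  by rewrite scalerBl scale1r addrAC scalerBr addrA addrAC.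
have b1 : N ((1 - t) *: (y - y0)) <= `|1 - t| * m.
  by rewrite gnormZ// ler_wpM2l// le_max lexx.
have b2 : N (t *: (y' - y0)) <= `|t| * m.
  by rewrite gnormZ// ler_wpM2l// le_max lexx orbT.
have tt : `|1 - t| + `|t| <= 1 + 2 * e.
  by case: (ger0P t) => ?; case: (ger0P (1 - t)) => ?; lra.
rewrite (le_lt_trans (ler_gnormD HG _ _))// (le_lt_trans (lerD b1 b2))// -mulrDl.
rewrite (le_lt_trans (ler_wpM2r m0 tt))//.
have : 0 <= e * m by rewrite mulr_ge0// ltW.
lra.
Qed.

(** Upper bound for distances in a chart: the image of a segment is a curve, of
speed at most K times that of the segment. *)
Lemma segment_reach y y' : B y -> B y' ->
  (forall z v, B z -> chart_norm i z v <= K * N v) ->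
  exists2 l, reach X (cinv i y) (cinv i y') l & l <= K * N (y' - y).
Proof.
move=> yB y'B BK; have [e e0 eB] := near_line_in_ball yB y'B.
pose c t := cinv i (y + t *: (y' - y)).
have cC : C1_curve_on X [set` `]0 - e, 1 + e[ ] c.
  by apply: line_C1_curve => t; rewrite /= in_itv/= sub0r => /eB/Bi.
have [l cl] := piece_exists ler01 e0 cC.
have h := reach_piece cl.
have c0 : c 0 = cinv i y by rewrite /c scale0r addr0.
have c1 : c 1 = cinv i y' by rewrite /c scale1r addrC subrK.
exists (l 1 - l 0); first by rewrite -c0 -c1.
have [_ _ ld] := cl.
suff : (fun t => K * N (y' - y) * t - l t) 0 <= (fun t => K * N (y' - y) * t - l t) 1 by rewrite /= mulr0 mulr1; lra.
apply: (@is_derive_ge0_le R (fun t => K * N (y' - y) * t - l t)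
  (fun t => K * N (y' - y) * 1 - speed X c t) _ _ ler01) => t t01.
  have h1 := ld t t01; have h2 := is_derive_scale (K * N (y' - y)) (is_derive_id t 1).
  exact: (is_deriveB h2 h1).
have tB : - e < t < 1 + e by move: t01 => /andP[? ?]; apply/andP; split; lra.
have ti := Bi (eB t tB); have [it Et] := cimgP ti.
have At : [set` `]0 - e, 1 + e[ ] t by rewrite /= in_itv/= sub0r.
rewrite (speed_in_chart cC At it) mulr1 Et.
have -> : (cmap i \o c : R -> H)^`()%classic t = y' - y.
  have ce : \forall s \near t, (fun s : R => y + s *: (y' - y)) s = (cmap i \o c) s.
    have : \forall s \near t, - e < s < 1 + e.
      have := @near_in_itvoo R (- e) (1 + e) t; rewrite in_itv/= tB => /(_ isT).
      by apply: filterS => s; rewrite in_itv.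
    by apply: filterS => s /eB/Bi/cimgP[_ /= ->].
  rewrite derive1E -(near_eq_derive _ ce).
  by have [_ ->] := is_derive_line y (y' - y) t.
by rewrite subr_ge0; apply: BK; exact: eB.
Qed.

Hypothesis K0 : 0 < K.
Hypothesis BK : forall z v, B z -> N v <= K * chart_norm i z v.

(** A short curve starting well inside a chart ball cannot leave it, hence its length
controls the displacement of its coordinates.  The delicate point is that the
curve might leave the domain of the chart while its coordinates remain in the
ball: at a first such time the coordinates form a Cauchy family, since they are
Lipschitz in the length, so they converge to some h in the ball by completeness
of H; as M is Hausdorff, the curve is then at the point of coordinates h, still
in the chart. *)
Lemma piece_stays c l a b : piece X c l a b -> cdom i (c a) ->
  N (cmap i (c a) - y0) + K * (l b - l a) < r ->
  forall t, a <= t <= b ->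
    cdom i (c t) /\ N (cmap i (c t) - cmap i (c a)) <= K * (l t - l a).
Proof.
move=> cl ia aB; have [ab [e e0 cC] ld] := cl.
have tA t : a <= t <= b -> [set` `]a - e, b + e[ ] t.
  move=> /andP[h1 h2]; rewrite /= in_itv/= (lt_le_trans _ h1) ?gtrBl//=.
  by rewrite (le_lt_trans h2)// ltrDl.
have lle s t : a <= s -> s <= t -> t <= b -> l s <= l t.
  by move=> h1 h2 h3; apply: piece_le (piece_sub cl h1 h2 h3).
have inB t : a <= t <= b -> N (cmap i (c t) - cmap i (c a)) <= K * (l t - l a) ->
    B (cmap i (c t)).
  move=> /andP[h1 h2] h; rewrite /B/= (le_lt_trans (ler_gdistD HG (cmap i (c a)) _ _))//.
  rewrite addrC (le_lt_trans _ aB)// lerD2l (le_trans h)// ler_pM2l// lerD2r.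
  exact: lle.
(* The mean value inequality on a time interval spent inside the ball. *)
have mv s t : a <= s -> s <= t -> t <= b ->
    (forall u, s <= u <= t -> cdom i (c u) /\ B (cmap i (c u))) ->
    N (cmap i (c t) - cmap i (c s)) <= K * (l t - l s).
  move=> as_ st tb Hu.
  have uab u : s <= u <= t -> a <= u <= b.
    by move=> /andP[h1 h2]; rewrite (le_trans as_ h1) (le_trans h2 tb).
  apply: (@gnorm_mean_value R H G (cmap i \o c) ((cmap i \o c : R -> H)^`()%classic)
    l (speed X c) s t K HG st) => u ust.
  - rewrite derive1E; apply/derivableP.
    exact: C1_curve_derivable cC (tA _ (uab _ ust)) (Hu _ ust).1.
  - exact: ld (uab _ ust).
  - rewrite (speed_in_chart cC (tA _ (uab _ ust)) (Hu _ ust).1).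
    exact: BK (Hu _ ust).2.
apply: real_induction.
- by split=> //; rewrite subrr gnorm0 subrr mulr0.
- move=> t /andP[at_ tb] [it tN].
  have tab : a <= t <= b by rewrite at_ ltW.
  have ct := (cC t (tA t tab)).1.
  have nB : nbhs (cmap i (c t)) B.
    by apply: open_nbhs_nbhs; split; [exact: gnorm_open_ball|exact: inB].
  have h : \forall s \near t, cdom i (c s) /\ B (cmap i (c s)) := ct _ (near_chart it nB).
  have /nbhs_ballP[d /= d0 Hd] := h.
  have hb : \forall s \near t, s < b by exact: (cvgr_lt _ cvg_id).
  have hd : \forall s \near t, s < t + d by apply: (cvgr_lt _ cvg_id); rewrite ltrDl.
  apply: filterS3 h hb hd => s [is_ sB] sb sd ts; split=> //.
  have h2 : N (cmap i (c s) - cmap i (c t)) <= K * (l s - l t).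
    apply: mv => //; [exact: ltW|exact: ltW|move=> u /andP[tu us]].
    apply: Hd; rewrite /ball/= ler0_norm ?subr_le0// opprB ltrBlDr.
    by rewrite (le_lt_trans us)// addrC.
  rewrite (le_trans (ler_gdistD HG (cmap i (c t)) _ _))// (le_trans (lerD h2 tN))//.
  by rewrite -mulrDr addrA subrK.
- move=> t /andP[at_ tb] Hs.
  have tab : a <= t <= b by rewrite (ltW at_).
  have lt0 := piece_primitive_continuous cl tab.
  have sgood s : a <= s < t -> cdom i (c s) /\ B (cmap i (c s)).
    move=> /andP[h1 h2]; have [|h3 h4] := Hs s; first by rewrite h1.
    by split=> //; apply: inB h4; rewrite h1 (le_trans (ltW h2)).
  have [k [K' [k0 _ HK]]] := gnorm_equiv HG.
  have near_at : \forall s \near t^'-, a <= s < t.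
    near=> s; apply/andP; split; last by near: s; exact: nbhs_left_lt.
    by apply: ltW; near: s; exact: nbhs_left_gt.
  have ll : l s @[s --> t^'-] --> l t by exact: cvg_at_left_filter.
  (* Increments of the coordinates are controlled by those of l, continuous at t. *)
  have xcauchy : cauchy ((cmap i \o c) @ t^'-).
    apply: cauchy_exP => e1 e10.
    have d0 : 0 < k * e1 / (2 * K) by rewrite !divr_gt0 ?mulr_gt0.
    have near_l : \forall s \near t^'-, l t - l s <= k * e1 / (2 * K).
      move/cvgrPdist_le : ll => /(_ _ d0).
      by apply: filterS => s; apply: le_trans; exact: ler_norm.
    have [s [/andP[as_ st] ls]] := filter_ex (filterI near_at near_l).
    exists (cmap i (c s)).
    have near_s : \forall u \near t^'-, s < u by exact: nbhs_left_gt.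
    apply: filterS2 near_at near_s => u /andP[au ut] su.
    rewrite -ball_normE /= -(ltr_pM2l k0) distrC.
    have /andP[h1 _] := HK (cmap i (c u) - cmap i (c s)); rewrite (le_lt_trans h1)//.
    have h2 : N (cmap i (c u) - cmap i (c s)) <= K * (l u - l s).
      apply: mv => //; [exact: ltW|exact: le_trans (ltW ut) tb|].
      move=> w /andP[sw wu]; apply: sgood.
      by rewrite (le_trans as_ sw) (le_lt_trans wu ut).
    rewrite (le_lt_trans h2)//.
    have h3 : K * (l u - l s) <= K * (l t - l s).
      by rewrite ler_pM2l// lerD2r lle// ltW.
    rewrite (le_lt_trans h3)//.
    have h4 : K * (l t - l s) <= K * (k * e1 / (2 * K)) by rewrite ler_pM2l.
    rewrite (le_lt_trans h4)//.
    have -> : K * (k * e1 / (2 * K)) = k * e1 / 2 by field; rewrite gt_eqF.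
    by rewrite ltr_pdivrMr// ltr_pMr ?mulr_gt0// ltrDl.
  have /cvg_ex[h xh] : cvg ((cmap i \o c) @ t^'-) by exact: cauchy_cvg.
  have hN : N (h - cmap i (c a)) <= K * (l t - l a).
    have c1 : N ((cmap i \o c) s - cmap i (c a)) @[s --> t^'-] --> N (h - cmap i (c a)).
      by apply: gnorm_cvg => //; apply: cvgB => //; exact: cvg_cst.
    have c2 : K * (l s - l a) @[s --> t^'-] --> K * (l t - l a).
      by apply: cvgMr; apply: cvgB => //; exact: cvg_cst.
    apply: ler_cvg_to c1 c2 _.
    by apply: filterS near_at => s /Hs[].
  have hB : B h.
    rewrite /B/= (le_lt_trans (ler_gdistD HG (cmap i (c a)) _ _))//.
    rewrite addrC (le_lt_trans _ aB)// lerD2l (le_trans hN)// ler_pM2l// lerD2r.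
    exact: lle (ltW at_) tb (lexx b).
  have [ih Eh] := cimgP (Bi hB).
  have cE : c t = cinv i h.
    have c1 : c s @[s --> t^'-] --> c t.
      by apply: cvg_at_left_filter; exact: (cC t (tA t tab)).1.
    have c2 : c s @[s --> t^'-] --> cinv i h.
      have h1 := cvg_comp _ _ xh (cinv_continuous_at (Bi hB)).
      apply: cvg_trans h1; apply: near_eq_cvg.
      by apply: filterS near_at => s /sgood[is_ _] /=; rewrite cmapK.
    exact: (cvg_unique (manifold_hausdorff X) c1 c2).
  by rewrite cE Eh.
Unshelve. all: by end_near. Qed.

(** Along a concatenation the length consumed by the first part is taken from the
room left to the second. *)
Lemma reach_stays x y l : reach X x y l -> cdom i x ->
  N (cmap i x - y0) + K * l < r ->
  cdom i y /\ N (cmap i y - cmap i x) <= K * l.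
Proof.
move=> h; elim: h => {x y l} [c l a b cl|x z y l m h1 IH1 h2 IH2] ix xB.
  have [ab _ _] := cl.
  by apply: (piece_stays cl ix xB); rewrite ab lexx.
have m0 := reach_ge0 h2.
have Km : 0 <= K * m by rewrite mulr_ge0// ltW.
rewrite mulrDr in xB.
have [|iz zN] := IH1 ix; first by lra.
have zB := ler_gdistD HG (cmap i x) (cmap i z) y0.
have [|iy yN] := IH2 iz; first by lra.
split=> //; rewrite mulrDr.
have := ler_gdistD HG (cmap i z) (cmap i y) (cmap i x); lra.
Qed.

End Ball.
End LocalComparison.

(** * The Riemannian distance *)

Section Distance.
Variables (R : realType) (H : completeNormedModType R) (M : topologicalType).
Variable X : riemannian_manifold H M.
Implicit Types (p q x y z : M).
Local Notation d := (rdist X).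

(** A ball of coordinates of radius [r], in the preferred chart at [p], on which the
metric agrees with that of TM_p up to a factor 1 + e or 1 - e. *)
Definition uniform_chart p (e r : R) :=
  let i := chart_at X p in let N := gnorm (metric X p) in
  [/\ 0 < r,
      forall y : H, N (y - cmap i p) < r -> cimg i y &
      forall y v : H, N (y - cmap i p) < r ->
        (1 - e) * N v <= chart_norm i y v <= (1 + e) * N v].

Lemma uniform_chart_exists p (e : R) : 0 < e < 1 -> exists r, uniform_chart p e r.
Proof.
move=> e01; set i := chart_at X p.
have h := filterI (near_cimg (chart_atP X p)) (chart_norm_near X p e01).
have [r r0 Hr] := gnorm_nbhs (metric_inner_product X p) (h _).
by exists r; split=> // [y|y v] /Hr[h1 h2] //; exact: h2.
Qed.

Lemma uniform_chart_le p e r r' : uniform_chart p e r -> 0 < r' <= r ->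
  uniform_chart p e r'.
Proof.
move=> [r0 h1 h2] /andP[r'0 r'r]; split=> // y; [|move=> v] => yr.
  by apply: h1; exact: lt_le_trans yr r'r.
by apply: h2; exact: lt_le_trans yr r'r.
Qed.

Lemma uniform_chart_segment p e r (y y' : H) : uniform_chart p e r ->
  let i := chart_at X p in let N := gnorm (metric X p) in
  N (y - cmap i p) < r -> N (y' - cmap i p) < r ->
  exists2 l, reach X (cinv i y) (cinv i y') l & l <= (1 + e) * N (y' - y).
Proof.
move=> [r0 h1 h2] i N yr y'r.
apply: (segment_reach (metric_inner_product X p) h1 yr y'r).
by move=> z v zr; have /andP[] := h2 z v zr.
Qed.

Lemma uniform_chart_reach p e r x y l : uniform_chart p e r -> e < 1 ->
  let i := chart_at X p in let N := gnorm (metric X p) in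
  reach X x y l -> cdom i x -> N (cmap i x - cmap i p) + (1 - e)^-1 * l < r ->
  cdom i y /\ N (cmap i y - cmap i x) <= (1 - e)^-1 * l.
Proof.
move=> [r0 h1 h2] e1 i N xy ix xr.
have e0 : 0 < 1 - e by rewrite subr_gt0.
apply: (reach_stays (metric_inner_product X p) h1 _ _ xy ix xr).
  by rewrite invr_gt0.
by move=> z v zr; have /andP[h _] := h2 z v zr; rewrite ler_pdivlMl.
Qed.

Let half01 : 0 < (2^-1 : R) < 1.
Proof. by apply/andP; split; lra. Qed.

Lemma reach_near p : \forall q \near p, exists l, reach X p q l.
Proof.
have [r ur] := uniform_chart_exists p half01; have [r0 _ _] := ur.
have ip := chart_atP X p; set i := chart_at X p in ip.
have h := near_chart ip (gnorm_near_lt (metric_inner_product X p) (cmap i p) r0).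
apply: filterS h => q [iq qr].
have [|l h _] := uniform_chart_segment (y := cmap i p) ur _ qr.
  by rewrite subrr gnorm0.
by exists l; move: h; rewrite !cmapK.
Qed.

(** The points reached from x form an open and closed set.  Without this the
distance, an infimum of reals, would take the value 0 on pairs of points not
joined by curves. *)
Lemma reach_connected x y : exists l, reach X x y l.
Proof.
pose A := [set y | exists l, reach X x y l].
suff AT : A = [set: M] by have : A y by rewrite AT.
have AC := manifold_connected X.
apply: AC.
- by exists x, 0; exact: reach_refl.
- exists A; last by rewrite setTI.
  rewrite openE => z [l xz]; apply: filterS (reach_near z) => q [m zq].
  by exists (l + m); exact: reach_trans xz zq.
- exists A; last by rewrite setTI.
  move=> z /(_ _ (reach_near z))[q [[l xq] [m zq]]].
  by exists (l + m); exact: reach_trans xq (reach_sym zq).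
Qed.

Let has_inf_reach x y : has_inf [set l | reach X x y l].
Proof.
split; first by have [l h] := reach_connected x y; exists l.
by exists 0 => l /reach_ge0.
Qed.

Lemma rdist_le_reach x y l : reach X x y l -> d x y <= l.
Proof. by move=> h; rewrite rdist_reach; apply: ge_inf => //; case: (has_inf_reach x y). Qed.

Lemma reach_lt_rdist x y a : d x y < a -> exists2 l, reach X x y l & l < a.
Proof. by rewrite rdist_reach => /inf_lt-/(_ (has_inf_reach x y).1)[l]; exists l. Qed.

Lemma rdist_ge0 x y : 0 <= d x y.
Proof.
rewrite rdist_reach; apply: lb_le_inf; first by case: (has_inf_reach x y).
by move=> l /reach_ge0.
Qed.

Lemma rdistxx x : d x x = 0.
Proof.
by apply/le_anti; rewrite rdist_ge0 andbT; apply: rdist_le_reach; exact: reach_refl.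
Qed.

Lemma rdistC x y : d x y = d y x.
Proof.
by rewrite !rdist_reach; congr inf; apply/seteqP; split=> l /reach_sym.
Qed.

Lemma rdist_triangle y x z : d x z <= d x y + d y z.
Proof.
apply/ler_addgt0Pr => e e0; have e2 : 0 < e / 2 by rewrite divr_gt0.
have [|l xy le] := @reach_lt_rdist x y (d x y + e / 2); first by rewrite ltrDl.
have [|m yz me] := @reach_lt_rdist y z (d y z + e / 2); first by rewrite ltrDl.
have := rdist_le_reach (reach_trans xy yz); lra.
Qed.

(** The manifold is a length space: near-shortest curves can be cut at any
length. *)
Lemma rdist_between x y s e : 0 <= s <= d x y -> 0 < e ->
  exists z, d x z <= s /\ d z y <= d x y - s + e.
Proof.
move=> /andP[s0 sd] e0.
have [|l xy le] := @reach_lt_rdist x y (d x y + e); first by rewrite ltrDl.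
have [|z [xz zy]] := reach_split xy (s := s).
  by rewrite s0 (le_trans sd)// rdist_le_reach.
exists z; split; first exact: rdist_le_reach.
by rewrite (le_trans (rdist_le_reach zy))//; lra.
Qed.

Lemma rdist_le_gnorm p e r (y y' : H) : uniform_chart p e r ->
  let i := chart_at X p in let N := gnorm (metric X p) in
  N (y - cmap i p) < r -> N (y' - cmap i p) < r ->
  d (cinv i y) (cinv i y') <= (1 + e) * N (y' - y).
Proof.
move=> ur i N yr y'r; have [l h1 h2] := uniform_chart_segment ur yr y'r.
exact: le_trans (rdist_le_reach h1) h2.
Qed.

(** The near-shortest curves from x to y are short, so they stay in the chart ball
and their length dominates the displacement.  The point y is found to be in the
chart rather than assumed to be there. *)
Lemma gnorm_le_rdist p e r x y : uniform_chart p e r -> e < 1 ->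
  let i := chart_at X p in let N := gnorm (metric X p) in
  cdom i x -> N (cmap i x - cmap i p) + (1 - e)^-1 * d x y < r ->
  cdom i y /\ (1 - e) * N (cmap i y - cmap i x) <= d x y.
Proof.
move=> ur e1 i N ix xr; have e0 : 0 < 1 - e by rewrite subr_gt0.
(* Lengths below g are those that keep a curve from x inside the chart ball. *)
pose g := (r - N (cmap i x - cmap i p)) * (1 - e).
have dg : d x y < g by move: xr; rewrite -ltrBrDl ltr_pdivrMl// mulrC.
have key a : d x y < a -> a <= g -> cdom i y /\ (1 - e) * N (cmap i y - cmap i x) <= a.
  move=> da ag; have [l xy la] := reach_lt_rdist da.
  have [|iy yN] := uniform_chart_reach ur e1 xy ix.
    by rewrite -ltrBrDl ltr_pdivrMl// mulrC (lt_le_trans la).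
  by split=> //; move: yN; rewrite ler_pdivlMl// => yN; rewrite (le_trans yN)// ltW.
split; first by have [] := key g dg (lexx g).
apply/ler_addgt0Pr => a a0.
pose b := Num.min g (d x y + a).
have [||_ h] := key b; rewrite ?lt_min ?dg ?ltrDl ?a0 ?ge_min ?lexx//.
by rewrite (le_trans h)// /b ge_min lexx orbT.
Qed.

(** The distance defines the topology of M: both are compared to the Hilbert norm
in a uniform chart. *)
Lemma nbhs_rdist p (P : set M) :
  nbhs p P <-> exists2 r, 0 < r & forall q, d p q < r -> P q.
Proof.
have [r ur] := uniform_chart_exists p half01; have [r0 _ _] := ur.
have HG := metric_inner_product X p.
have ip := chart_atP X p; set i := chart_at X p in ip.
have h12 : 2^-1 < (1 : R) by lra.
have h1 : 1 - 2^-1 = 2^-1 :> R by lra.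
split=> [pP|[a a0 aP]].
  have [b b0 bP] := gnorm_nbhs HG (near_cinv ip pP).
  (* Norms are at most twice distances, as e = 1/2. *)
  exists (Num.min r b / 2) => [|q]; first by rewrite divr_gt0// lt_min r0.
  rewrite ltr_pdivlMr// => qrb.
  have qr : d p q * 2 < r by rewrite (lt_le_trans qrb)// ge_min lexx.
  have qb : d p q * 2 < b by rewrite (lt_le_trans qrb)// ge_min lexx orbT.
  have [|iq qN] := gnorm_le_rdist (y := q) ur h12 ip.
    by rewrite subrr gnorm0 add0r h1 invrK mulrC.
  rewrite -(cmapK iq); apply: bP; move: qN; rewrite h1 ler_pdivrMl//.
  by rewrite mulrC => qN; exact: le_lt_trans qN qb.
have ra : 0 < Num.min r (a / 2) by rewrite lt_min r0 divr_gt0.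
have h := near_chart ip (gnorm_near_lt HG (cmap i p) ra).
apply: filterS h => q [iq]; rewrite lt_min => /andP[qr qa]; apply: aP.
have := rdist_le_gnorm (y := cmap i p) ur _ qr; rewrite !cmapK// => h.
rewrite (le_lt_trans (h _))// ?subrr ?gnorm0//.
by have := gnorm_ge0 (metric X p) (cmap i q - cmap i p); lra.
Qed.

Lemma near_rdist p e : 0 < e -> \forall q \near p, d p q < e.
Proof. by move=> e0; apply/nbhs_rdist; exists e. Qed.

Lemma rdist_eq0 p q : d p q = 0 -> p = q.
Proof.
move=> pq; apply: (manifold_hausdorff X) => A B pA qB.
exists q; split; last exact: nbhs_singleton.
by move/nbhs_rdist : pA => [r r0]; apply; rewrite pq.
Qed.

Lemma closure_rdist (A : set M) x :
  closure A x <-> forall e, 0 < e -> exists2 y, A y & d x y < e.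
Proof.
split=> [clx e e0|h B /nbhs_rdist[r r0 rB]].
  by have [y [Ay xy]] := clx _ (near_rdist x e0); exists y.
by have [y Ay /rB xy] := h r r0; exists y.
Qed.

End Distance.

(** * Cutoffs, test functions and the dual norm *)

Section PositivePartSquare.
Variable R : realType.

(** A function of class C^1 that vanishes on the negative half-line: enough for
cutoffs of class C^1. *)
Definition pos2 (t : R) : R := Num.max 0 t ^+ 2.

Lemma pos2_is_derive (t : R) : is_derive t 1 pos2 (2 * Num.max 0 t).
Proof.
have key (h : R) : `|pos2 (t + h) - pos2 t - 2 * Num.max 0 t * h| <= h ^+ 2.
  have ineq (x : R) : - (h ^+ 2) <= x <= h ^+ 2 -> `|x| <= h ^+ 2 by rewrite ler_norml.
  apply: ineq; rewrite /pos2.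
  have h2 := sqr_ge0 h; have ht := sqr_ge0 (t + h); have t2 := sqr_ge0 t.
  by case: (leP 0 t) => t0; case: (leP 0 (t + h)) => th0; apply/andP; split; nra.
have [|||d dE] := @diff_eps R R R pos2 (fun h => 2 * Num.max 0 t * h) t.
- by move=> k u v; rewrite /GRing.scale/=; ring.
- by exists `|2 * Num.max 0 t| => v; rewrite normrM.
- move=> e e0; near=> h.
  rewrite (le_trans (key h))// -[h ^+ 2]ger0_norm ?sqr_ge0// expr2 normrM ler_wpM2r//.
apply: DeriveDef; first exact/derivable1_diffP.
by rewrite deriveE// dE mulr1.
Unshelve. all: by end_near. Qed.

Lemma C1at_pos2 (V : normedModType R) (f : V -> R^o) x : C1at f x ->
  C1at (pos2 \o f : V -> R^o) x.
Proof.
move=> fx; apply: (C1at_real_comp (dg := fun t => 2 * Num.max 0 t) fx).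
  by near=> t; exact: pos2_is_derive.
apply: cvgMr; apply: continuous_max; [exact: cvg_cst|exact: cvg_id].
Unshelve. all: by end_near. Qed.

(** The outer [pos2] flattens 1 - pos2 (2 - t) at 0, as the inner one flattens the
function beyond t = 2: a C^1 cutoff. *)
Definition step (t : R) : R := 1 - pos2 (1 - pos2 (2 - t)).

Lemma step1 t : t <= 1 -> step t = 1.
Proof.
move=> t1; have h : 1 <= pos2 (2 - t).
  by rewrite /pos2 (max_idPr _) ?exprn_ege1//; lra.
by rewrite /step {1}/pos2 (max_idPl _) ?expr0n/= ?subr0//; lra.
Qed.

Lemma step0 t : 2 <= t -> step t = 0.
Proof.
move=> t2; have h : pos2 (2 - t) = 0 by rewrite /pos2 (max_idPl _) ?expr0n//; lra.
by rewrite /step h subr0 /pos2 (max_idPr _) ?expr1n ?subrr.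
Qed.

Lemma C1at_onem (V : normedModType R) (f : V -> R^o) (k : R) x : C1at f x ->
  C1at (fun y => k - f y : R^o) x.
Proof.
move=> fx; have h := C1diff_scale (-1) (conj fx (fun v => erefl ('d f x v))).
apply: C1at_near_eq (C1at_add (C1at_cst (k : R^o) x) h.1).
by near=> y; rewrite mulN1r.
Unshelve. all: by end_near. Qed.

Lemma C1at_step (V : normedModType R) (f : V -> R^o) x : C1at f x ->
  C1at (step \o f : V -> R^o) x.
Proof.
by move=> fx; do 2 (apply: C1at_onem; apply: C1at_pos2); exact: C1at_onem.
Qed.

End PositivePartSquare.

Section TestFunctions.
Variables (R : realType) (H : completeNormedModType R) (M : topologicalType).
Variable X : riemannian_manifold H M.
Implicit Types (p q : M) (i j : chart X).
Local Notation d := (rdist X).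

(** Sub- and superdifferentials are defined with C^1 functions on the whole of M,
so a function given near a point of a chart must be cut off and extended by 0.
The extension is C^1 across the complement of the chart domain because the
support of the cutoff stays at a positive distance from that complement: since d
defines the topology, the support is inside a d-ball of half the radius of one
contained in the domain. *)
Lemma test_function i p (f : H -> R^o) : cdom i p ->
  (\forall y \near cmap i p, C1at f y) ->
  exists2 phi : M -> R, C1_function X phi &
    \forall y \near cmap i p, phi (cinv i y) = f y.
Proof.
move=> ip fC; have HG := metric_inner_product X p.
set G := metric X p in HG; set y0 := cmap i p in fC *.
have [s s0 Hs] := (nbhs_rdist X p (cdom i)).1 (near_cdom ip).
have s2 : 0 < s / 2 by rewrite divr_gt0.
have h1 : \forall y \near y0, d p (cinv i y) < s / 2 := near_cinv ip (near_rdist X p s2).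
have [r r0 Hr] := gnorm_nbhs HG (filterI (filterI h1 (near_cimg ip)) fC).
(* The cutoff is 1 on the ball of radius r / sqrt 8 and 0 outside that of radius r / 2. *)
pose chi : H -> R^o := step (R := R) \o (fun y => (8 / r ^+ 2) * G (y - y0) (y - y0) : R^o).
have r2 : 0 < r ^+ 2 by rewrite exprn_gt0.
have chiC y : C1at chi y.
  by apply: C1at_step; exact: (C1diff_scale _ (C1diff_quadratic HG y0 y)).1.
have chi0 y : r / 2 <= gnorm G (y - y0) -> chi y = 0.
  move=> ry; apply: step0; rewrite -sqr_gnorm// mulrAC ler_pdivlMr//.
  have h : (r / 2) ^+ 2 <= gnorm G (y - y0) ^+ 2.
    by rewrite ler_pXn2r// nnegrE ?gnorm_ge0// divr_ge0 ?(ltW r0).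
  by move: h; rewrite expr_div_n (_ : 2 ^+ 2 = 4 :> R) ?ler_pdivrMr//; [lra|rewrite -natrX].
have chi1 : \forall y \near y0, chi y = 1.
  have r3 : 0 < r / 4 by rewrite divr_gt0.
  apply: filterS (gnorm_near_lt HG y0 r3) => y yr; apply: step1.
  rewrite -sqr_gnorm// mulrAC ler_pdivrMr// mul1r.
  have h : gnorm G (y - y0) ^+ 2 <= (r / 4) ^+ 2.
    by rewrite ler_pXn2r// ?nnegrE ?gnorm_ge0 ?divr_ge0 ?(ltW r0) ?(ltW yr).
  by rewrite (le_trans (ler_wpM2l _ h))// expr_div_n (_ : 4 ^+ 2 = 16 :> R); [lra|rewrite -natrX].
pose g : H -> R^o := fun y => chi y * f y.
have gC y : C1at g y.
  have [yr|ry] := ltP (gnorm G (y - y0)) r.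
    by apply: C1at_mul => //; have [_] := Hr y yr.
  have : \forall z \near y, cst (0 : R^o) z = g z.
    have r3 : 0 < r / 2 by rewrite divr_gt0.
    apply: filterS (gnorm_near_lt HG y r3) => z zy; rewrite /g chi0 ?mul0r//.
    have := ler_gdistD HG z y y0; rewrite (gdistC _ y z); lra.
  by move/C1at_near_eq; apply; exact: C1at_cst.
pose phi q : R := if `[< cdom i q >] then g (cmap i q) else 0.
have phiE q : cdom i q -> phi q = g (cmap i q).
  by move=> iq; rewrite /phi; case: asboolP.
have phi0 q : ~ cdom i q -> \forall q' \near q, phi q' = 0.
  move=> niq; have sq : s <= d p q by rewrite leNgt; apply/negP => /Hs.
  apply: filterS (near_rdist X q s2) => q' qq'.
  have [iq'|niq'] := pselect (cdom i q'); last by rewrite /phi; case: asboolP.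
  rewrite phiE// /g chi0 ?mul0r// leNgt; apply/negP => h.
  have [|[]] := Hr (cmap i q'); first by apply: lt_trans h _; rewrite ltr_pdivrMr// ltr_pMr// ltrDl.
  rewrite cmapK// => h2 _ _.
  have := rdist_triangle X q' p q; rewrite (rdistC X q' q); lra.
exists phi.
  move=> j; apply: C1at_on => y /cimgP[jq yE].
  have [iq|niq] := pselect (cdom i (cinv j y)).
    have T : C1at (cmap i \o cinv j) y by rewrite -yE; exact: transition_C1at.
    have C : C1at (g \o (cmap i \o cinv j)) y by exact: C1at_comp T (gC _).
    apply: C1at_near_eq C; have := near_cinv jq (near_cdom iq); rewrite yE.
    by apply: filterS => z iz; rewrite /= phiE.
  have := near_cinv jq (phi0 _ niq); rewrite yE => h.
  apply: (@C1at_near_eq _ _ _ (cst (0 : R^o))); last exact: C1at_cst.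
  by apply: filterS h => z /= ->.
apply: filterS2 chi1 (near_cimg ip) => y y1 /cimgP[iy yE].
by rewrite phiE// yE /g y1 mul1r.
Qed.

Lemma superdifferential_of_chart i p (u : M -> R) (f : H -> R^o) : cdom i p ->
  (\forall y \near cmap i p, C1at f y) ->
  (\forall y \near cmap i p, u (cinv i y) - f y <= u p - f (cmap i p)) ->
  exists2 zeta, superdifferential X u p zeta &
    forall v, zeta (to_tangent i (cmap i p) v) = 'd f (cmap i p) v.
Proof.
move=> ip fC umax; have [phi phiC phiE] := test_function ip fC.
have df := C1at_differentiable (nbhs_singleton fC).
exists (dfun X phi p); last first.
  move=> v; rewrite (dfun_to_tangent _ phiC ip).
  by apply: (diff_near_eq _ df).2; apply: filterS phiE => y /= ->.
exists phi => //; split=> //.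
have pE : phi p = f (cmap i p) by rewrite -(nbhs_singleton phiE) cmapK.
by apply: filterS (near_chart ip (filterI umax phiE)) => q [iq []]; rewrite cmapK// pE => + ->.
Qed.

Lemma subdifferential_of_chart i p (u : M -> R) (f : H -> R^o) : cdom i p ->
  (\forall y \near cmap i p, C1at f y) ->
  (\forall y \near cmap i p, u p - f (cmap i p) <= u (cinv i y) - f y) ->
  exists2 zeta, subdifferential X u p zeta &
    forall v, zeta (to_tangent i (cmap i p) v) = 'd f (cmap i p) v.
Proof.
move=> ip fC umin; have [phi phiC phiE] := test_function ip fC.
have df := C1at_differentiable (nbhs_singleton fC).
exists (dfun X phi p); last first.
  move=> v; rewrite (dfun_to_tangent _ phiC ip).
  by apply: (diff_near_eq _ df).2; apply: filterS phiE => y /= ->.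
exists phi => //; split=> //.
have pE : phi p = f (cmap i p) by rewrite -(nbhs_singleton phiE) cmapK.
by apply: filterS (near_chart ip (filterI umin phiE)) => q [iq []]; rewrite cmapK// pE => + ->.
Qed.

Lemma dual_norm_le p (phi : M -> R) k : 0 <= k ->
  (forall v, `|dfun X phi p v| <= k * tnorm X p v) -> dual_norm X p (dfun X phi p) <= k.
Proof.
move=> k0 Hk; apply: ge_sup.
  by exists `|dfun X phi p 0|, 0 => //=; rewrite tnorm_gnorm gnorm0.
by move=> _ [v /= v1 <-]; rewrite (le_trans (Hk v))// ler_piMr.
Qed.

(** The supremum defining the dual norm is that of a bounded set, the differential
being continuous; hence it is a genuine norm estimate. *)
Lemma le_dual_norm p (phi : M -> R) v : C1_function X phi ->
  `|dfun X phi p v| <= dual_norm X p (dfun X phi p) * tnorm X p v.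
Proof.
move=> phiC; have HG := metric_inner_product X p.
have ip := chart_atP X p.
have df := C1at_differentiable (C1_function_at phiC ip).
have [C C0 HC] := diff_bounded df.
have [c [c' [c0 _ Hc]]] := gnorm_equiv HG.
have [v0|vpos] := eqVneq (tnorm X p v) 0.
  rewrite v0 (gnorm_eq0 HG v0) mulr0 (_ : dfun X phi p 0 = 0) ?normr0//.
  exact: linear0.
have v0 : 0 < tnorm X p v by rewrite lt_neqAle eq_sym vpos sqrtr_ge0.
rewrite -ler_pdivrMr//.
have E : `|dfun X phi p v| / tnorm X p v = `|dfun X phi p ((tnorm X p v)^-1 *: v)|.
  rewrite (_ : dfun X phi p (_ *: v) = (tnorm X p v)^-1 * dfun X phi p v); last exact: linearZ.
  by rewrite normrM ger0_norm ?invr_ge0 ?(ltW v0)// mulrC.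
rewrite E; apply: ub_le_sup.
  exists (C * c^-1) => _ [w /= w1 <-]; rewrite (le_trans (HC w))// ler_pM2l//.
  have /andP[h _] := Hc w; rewrite -[c^-1]mulr1 ler_pdivlMl//.
  exact: le_trans h w1.
exists ((tnorm X p v)^-1 *: v) => //=.
by rewrite tnorm_gnorm gnormZ// ger0_norm ?invr_ge0 ?(ltW v0)// mulVf.
Qed.

Lemma C1_function_expansion (phi : M -> R) p e : C1_function X phi -> 0 < e ->
  let i := chart_at X p in
  \forall y \near cmap i p,
    `|phi (cinv i y) - phi p - dfun X phi p (y - cmap i p)| <= e * tnorm X p (y - cmap i p).
Proof.
move=> phiC e0 i; have HG := metric_inner_product X p.
have ip := chart_atP X p; rewrite -/i in ip.
have df := C1at_differentiable (C1_function_at phiC ip).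
have [c [c' [c0 _ Hc]]] := gnorm_equiv HG.
have ec : 0 < e * c by rewrite mulr_gt0.
apply/near_translate; apply: filterS (diff_le_eps df ec) => h.
rewrite /= cmapK// (addrC (cmap i p)) addrK => Hh; rewrite /dfun -/i.
rewrite (le_trans Hh)// -mulrA ler_pM2l//.
by have /andP[] := Hc h.
Qed.

End TestFunctions.

(** * Maximal descent, and slopes of viscosity solutions *)

Section Caristi.
Variables (R : realType) (H : completeNormedModType R) (M : topologicalType).
Variable X : riemannian_manifold H M.
Hypothesis completeM : rcomplete X.
Local Notation d := (rdist X).

(** An Ekeland-Caristi principle.  [P x z] means that [z] may be reached by descending
from [x]; each step decreases f by at least c times its length.  Choosing at
each stage a point that nearly minimizes f among the points that can be reached
gives a Cauchy sequence.  Its limit can be reached from all its terms, and from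
it no other point can be reached, because the sets of points that can be reached
from the n-th term have diameters tending to 0. *)
Lemma maximal_descent (A : set M) (f : M -> R) (P : M -> M -> Prop) (m c : R) :
  closed A -> 0 < c -> (forall x, A x -> m <= f x) ->
  (forall x, P x x) -> (forall x y z, P x y -> P y z -> P x z) ->
  (forall x z, A x -> A z -> P x z -> c * d x z <= f x - f z) ->
  (forall x z, A x -> A z ->
    (forall e, 0 < e -> exists w, [/\ A w, P x w & d z w < e]) -> P x z) ->
  forall x0, A x0 -> exists x, [/\ A x, P x0 x & forall z, A z -> P x z -> z = x].
Proof.
move=> cA c0 fm Pxx Ptr Pd Pcl x0 Ax0.
have /choice[next Hnext] : forall q : M * nat, exists y, A q.1 ->
    [/\ A y, P q.1 y & forall z, A z -> P q.1 z -> f y <= f z + c * 2^-1 ^+ q.2].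
  move=> [x n] /=; have [Ax|nAx] := pselect (A x); last by exists x.
  have e0 : 0 < c * 2^-1 ^+ n by rewrite mulr_gt0// exprn_gt0// invr_gt0.
  pose S := [set f z | z in [set z | A z /\ P x z]].
  have hi : has_inf S.
    by split; [exists (f x), x|exists m => _ [z [Az _] <-]; exact: fm].
  have [_ [y [Ay Pxy] <-] fy] := inf_adherent e0 hi.
  exists y => _; split=> // z Az Pxz; rewrite (le_trans (ltW fy))// lerD2r.
  by apply: ge_inf; [case: hi|exists z].
pose s := fix s n := if n is k.+1 then next (s k, k) else x0.
have As n : A (s n) by elim: n => [//|n IH]; have [] := Hnext (s n, n) IH.
have Ps n : P (s n) (s n.+1) by have [] := Hnext (s n, n) (As n).
have Ple n k : P (s n) (s (n + k)%N).
  elim: k => [|k IH]; first by rewrite addn0.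
  by rewrite addnS; exact: Ptr IH (Ps _).
have small n z : A z -> P (s n.+1) z -> d (s n.+1) z <= 2^-1 ^+ n.
  move=> Az Pz; have := Pd _ _ (As n.+1) Az Pz.
  have [_ _ /(_ z Az (Ptr _ _ _ (Ps n) Pz))] := Hnext (s n, n) (As n).
  rewrite -[next _]/(s n.+1) /= => h1 h2.
  by rewrite -(ler_pM2l c0) (le_trans h2)// lerBlDl.
have exp0 (e : R) : 0 < e -> exists n : nat, 2^-1 ^+ n < e.
  move=> e0; have h : (2^-1 : R) ^+ n @[n --> \oo] --> (0 : R).
    by apply: cvg_expr; rewrite ger0_norm ?invr_ge0// invf_lt1//; lra.
  move/cvgrPdist_lt : h => /(_ _ e0)[n _ /(_ n (leqnn n))].
  rewrite sub0r normrN ger0_norm; first by exists n.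
  by rewrite exprn_ge0// invr_ge0.
have [l hl] : exists l, forall e : R, 0 < e -> exists N, forall n, (N <= n)%N -> d (s n) l < e.
  apply: completeM => e e0; have [n hn] := exp0 (e / 2) (divr_gt0 e0 (ltr0Sn _ _)).
  have hs k : (n.+1 <= k)%N -> d (s n.+1) (s k) < e / 2.
    move=> nk; rewrite (le_lt_trans _ hn)// small// -(subnKC nk); exact: Ple.
  exists n.+1 => a b na nb.
  have := rdist_triangle X (s n.+1) (s a) (s b).
  rewrite (rdistC X (s a) (s n.+1)); have := hs a na; have := hs b nb; lra.
have Al : A l.
  apply: cA; apply/(closure_rdist X) => e e0; have [N HN] := hl e e0.
  by exists (s N) => //; rewrite rdistC HN.
have Pl n : P (s n) l.
  apply: Pcl => // e e0; have [N HN] := hl e e0.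
  exists (s (n + N)%N); split; [exact: As|exact: Ple|].
  by rewrite rdistC; apply: HN; exact: leq_addl.
exists l; split=> //; first exact: (Pl 0%N).
move=> z Az Plz; apply/esym/(rdist_eq0 (X := X)).
apply/le_anti; rewrite rdist_ge0 andbT leNgt; apply/negP => lz0.
have [n hn] := exp0 (d l z / 2) (divr_gt0 lz0 (ltr0Sn _ _)).
have h1 := small n l Al (Pl n.+1).
have h2 := small n z Az (Ptr _ _ _ (Pl n.+1) Plz).
have := rdist_triangle X (s n.+1) l z; rewrite (rdistC X l (s n.+1)); lra.
Qed.

End Caristi.

Section Eikonal.
Variables (R : realType) (H : completeNormedModType R) (M : topologicalType).
Variable X : riemannian_manifold H M.
Variable Omega : set M.
Hypothesis openOmega : open Omega.
Local Notation d := (rdist X).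

(** If u grew from y to y1 more than k times their distance,
[steep_supergradient], applied in a chart that is almost isometric, would
produce a superdifferential of dual norm greater than 1.  To have a
Lipschitz estimate centred at x in both directions the base point y is allowed
to vary near x. *)
Lemma locally_lipschitz (u : M -> R) :
  (forall x, Omega x -> {for x, continuous u}) ->
  (forall x zeta, Omega x -> superdifferential X u x zeta -> dual_norm X x zeta <= 1) ->
  forall x k, Omega x -> 1 < k ->
    exists2 rho, 0 < rho & forall z, d x z < rho -> `|u z - u x| <= k * d x z.
Proof.
move=> uc usub x k Ox k1; set i := chart_at X x.
have HG := metric_inner_product X x; set G := metric X x in HG.
have ix : cdom i x := chart_atP X x.
pose e := Num.min 2^-1 ((k - 1) / (k + 3)).
have e0 : 0 < e by rewrite lt_min invr_gt0 ltr0n/= divr_gt0//; lra.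
have e12 : e <= 2^-1 by rewrite ge_min lexx.
have e1 : e < 1 by lra.
have ek : e * (k + 3) <= k - 1.
  by rewrite -ler_pdivlMr; [rewrite ge_min lexx orbT|lra].
have e01 : 0 < e < 1 by rewrite e0.
have [r1 ur1] := uniform_chart_exists X x e01; have [r10 _ _] := ur1.
pose v y := u (cinv i y).
have nO : \forall y \near cmap i x, Omega (cinv i y) /\ `|v y - u x| <= 1.
  have h : \forall z \near x, `|u x - u z| <= 1.
    by have /cvgrPdist_le := uc x Ox; apply.
  apply: filterS (near_cinv ix (filterI (open_nbhs_nbhs (conj openOmega Ox)) h)) => y [Oy].
  by rewrite distrC.
have [r2 r20 Hr2] := gnorm_nbhs HG nO.
pose r := Num.min r1 r2.
have r0 : 0 < r by rewrite lt_min r10.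
have ur : uniform_chart X x e r.
  by apply: uniform_chart_le ur1 _; rewrite r0 ge_min lexx.
have [_ Hi Hn] := ur; rewrite -/i in Hi Hn.
have HO y : gnorm G (y - cmap i x) < r -> Omega (cinv i y) /\ `|v y - u x| <= 1.
  by move=> yr; apply: Hr2; rewrite (lt_le_trans yr)// ge_min lexx orbT.
have vc y : gnorm G (y - cmap i x) < r -> {for y, continuous v}.
  move=> yr; exact: (cvg_comp _ _ (cinv_continuous_at (Hi y yr)) (uc _ (HO y yr).1)).
(* On the sphere of radius r / 4 the square dominates the oscillation 2 of v. *)
pose B := 48 / r ^+ 2; have B0 : 0 < B by rewrite divr_gt0// exprn_gt0.
have Br : B * (r / 4) ^+ 2 = 3 by rewrite /B; field; rewrite gt_eqF.
have r4 : 0 < r / 4 by rewrite divr_gt0.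
have key y y1 : gnorm G (y - cmap i x) < r / 2 -> gnorm G (y1 - y) <= r / 4 ->
    v y1 - v y <= (1 + 2 * e) * gnorm G (y1 - y) + B * gnorm G (y1 - y) ^+ 2.
  move=> yr y1r; rewrite leNgt; apply/negP => steep.
  have inr y' : gnorm G (y' - y) <= r / 4 -> gnorm G (y' - cmap i x) < r.
    move=> h; have := ler_gdistD HG y y' (cmap i x); lra.
  have v2 y' : gnorm G (y' - y) <= r / 4 -> v y' <= v y + 2.
    have [|_] := HO y; first by lra.
    move=> h1 /inr/HO[_]; move: h1; rewrite !ler_norml => /andP[? ?] /andP[? ?]; lra.
  have b3 : 2 < B * (r / 4) ^+ 2 by rewrite Br; lra.
  have kK : 0 <= 1 + e < 1 + 2 * e by apply/andP; split; lra.
  have [z [f [L [zr [fC fL] fmax [w Lw]]]]] := steep_supergradient HG r4 kK b3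
    (fun y' h => vc y' (inr y' h)) v2 y1r steep.
  have zB := inr z (ltW zr); have [iz zE] := cimgP (Hi z zB).
  have fC' : \forall y \near cmap i (cinv i z), C1at f y by rewrite zE.
  have fmax' : \forall y \near cmap i (cinv i z), u (cinv i y) - f y
      <= u (cinv i z) - f (cmap i (cinv i z)).
    rewrite zE; have zr' : 0 < r / 4 - gnorm G (z - y) by rewrite subr_gt0.
    apply: filterS (gnorm_near_lt HG z zr') => y' y'z; apply: fmax.
    have := ler_gdistD HG z y' y; lra.
  have [zeta zsup zetaE] := superdifferential_of_chart iz fC' fmax'.
  have dual1 := usub _ _ (HO z zB).1 zsup.
  have [phi [phiC _] phiE] := zsup; rewrite -phiE zE in zetaE dual1.
  have h1 := le_dual_norm (cinv i z) (to_tangent i z w) phiC.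
  have h2 : L w <= chart_norm i z w.
    rewrite -fL -zetaE (le_trans (ler_norm _))// (le_trans h1)//.
    by rewrite ler_piMl// sqrtr_ge0.
  have /andP[_ h3] := Hn z w zB.
  by have := lt_le_trans Lw (le_trans h2 h3); rewrite ltxx.
(* So near x the square is absorbed in a slope e. *)
pose rho := Num.min (r / 8) (e / (2 * B)).
have rho0 : 0 < rho by rewrite lt_min !divr_gt0// mulr_gt0.
exists rho => // z; rewrite lt_min => /andP[zr zB].
have [|iz zN] := gnorm_le_rdist (y := z) ur e1 ix.
  rewrite subrr gnorm0 add0r ltr_pdivrMl ?subr_gt0//.
  have : r * 2^-1 <= (1 - e) * r by rewrite mulrC ler_pM2r//; lra.
  lra.
rewrite -/i -/G in iz zN; set n := gnorm G _ in zN.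
have n0 : 0 <= n := gnorm_ge0 _ _.
have d0 := rdist_ge0 X x z.
have n2 : n <= 2 * d x z.
  have : 2^-1 * n <= (1 - e) * n by rewrite ler_wpM2r//; lra.
  lra.
have Bn : B * n <= e.
  have : d x z * (2 * B) < e by rewrite -ltr_pdivlMr// mulr_gt0.
  have : B * n <= B * (2 * d x z) by rewrite ler_pM2l.
  lra.
have Bnn : B * n ^+ 2 <= e * n by rewrite expr2 mulrA ler_wpM2r.
have ub : (1 + 2 * e) * n + B * n ^+ 2 <= k * d x z.
  have h1 : (1 + 3 * e) * n <= (k * (1 - e)) * n by rewrite ler_wpM2r//; lra.
  have h2 : k * ((1 - e) * n) <= k * d x z by rewrite ler_pM2l//; lra.
  lra.
have nr : n < r / 4 by lra.
rewrite ler_norml; apply/andP; split.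
  rewrite -lerN2 opprK opprB; apply: le_trans ub.
  have := key (cmap i z) (cmap i x); rewrite /v !cmapK// (gdistC G (cmap i x)) -/n.
  by apply; [lra|exact: ltW].
apply: le_trans ub.
have := key (cmap i x) (cmap i z); rewrite /v !cmapK// -/n subrr gnorm0.
by apply; [lra|exact: ltW].
Qed.

(** If u decreased from x at a rate at most 1 - e in all directions,
[subgradient_of_slow_descent], applied in a chart that is almost isometric,
would produce a subdifferential of dual norm less than 1. *)
Lemma strict_descent (u : M -> R) :
  (forall x, Omega x -> {for x, continuous u}) ->
  (forall x zeta, Omega x -> subdifferential X u x zeta -> 1 <= dual_norm X x zeta) ->
  forall x e rho, Omega x -> 0 < e < 1 -> 0 < rho ->
    exists2 z, d x z < rho & (1 - e) * d x z < u x - u z.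
Proof.
move=> uc usup x e rho Ox /andP[e0 e1] rho0; set i := chart_at X x.
have HG := metric_inner_product X x; set G := metric X x in HG.
have ix : cdom i x := chart_atP X x.
(* Otherwise u decreases slowly from x in all directions. *)
apply: contrapT => nex.
have slow z : d x z < rho -> u x - u z <= (1 - e) * d x z.
  by move=> xz; rewrite leNgt; apply/negP => h; apply: nex; exists z.
pose e8 := e / 8.
have e80 : 0 < e8 < 1 by rewrite /e8; apply/andP; split; lra.
have e81 : e8 < 1 by case/andP: e80.
have [r1 ur1] := uniform_chart_exists X x e80; have [r10 _ _] := ur1.
pose v y := u (cinv i y).
have [r2 r20 Hr2] := gnorm_nbhs HG (near_cinv ix
  (filterI (open_nbhs_nbhs (conj openOmega Ox)) (near_rdist X x rho0))).
pose r := Num.min r1 r2.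
have r0 : 0 < r by rewrite lt_min r10.
have ur : uniform_chart X x e8 r.
  by apply: uniform_chart_le ur1 _; rewrite r0 ge_min lexx.
have [_ Hi Hn] := ur; rewrite -/i in Hi Hn.
have HO y : gnorm G (y - cmap i x) < r -> Omega (cinv i y) /\ d x (cinv i y) < rho.
  by move=> yr; apply: Hr2; rewrite (lt_le_trans yr)// ge_min lexx orbT.
have r2' : 0 < r / 2 by rewrite divr_gt0.
have inr y : gnorm G (y - cmap i x) <= r / 2 -> gnorm G (y - cmap i x) < r by lra.
have vc y : gnorm G (y - cmap i x) <= r / 2 -> {for y, continuous v}.
  move=> /inr yr; exact: (cvg_comp _ _ (cinv_continuous_at (Hi y yr)) (uc _ (HO y yr).1)).
have vslow y : gnorm G (y - cmap i x) <= r / 2 ->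
    v (cmap i x) - (1 - e / 2) * gnorm G (y - cmap i x) <= v y.
  move=> /inr yr; have /slow := (HO y yr).2; rewrite /v cmapK// => h1.
  have := rdist_le_gnorm (y := cmap i x) ur _ yr; rewrite -/i -/G cmapK// => h2.
  have {}h2 : d x (cinv i y) <= (1 + e8) * gnorm G (y - cmap i x).
    by apply: h2; rewrite subrr gnorm0.
  have N0 := gnorm_ge0 G (y - cmap i x); set n := gnorm G (y - cmap i x) in h2 N0 *.
  have h3 : (1 - e) * d x (cinv i y) <= (1 - e) * ((1 + e8) * n).
    by rewrite ler_wpM2l//; lra.
  have h4 : ((1 - e) * (1 + e8)) * n <= (1 - e / 2) * n.
    by rewrite ler_wpM2r// /e8; nra.
  lra.
have e2 : 0 < e / 2 < 1 by apply/andP; split; lra.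
have [z [f [L [zr [fC fL] fmin Lbnd]]]] := subgradient_of_slow_descent HG r2' e2 vc vslow.
have zB := inr z (ltW zr); have [iz zE] := cimgP (Hi z zB).
have fC' : \forall y \near cmap i (cinv i z), C1at f y by rewrite zE.
have fmin' : \forall y \near cmap i (cinv i z),
    u (cinv i z) - f (cmap i (cinv i z)) <= u (cinv i y) - f y.
  rewrite zE; have zr' : 0 < r / 2 - gnorm G (z - cmap i x) by rewrite subr_gt0.
  apply: filterS (gnorm_near_lt HG z zr') => y yz; apply: fmin.
  have := ler_gdistD HG z y (cmap i x); lra.
have [zeta zsub zetaE] := subdifferential_of_chart iz fC' fmin'.
have dual1 := usup _ _ (HO z zB).1 zsub.
have [phi [phiC _] phiE] := zsub; rewrite -phiE zE in zetaE dual1.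
(* Distortion of the chart: the bound 1 - e / 4 for L becomes k in the manifold. *)
pose k := (1 - e / 4) / (1 - e8).
have k0 : 0 <= k by rewrite divr_ge0// /e8; lra.
have k1 : k < 1 by rewrite ltr_pdivrMr /e8; lra.
suff : dual_norm X (cinv i z) (dfun X phi (cinv i z)) <= k.
  by move=> h; have := le_lt_trans (le_trans dual1 h) k1; rewrite ltxx.
apply: dual_norm_le => // w; have [w' <-] := to_tangent_surj w iz.
rewrite zE zetaE fL (le_trans (Lbnd w'))//.
have /andP[h1 _] := Hn z w' zB.
have -> : 1 - e / 2 / 2 = k * (1 - e8).
  by rewrite /k divfK; [field|rewrite gt_eqF// subr_gt0].
by rewrite -mulrA ler_wpM2l.
Qed.

End Eikonal.

(** * The distance to the boundary is a solution *)

Section DistanceToBoundary.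
Variables (R : realType) (H : completeNormedModType R) (M : topologicalType).
Variable X : riemannian_manifold H M.
Implicit Types (x y z : M) (A Omega : set M).
Local Notation d := (rdist X).

Lemma rdist_set_le A x y : A y -> rdist_set X x A <= d x y.
Proof.
move=> Ay; apply: ge_inf; last by exists y.
by exists 0 => _ [z _ <-]; exact: rdist_ge0.
Qed.

Lemma le_rdist_set A x a : A !=set0 -> (forall y, A y -> a <= d x y) ->
  a <= rdist_set X x A.
Proof.
move=> [y Ay] h; apply: lb_le_inf; first by exists (d x y), y.
by move=> _ [z Az <-]; exact: h.
Qed.

Lemma rdist_set_adherent A x e : A !=set0 -> 0 < e ->
  exists2 y, A y & d x y < rdist_set X x A + e.
Proof.
move=> [y Ay] e0; have [|_ [z Az <-] h] := @inf_adherent R [set d x y | y in A] e e0.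
  by split; [exists (d x y), y|exists 0 => _ [z _ <-]; exact: rdist_ge0].
by exists z.
Qed.

Lemma rdist_set_lip A x z : A !=set0 -> rdist_set X x A <= d x z + rdist_set X z A.
Proof.
move=> A0; rewrite -lerBlDl; apply: le_rdist_set => // y Ay.
by rewrite lerBlDl (le_trans (rdist_set_le x Ay))// rdist_triangle.
Qed.

Lemma rdist_set_continuous A : A !=set0 -> continuous (fun x => rdist_set X x A).
Proof.
move=> A0 x; apply/cvgrPdist_lt => e e0; apply: filterS (near_rdist X x e0) => z xz.
have h1 := rdist_set_lip x z A0; have h2 := rdist_set_lip z x A0.
by rewrite ltr_norml; apply/andP; rewrite (rdistC X z x) in h2; split; lra.
Qed.

Lemma boundary_open_disjoint Omega x : open Omega -> Omega x -> ~ boundary Omega x.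
Proof. by rewrite openE => oO Ox [_]; apply; exact: oO. Qed.

Lemma closure_open Omega x : open Omega -> closure Omega x -> Omega x \/ boundary Omega x.
Proof.
move=> oO clx; have [Ox|nOx] := pselect (Omega x); [by left|right].
by split=> // /interior_subset.
Qed.

Lemma closed_boundary Omega : open Omega -> closed (boundary Omega).
Proof.
move=> oO; rewrite /boundary setDE; apply: closedI; first exact: closed_closure.
by apply: open_closedC; exact: open_interior.
Qed.

Lemma rdist_set_gt0 A x : closed A -> A !=set0 -> ~ A x -> 0 < rdist_set X x A.
Proof.
move=> cA A0 nAx; have h0 : 0 <= rdist_set X x A.
  by apply: le_rdist_set => // y _; exact: rdist_ge0.
rewrite lt_neqAle h0 andbT; apply/eqP => h; apply: nAx; apply: cA.
apply/(closure_rdist X) => e e0; have [y Ay xy] := rdist_set_adherent x A0 e0.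
by exists y => //; rewrite -h add0r in xy.
Qed.

(** Take the first-order expansion at x, bound the linear term by the dual norm and
compare the norm of TM_x with d in an almost isometric chart. *)
Lemma C1_function_slope (phi : M -> R) x k : C1_function X phi -> 0 < k ->
  dual_norm X x (dfun X phi x) < k ->
  \forall z \near x, phi x - phi z <= k * d x z.
Proof.
move=> phiC k0; set D := dual_norm _ _ _ => Dk.
have HG := metric_inner_product X x; set i := chart_at X x.
have ix : cdom i x := chart_atP X x.
pose e := Num.min 2^-1 ((k - D) / (2 * (k + 1))).
have k1 : 0 < 2 * (k + 1) by rewrite mulr_gt0// addr_gt0.
have e0 : 0 < e by rewrite lt_min invr_gt0 ltr0n/= divr_gt0// subr_gt0.
have eE : e * (2 * (k + 1)) <= k - D by rewrite -ler_pdivlMr// ge_min lexx orbT.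
have e12 : e <= 2^-1 by rewrite ge_min lexx.
have e1 : e < 1 by lra.
have e01 : 0 < e < 1 by rewrite e0.
have [r ur] := uniform_chart_exists X x e01; have [r0 _ _] := ur.
have h1 := near_chart ix (C1_function_expansion x phiC e0).
have h2 : \forall z \near x, d x z < (1 - e) * r.
  by apply: near_rdist; rewrite mulr_gt0// subr_gt0.
apply: filterS2 h1 h2 => z [iz]; rewrite -/i cmapK// => hphi zr.
have [|_ zN] := gnorm_le_rdist (y := z) ur e1 ix.
  by rewrite subrr gnorm0 add0r ltr_pdivrMl ?subr_gt0.
rewrite -/i in zN; set w := cmap i z - cmap i x in hphi zN.
have dw := le_dual_norm x w phiC; rewrite -/D in dw.
move: hphi; rewrite ler_norml => /andP[hphi _].
move: dw; rewrite ler_norml => /andP[dw _].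
set n := tnorm X x w in hphi dw; rewrite -[gnorm _ w]/n in zN.
have n0 : 0 <= n by exact: sqrtr_ge0.
have h3 : phi x - phi z <= (D + e) * n by lra.
have h4 : (D + e) * n <= (k * (1 - e)) * n by rewrite ler_wpM2r//; nra.
have h5 : k * ((1 - e) * n) <= k * d x z by rewrite ler_pM2l.
lra.
Qed.

(** Conversely, the rate of decrease in a direction v is seen at the points of
coordinates x + t v, which are at distance at most (1 + e) t |v| from x. *)
Lemma dual_norm_slope (phi : M -> R) x k : C1_function X phi -> 0 <= k ->
  (\forall z \near x, phi x - phi z <= k * d x z) ->
  dual_norm X x (dfun X phi x) <= k.
Proof.
move=> phiC k0 slope; have HG := metric_inner_product X x; set i := chart_at X x.
have ix : cdom i x := chart_atP X x.
suff half v : - dfun X phi x v <= k * tnorm X x v.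
  apply: dual_norm_le => // v; rewrite ler_norml; apply/andP; split.
    by rewrite -lerN2 opprK half.
  have := half (- v); rewrite !tnorm_gnorm gnormN (_ : dfun X phi x (- v) = - dfun X phi x v) ?opprK//.
  exact: linearN.
have HN0 : 0 <= tnorm X x v by exact: sqrtr_ge0.
suff eps e : 0 < e < 1 -> - dfun X phi x v <= (k + (k + 1) * e) * tnorm X x v.
  apply/ler_addgt0Pr => a a0.
  have kn : 0 < (k + 1) * (tnorm X x v + 1) by rewrite mulr_gt0// ltr_wpDl.
  pose e := Num.min 2^-1 (a / ((k + 1) * (tnorm X x v + 1))).
  have e0 : 0 < e by rewrite lt_min invr_gt0 ltr0n/= divr_gt0.
  have e12 : e <= 2^-1 by rewrite ge_min lexx.
  have ea : e * ((k + 1) * (tnorm X x v + 1)) <= a by rewrite -ler_pdivlMr// ge_min lexx orbT.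
  have := eps e; rewrite e0 /= => /(_ _) h; apply: le_trans (h _) _; first by lra.
  have : 0 <= e * (k + 1) by rewrite mulr_ge0 ?addr_ge0// ltW.
  lra.
move=> e01; have /andP[e0 e1] := e01.
have [r ur] := uniform_chart_exists X x e01; have [r0 _ _] := ur.
have [r' r'0 Hr'] := gnorm_nbhs HG (filterI (near_cinv ix slope) (C1_function_expansion x phiC e0)).
pose t := Num.min r r' / (2 * (tnorm X x v + 1)).
have m0 : 0 < Num.min r r' by rewrite lt_min r0.
have n1 : 0 < 2 * (tnorm X x v + 1) by rewrite mulr_gt0// ltr_wpDl.
have t0 : 0 < t by rewrite divr_gt0.
have tE : t * (2 * (tnorm X x v + 1)) = Num.min r r' by rewrite divfK// gt_eqF.
have E : cmap i x + t *: v - cmap i x = t *: v by rewrite addrC addKr.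
have tv' : tnorm X x (t *: v) = t * tnorm X x v.
  by rewrite !tnorm_gnorm gnormZ// ger0_norm// ltW.
have tv : gnorm (metric X x) (cmap i x + t *: v - cmap i x) = t * tnorm X x v.
  by rewrite E -tv'.
have tvm : t * tnorm X x v < Num.min r r' by rewrite -tE ltr_pM2l//; lra.
have tvr : gnorm (metric X x) (cmap i x + t *: v - cmap i x) < r.
  by rewrite tv (lt_le_trans tvm)// ge_min lexx.
have [|h1 h2] := Hr' (cmap i x + t *: v).
  by rewrite tv (lt_le_trans tvm)// ge_min lexx orbT.
have h3 : d x (cinv i (cmap i x + t *: v)) <= (1 + e) * (t * tnorm X x v).
  have := rdist_le_gnorm (y := cmap i x) ur _ tvr; rewrite -/i cmapK// tv; apply.
  by rewrite subrr gnorm0.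
move: h2; rewrite -/i E tv'.
rewrite (_ : dfun X phi x (t *: v) = t * dfun X phi x v); last exact: linearZ.
rewrite ler_norml => /andP[_ h2].
rewrite -(ler_pM2l t0).
have h4 : k * d x (cinv i (cmap i x + t *: v)) <= k * ((1 + e) * (t * tnorm X x v)).
  by rewrite ler_wpM2l.
lra.
Qed.

(** A test function above u at x decreases from x no faster than u, which is
1-Lipschitz: its slope is at most 1.  A test function below u decreases at least
as fast as u; walking a distance s towards an almost nearest point of the
boundary, which is possible in a length space, decreases u by s up to an
arbitrarily small error: the slope is at least 1. *)
Lemma rdist_set_boundary_viscosity Omega : open Omega ->
  (Omega !=set0 -> boundary Omega !=set0) ->
  viscosity_solution X Omega (fun x => rdist_set X x (boundary Omega)).
Proof.
move=> oO bO; set u := fun x => _.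
have u_bd x : boundary Omega x -> u x = 0.
  move=> bx; apply/le_anti/andP; split.
    by rewrite -(rdistxx X x); exact: rdist_set_le.
  by apply: le_rdist_set => [|y _]; [exists x|exact: rdist_ge0].
split=> //.
- have [neO|eO] := pselect (Omega !=set0).
    by apply: continuous_subspaceT; exact: rdist_set_continuous (bO neO).
  have -> : Omega = set0 by apply/eqP/negPn/negP => /set0P.
  by rewrite closure0; apply/subspace_continuousP => x [].
- move=> x zeta Ox [phi [phiC umin] <-]; have B0 := bO (ex_intro _ x Ox).
  rewrite leNgt; apply/negP => D1; set D := dual_norm _ _ _ in D1.
  pose k := Num.max 2^-1 ((1 + D) / 2).
  have k0 : 0 < k by rewrite lt_max invr_gt0 ltr0n.
  have k1 : k < 1 by rewrite gt_max; apply/andP; split; lra.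
  have Dk : D < k by rewrite lt_max; apply/orP; right; lra.
  have := filterI umin (C1_function_slope phiC k0 Dk).
  move=> h; have [r r0 Hr] := (nbhs_rdist X x _).1 (h _).
  have ux : 0 < u x.
    apply: rdist_set_gt0 => //; first exact: closed_boundary.
    exact: boundary_open_disjoint.
  (* Not beyond the boundary, and inside the ball where the test function works. *)
  pose s := Num.min (u x) (r / 2).
  have s0 : 0 < s by rewrite lt_min ux divr_gt0.
  have sr : s < r.
    by rewrite gt_min; apply/orP; right; rewrite ltr_pdivrMr// ltr_pMr// ltrDl.
  (* The walk of length s loses 2 e in all, by the choice of y and by that of z;
     4 e = s - k s is the gap between u and the test function. *)
  pose e := (1 - k) * s / 4; have e0 : 0 < e by rewrite divr_gt0// mulr_gt0// subr_gt0.
  have [y By xy] := rdist_set_adherent x B0 e0.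
  have uxy : u x <= d x y by exact: rdist_set_le.
  have [|z [xz zy]] := @rdist_between _ _ _ X x y s e _ e0.
    by rewrite (ltW s0)/= (le_trans _ uxy)// ge_min lexx.
  have [h1 h2] := Hr z (le_lt_trans xz sr).
  have uz : u z <= d z y by exact: rdist_set_le.
  have h3 : k * d x z <= k * s by rewrite ler_pM2l.
  have eE : e * 4 = s - k * s by rewrite /e; field.
  rewrite -/(u x) in xy; lra.
- move=> x zeta Ox [phi [phiC umax] <-]; have B0 := bO (ex_intro _ x Ox).
  apply: dual_norm_slope => //; apply: filterS umax => z h; rewrite mul1r.
  have := rdist_set_lip x z B0; rewrite -/(u x) -/(u z); lra.
Qed.

End DistanceToBoundary.

(** * Uniqueness *)

Section Uniqueness.
Variables (R : realType) (H : completeNormedModType R) (M : topologicalType).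
Variables (X : riemannian_manifold H M) (Omega : set M).
Hypotheses (completeM : rcomplete X) (openOmega : open Omega).
Local Notation d := (rdist X).

Lemma within_continuous_rdist (A : set M) (u : M -> R) z e :
  {within A, continuous u} -> A z -> 0 < e ->
  exists2 r, 0 < r & forall w, A w -> d z w < r -> `|u w - u z| < e.
Proof.
move=> /subspace_continuousP uA Az e0.
have := uA z Az; move=> /cvgrPdist_lt/(_ _ e0) h.
have [r r0 Hr] := (nbhs_rdist X z _).1 h.
by exists r => // w Aw zw; rewrite distrC; exact: Hr.
Qed.

Lemma within_continuous_interior (A : set M) (u : M -> R) x :
  {within A, continuous u} -> nbhs x A -> {for x, continuous u}.
Proof.
move=> uA xA; have Ax := nbhs_singleton xA.
apply/cvgrPdist_lt => e e0; have [r r0 Hr] := within_continuous_rdist uA Ax e0.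
by apply: filterS2 xA (near_rdist X x r0) => z Az xz; rewrite distrC; exact: Hr.
Qed.

Variable u : M -> R.
Hypothesis usol : viscosity_solution X Omega u.

Let ucl : {within closure Omega, continuous u}. Proof. by case: usol. Qed.
Let ubd x : boundary Omega x -> u x = 0. Proof. by case: usol => _ + _ _; apply. Qed.

Let ucont x : Omega x -> {for x, continuous u}.
Proof.
move=> Ox; apply: (within_continuous_interior ucl).
by apply: filterS (open_nbhs_nbhs (conj openOmega Ox)); exact: subset_closure.
Qed.

(** Walk from x towards y0, inside the closure of Omega, decreasing d(., y0) at
nearly unit rate while u, locally Lipschitz with a constant close to 1, varies
at most as much.  A maximal walk cannot end inside Omega, where a further step
towards y0 is possible as d is a length metric; so it ends at a point of the
boundary, where u vanishes, after u has varied by at most about d(x, y0). *)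
Lemma viscosity_solution_le x y0 : closure Omega x -> boundary Omega y0 ->
  `|u x| <= d x y0.
Proof.
move=> clx by0.
have Dl x1 x2 : `|d x1 y0 - d x2 y0| <= d x1 x2.
  have h1 := rdist_triangle X x2 x1 y0; have h2 := rdist_triangle X x1 x2 y0.
  by rewrite ler_norml (rdistC X x2 x1) in h2 *; apply/andP; split; lra.
suff key a : 0 < a < 1 -> (1 - a) * `|u x| <= (1 + a) * d x y0.
  apply/ler_addgt0Pr => e e0.
  pose s := `|u x| + d x y0 + 1.
  have s0 : 0 < s by rewrite ltr_wpDl ?addr_ge0 ?rdist_ge0.
  pose a := Num.min 2^-1 (e / s).
  have a0 : 0 < a by rewrite lt_min invr_gt0 ltr0n/= divr_gt0.
  have a12 : a <= 2^-1 by rewrite ge_min lexx.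
  have ae : a * s <= e by rewrite -ler_pdivlMr// ge_min lexx orbT.
  have a01 : 0 < a < 1 by rewrite a0/=; lra.
  have := key a a01; rewrite /s in ae; lra.
move=> /andP[a0 a1].
(* The first clause makes the distance to y0 decrease at nearly unit rate, the
   second makes u vary at most at the same rate up to the factor
   (1 + a) / (1 - a). *)
pose P w z := (1 - a) * d w z <= d w y0 - d z y0 /\
  (1 - a) * `|u w - u z| <= (1 + a) * (d w y0 - d z y0).
have [x' [clx' [Px1 Px2] xmax]] : exists x', [/\ closure Omega x', P x x' &
    forall z, closure Omega z -> P x' z -> z = x'].
  apply: (@maximal_descent R H M X completeM (closure Omega) (fun z => d z y0) P 0 (1 - a)) => //.
  - exact: closed_closure.
  - by rewrite subr_gt0.
  - by move=> z _; exact: rdist_ge0.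
  - by move=> z; rewrite /P rdistxx !subrr normr0 !mulr0.
  - move=> z1 z2 z3 [h1 h2] [h3 h4]; split.
      have := rdist_triangle X z2 z1 z3 => h.
      have : (1 - a) * d z1 z3 <= (1 - a) * (d z1 z2 + d z2 z3).
        by rewrite ler_wpM2l// subr_ge0 ltW.
      lra.
    have := ler_distD (u z2) (u z1) (u z3) => h.
    have : (1 - a) * `|u z1 - u z3| <= (1 - a) * (`|u z1 - u z2| + `|u z2 - u z3|).
      by rewrite ler_wpM2l// subr_ge0 ltW.
    lra.
  - by move=> z1 z2 _ _ [].
  move=> z1 z2 cl1 cl2 Hcl; split; apply/ler_addgt0Pr => e e0;
    have e4 : 0 < e / 4 by rewrite divr_gt0.
    have [w [clw [h1 _] wz]] := Hcl _ e4.
    have h2 := rdist_triangle X w z1 z2.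
    have := Dl w z2; rewrite ler_norml => /andP[h3 h4].
    rewrite (rdistC X w z2) in h2 h3 h4.
    have h5 : (1 - a) * d z1 z2 <= (1 - a) * (d z1 w + d z2 w).
      by rewrite ler_wpM2l// subr_ge0 ltW.
    have h6 : (1 - a) * d z2 w <= d z2 w by rewrite ler_piMl ?rdist_ge0//; lra.
    lra.
  have [r r0 Hr] := within_continuous_rdist ucl cl2 e4.
  have re : 0 < Num.min r (e / 4) by rewrite lt_min r0.
  have [w [clw [_ h1]]] := Hcl _ re; rewrite lt_min => /andP[wr we].
  have h2 := ltW (Hr w clw wr).
  have := Dl w z2; rewrite ler_norml => /andP[h3 _]; rewrite (rdistC X w z2) in h3.
  have h4 : (1 - a) * `|u z1 - u z2| <= (1 - a) * (`|u z1 - u w| + `|u w - u z2|).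
    by rewrite ler_wpM2l ?ler_distD// subr_ge0 ltW.
  have h5 : (1 - a) * `|u w - u z2| <= `|u w - u z2| by rewrite ler_piMl//; lra.
  have h6 : (1 + a) * (d z2 y0 - d w y0) <= (1 + a) * (e / 4).
    by rewrite ler_wpM2l//; lra.
  have h7 : a * (e / 4) <= e / 4 by rewrite ler_piMl// ltW.
  lra.
have [Ox'|bx'] := closure_open openOmega clx'; last first.
  move: Px2; rewrite (ubd bx') subr0 => h; apply: le_trans h _.
  by rewrite ler_wpM2l ?gerBl ?rdist_ge0// addr_ge0// ltW.
exfalso.
have D0 : 0 < d x' y0.
  rewrite lt_neqAle rdist_ge0 andbT; apply/eqP => /esym/rdist_eq0 E.
  by apply: (boundary_open_disjoint openOmega Ox'); rewrite E.
have [_ _ _ usub] := usol.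
have k1 : 1 < 1 + a by rewrite ltrDl.
have [rho rho0 Hlip] := locally_lipschitz openOmega ucont usub Ox' k1.
have [r r0 Hr] := (nbhs_rdist X x' _).1 (open_nbhs_nbhs (conj openOmega Ox')).
(* A step short enough for the Lipschitz estimate and for staying in Omega. *)
pose s := Num.min (d x' y0) (Num.min (rho / 2) (r / 2)).
have s0 : 0 < s by rewrite !lt_min D0 !divr_gt0.
have sD : s <= d x' y0 by rewrite ge_min lexx.
have srho : s <= rho / 2 by rewrite !ge_min lexx orbT.
have sr : s <= r / 2 by rewrite !ge_min lexx !orbT.
have as0 : 0 < a * s / 2 by rewrite divr_gt0// mulr_gt0.
have [|z [xz zy]] := @rdist_between _ _ _ X x' y0 s (a * s / 2) _ as0.
  by rewrite (ltW s0).
have h1 : (1 - a) * d x' z <= (1 - a) * s by rewrite ler_wpM2l// subr_ge0 ltW.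
have h2 : (1 - a) * d x' z <= d x' y0 - d z y0 by lra.
have as1 : a * s < s by rewrite gtr_pMl.
have zx' : z = x'.
  apply: xmax; first by apply: subset_closure; apply: Hr; lra.
  split=> //; have : `|u z - u x'| <= (1 + a) * d x' z by apply: Hlip; lra.
  rewrite distrC => h3.
  have h4 : (1 - a) * `|u x' - u z| <= (1 - a) * ((1 + a) * d x' z).
    by rewrite ler_wpM2l// subr_ge0 ltW.
  have h5 : (1 + a) * ((1 - a) * d x' z) <= (1 + a) * (d x' y0 - d z y0).
    by rewrite ler_wpM2l// addr_ge0// ltW.
  lra.
rewrite zx' in zy; lra.
Qed.

(** Let u decrease from x at nearly unit rate.  By [strict_descent] a maximal descent
cannot end inside Omega; so it ends at a boundary point z, where u vanishes, and
u x is at least about d(x, z). *)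
Lemma viscosity_solution_ge x m : closure Omega x ->
  (forall z, closure Omega z -> m <= u z) ->
  rdist_set X x (boundary Omega) <= u x.
Proof.
move=> clx um; set D := rdist_set _ _ _.
suff key a : 0 < a < 1 -> (1 - a) * D <= u x.
  apply/ler_addgt0Pr => e e0.
  pose a := Num.min 2^-1 (e / (`|D| + 1)).
  have s0 : 0 < `|D| + 1 by rewrite ltr_wpDl.
  have a0 : 0 < a by rewrite lt_min invr_gt0 ltr0n/= divr_gt0.
  have a12 : a <= 2^-1 by rewrite ge_min lexx.
  have ae : a * (`|D| + 1) <= e by rewrite -ler_pdivlMr// ge_min lexx orbT.
  have a01 : 0 < a < 1 by rewrite a0/=; lra.
  have h1 := key a a01.
  have h2 : a * D <= a * `|D| by rewrite ler_pM2l// ler_norm.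
  lra.
move=> /andP[a0 a1].
pose P w z := (1 - a) * d w z <= u w - u z.
have [x' [clx' Px xmax]] : exists x', [/\ closure Omega x', P x x' &
    forall z, closure Omega z -> P x' z -> z = x'].
  apply: (@maximal_descent R H M X completeM (closure Omega) u P m (1 - a)) => //.
  - exact: closed_closure.
  - by rewrite subr_gt0.
  - by move=> z; rewrite /P rdistxx !subrr mulr0.
  - move=> z1 z2 z3 h1 h2; rewrite /P in h1 h2 *.
    have := rdist_triangle X z2 z1 z3 => h.
    have : (1 - a) * d z1 z3 <= (1 - a) * (d z1 z2 + d z2 z3).
      by rewrite ler_wpM2l// subr_ge0 ltW.
    lra.
  move=> z1 z2 cl1 cl2 Hcl; apply/ler_addgt0Pr => e e0.
  have e4 : 0 < e / 4 by rewrite divr_gt0.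
  have [r r0 Hr] := within_continuous_rdist ucl cl2 e4.
  have re : 0 < Num.min r (e / 4) by rewrite lt_min r0.
  have [w [clw h1]] := Hcl _ re; rewrite lt_min => /andP[wr we].
  rewrite /P in h1; have := Hr w clw wr; rewrite ltr_norml => /andP[h2 h3].
  have h4 := rdist_triangle X w z1 z2; rewrite (rdistC X w z2) in h4.
  have h5 : (1 - a) * d z1 z2 <= (1 - a) * (d z1 w + d z2 w).
    by rewrite ler_wpM2l// subr_ge0 ltW.
  have h6 : (1 - a) * d z2 w <= d z2 w by rewrite ler_piMl ?rdist_ge0//; lra.
  lra.
have [Ox'|bx'] := closure_open openOmega clx'; last first.
  move: Px; rewrite /P (ubd bx') subr0 => h; apply: le_trans h.
  by rewrite ler_wpM2l ?subr_ge0 ?(ltW a1)//; exact: rdist_set_le.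
exfalso; have [_ _ usup _] := usol.
have [r r0 Hr] := (nbhs_rdist X x' _).1 (open_nbhs_nbhs (conj openOmega Ox')).
have a01 : 0 < a < 1 by rewrite a0.
have [z zr zu] := strict_descent openOmega ucont usup Ox' a01 r0.
have zx' : z = x'.
  by apply: xmax; [apply: subset_closure; exact: Hr|exact: ltW].
by move: zu; rewrite zx' rdistxx mulr0 subrr ltxx.
Qed.

End Uniqueness.

Theorem theorem6p23 (R : realType) (H : completeNormedModType R)
    (M : topologicalType) (X : riemannian_manifold H M) (Omega : set M)
    (hilbertH : hilbert_norm H)
    (completeM : rcomplete X)
    (openOmega : open Omega)
    (boundedOmega : rbounded X Omega)
    (boundaryOmega : Omega !=set0 -> boundary Omega !=set0) :
  viscosity_solution X Omega (fun x => rdist_set X x (boundary Omega)) /\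
  (uniformly_locally_convex X -> (0 < injectivity_radius X)%E ->
   forall u : M -> R, viscosity_solution X Omega u ->
     forall x, closure Omega x -> u x = rdist_set X x (boundary Omega)).
Proof.
split; first exact: rdist_set_boundary_viscosity.
move=> _ _ u usol x clx.
have Omega0 : Omega !=set0 by have [y [Oy _]] := clx _ filterT; exists y.
have [x0 Ox0] := Omega0; have [y0 by0] := boundaryOmega Omega0.
have [C HC] := boundedOmega.
apply/le_anti/andP; split.
  apply: le_rdist_set; first by exists y0.
  move=> y By; apply: le_trans (ler_norm _) _.
  exact: (viscosity_solution_le completeM openOmega usol).
(* The first inequality bounds |u|, Omega being bounded, by distances to y0;
   this provides the lower bound that the descent of u requires. *)
apply: (@viscosity_solution_ge _ _ _ X Omega completeM openOmega u usol x
  (- (1 + C + rdist X x0 y0)) clx) => z clz.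
have h1 := viscosity_solution_le completeM openOmega usol clz by0.
have [z' Oz' zz'] := (closure_rdist X Omega z).1 clz 1 ltr01.
have h2 := HC z' x0 Oz' Ox0.
have h3 := rdist_triangle X z' z y0; have h4 := rdist_triangle X x0 z' y0.
have := ler_norm (- u z); rewrite normrN; lra.
Qed.
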